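(* Let $\xi_0,\xi_1,\dots$ be nondegenerate i.i.d. complex random variables with $\mathbb{P}(\xi_0=0)=0$ and $\mathbb{E}\log(1+|\xi_0|)<\infty$. Suppose there exist a function $p:[0,\infty)\to[0,\infty)$, a number $T_0\in(0,\infty)$, a sequence of positive integers $L_n\to\infty$, and a sequence of real numbers $\delta_n\in(-T_0,T_0)$ (not necessarily positive) with $\delta_n\to 0$, such that $(T_0-\delta_n)L_n$ is an integer for every $n$, and: (1) $p(t)>0$ for $t\in[0,T_0)$ and $p(t)=0$ for $t>T_0$; (2) $p$ is continuous on $[0,T_0]$; (3) $\lim_{n\to\infty}\sup_{0\le k\le (T_0-\delta_n)L_n}\big|\,|p_{k,n}|^{1/L_n}-p\big(\tfrac{k}{L_n}\wedge T_0\big)\big|=0$, where $p_{k,n}$ are deterministic complex coefficients. Consider the random polynomials $$F_n(z)=\sum_{k=0}^{(T_0-\delta_n)L_n}\xi_k\,p_{k,n}\,z^k .$$ Let $I(s)=\sup_{t\ge 0}\big(st+\log p(t)\big)$ (the Legendre–Fenchel transform of $-\log p$, with $\log 0=-\infty$). Then the random measure $\frac{1}{L_n}\mu_{F_n}$ converges in probability to the deterministic rotationally invariant measure $\mu$ on $\mathbb{C}$ determined by $$\mu(\mathbb{D}_r)=I'(\log r),\qquad r>0,$$ where $I'$ denotes the left derivative of $I$.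
   Context: For a polynomial $f$, $\mu_f=\sum_{z:\,f(z)=0}\delta_z$ is the counting measure of its zeros (with multiplicity). $\mathbb{D}_r$ is the open disk of radius $r$ centered at $0$. $a\wedge b=\min\{a,b\}$. A sequence of random measures $\nu_n$ converges in probability to a deterministic measure $\nu$ if $\int\phi\,d\nu_n\to\int\phi\,d\nu$ in probability for every smooth compactly supported test function $\phi$ on $\mathbb{C}$. *)

(* Defs.v *)
From HB Require Import structures.
From mathcomp Require Import all_boot all_order all_algebra.
From mathcomp Require Import all_classical all_reals all_analysis.
From mathcomp Require Import complex.
Set Implicit Arguments. Unset Strict Implicit. Unset Printing Implicit Defensive.
Import Order.TTheory GRing.Theory Num.Theory.
Import numFieldNormedType.Exports.
Local Open Scope classical_set_scope.
Local Open Scope ring_scope.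

Notation Cx R := (complex.complex R) (only parsing).

Definition toC {R : realType} (z : R * R) : Cx R := complex.Complex z.1 z.2.

Definition cmod {R : realType} (z : R * R) : R := Num.sqrt (z.1 ^+ 2 + z.2 ^+ 2).

(* the multiset of zeros (with multiplicity) of a nonzero polynomial over
   the algebraically closed field R[i]; by convention empty for f = 0 *)
Definition rootseq {R : realType} (f : {poly Cx R}) : seq (Cx R) :=
  if f == 0 then [::] else sval (closed_field_poly_normal f).

(* \int phi d(mu_f) = sum of phi over the zeros of f, counted with
   multiplicity; a test function on C = R^2 is a function phi x y *)
Definition zero_pairing {R : realType} (phi : R -> R -> R) (f : {poly Cx R}) : R :=
  \sum_(z <- rootseq f) phi (complex.Re z) (complex.Im z).

Definition dx {R : realType} (f : R -> R -> R) : R -> R -> R :=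
  fun x y => 'D_1 (fun t => f t y) x.
Definition dy {R : realType} (f : R -> R -> R) : R -> R -> R :=
  fun x y => 'D_1 (fun t => f x t) y.

Fixpoint Ck {R : realType} (k : nat) (f : R -> R -> R) : Prop :=
  continuous (fun z : R * R => f z.1 z.2) /\
  match k with
  | 0 => True
  | k'.+1 => (forall x y, derivable (fun t => f t y) x 1) /\
             (forall x y, derivable (fun t => f x t) y 1) /\
             Ck k' (dx f) /\ Ck k' (dy f)
  end.

Definition smooth {R : realType} (f : R -> R -> R) : Prop := forall k, Ck k f.

Definition compact_support {R : realType} (f : R -> R -> R) : Prop :=
  exists M : R, forall x y, M < cmod (x, y) -> f x y = 0.

Definition disk {R : realType} (r : R) : set (R * R) :=
  [set z | cmod z < r].

Definition rotation {R : realType} (th : R) (z : R * R) : R * R :=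
  (z.1 * cos th - z.2 * sin th, z.1 * sin th + z.2 * cos th).

Definition Ibar {R : realType} (p : R -> R) (s : R) : \bar R :=
  ereal_sup [set e | exists2 t : R, 0 <= t &
     e = if p t == 0 then -oo%E else ((s * t + ln (p t))%:E)].

(* real-valued version (I is finite under the hypotheses) *)
Definition I_LF {R : realType} (p : R -> R) (s : R) : R := fine (Ibar p s).

Definition cabs {R : realType} (z : Cx R) : R := cmod (complex.Re z, complex.Im z).

(* Main.v *)
(* Write [psi e a = ln (max |a| e)] and [U n e w] for [1/L_n] times the sum of
   [ln |lead F_n|] and of [psi e (a - w)] over the zeros [a] of [F_n].  This
   smoothed potential is at least [1/L_n ln |F_n w|] and, by Jensen, at most its
   maximum over the circle of radius [e] around [w].

   With high probability [1/L_n ln |F_n z| <= I (ln |z|) + o(1)] uniformly on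
   compact sets, because [E log (1 + |xi|) < oo] bounds all coefficients at once;
   and for each fixed [z != 0] also [1/L_n ln |F_n z| >= I (ln |z|) - o(1)],
   because the terms [p_k z^k] near the maximum of [p t |z|^t] are many and of
   comparable size, so that by an Erdos-Littlewood-Offord argument their random
   sum does not concentrate.  Hence [U n e w] is close to [I (ln |w|)] at finitely
   many prescribed points [w].

   A test function is uniformly close to a combination of [psi e (a - w_j)] with
   coefficients summing to [0], so the integral against the zeros is read off from
   [U n e w_j].  The limit measure is the rotation invariant one with
   [mu (disk r) = I' (ln r)]; averaging [psi] over circles shows that its
   potential is [I (ln |w|)] up to a constant, so the two limits agree. *)
Require Import Defs.
From HB Require Import structures.
From mathcomp Require Import all_boot all_order all_algebra.
From mathcomp Require Import all_classical all_reals all_analysis.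
From mathcomp Require Import measurable_realfun.
From mathcomp Require Import complex separable cyclic.
From mathcomp Require Import ring lra zify.
Import Order.TTheory GRing.Theory Num.Theory.
Import numFieldNormedType.Exports.
Local Open Scope classical_set_scope.
Local Open Scope ring_scope.
Set Implicit Arguments. Unset Strict Implicit. Unset Printing Implicit Defensive.

(** * Jensen inequality on regular polygons *)

(** Circle means are taken over regular [M]-gons: Jensen's inequality then rests on the vanishing of
    sums of roots of unity, and the errors [ln 2] and [cabs z / e] do not grow with [M], so division
    by [M] removes them. The lower bound on a random polynomial holds only at finitely many
    prescribed points, while zeros lie anywhere; truncation at [e] yields a two-sided bound at each
    centre. The centres depend on [e], so constants are fixed in the order: approximation error,
    bound [C] on the coefficients, tolerance [del], radius [e], centres, bad event, [n]. This is why
    the modulus of continuity of [radial_pot] must be uniform over all radii. The law of [xi] may be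
    discrete or heavy tailed; hence anticoncentration is qualitative and counts the summands that
    move by a definite amount between two sets of positive probability. [I] is never differentiated
    to compute potentials: its slopes, squeezed between least maximisers, determine the measure and
    its potential. Zeros are no explicit function of the coefficients, so measurability of
    [zero_pairing] is recovered from values of the polynomial. *)

Section Modulus.
Context {R : realType}.
Implicit Types z w : R[i].

Lemma cabsE z : cabs z = Normc.normc z. Proof. by case: z. Qed.
Lemma cabs_ge0 z : 0 <= cabs z. Proof. exact: sqrtr_ge0. Qed.
Lemma cabs0 : cabs (0 : R[i]) = 0. Proof. by rewrite cabsE Normc.normc0. Qed.
Lemma cabs1 : cabs (1 : R[i]) = 1. Proof. by rewrite cabsE Normc.normc1. Qed.
Lemma cabsM z w : cabs (z * w) = cabs z * cabs w.
Proof. by rewrite !cabsE Normc.normcM. Qed.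
Lemma cabsD z w : cabs (z + w) <= cabs z + cabs w.
Proof. by rewrite !cabsE le_normcD. Qed.
Lemma cabsN z : cabs (- z) = cabs z.
Proof. by rewrite !cabsE normcN. Qed.
Lemma cabs_eq0 z : (cabs z == 0) = (z == 0).
Proof.
apply/eqP/eqP => [|->]; last exact: cabs0.
by rewrite cabsE => /Normc.eq0_normc.
Qed.
Lemma cabs_gt0 z : (0 < cabs z) = (z != 0).
Proof. by rewrite lt_neqAle cabs_ge0 andbT eq_sym cabs_eq0. Qed.
Lemma cabs_real (x : R) : cabs x%:C%C = `|x|.
Proof. by rewrite /cabs /cmod /= expr0n /= addr0 sqrtr_sqr. Qed.
Lemma cabsX z n : cabs (z ^+ n) = cabs z ^+ n.
Proof. by elim: n => [|n IH]; rewrite ?expr0 ?cabs1// !exprS cabsM IH. Qed.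
Lemma cabs_conj z : cabs z^*%C = cabs z.
Proof. by case: z => a b; rewrite /cabs /cmod /= sqrrN. Qed.
Lemma cabsB_sym z w : cabs (z - w) = cabs (w - z).
Proof. by rewrite -cabsN opprB. Qed.
Lemma cabsB_ge z w : cabs z - cabs w <= cabs (z - w).
Proof. by rewrite lerBlDr; have := cabsD (z - w) w; rewrite subrK. Qed.
Lemma cabs_prod (I : Type) (r : seq I) (F : I -> R[i]) :
  cabs (\prod_(i <- r) F i) = \prod_(i <- r) cabs (F i).
Proof. exact: (big_morph (@cabs R) cabsM cabs1). Qed.
Lemma cabs_sum (I : Type) (r : seq I) (F : I -> R[i]) :
  cabs (\sum_(i <- r) F i) <= \sum_(i <- r) cabs (F i).
Proof.
elim/big_ind2: _ => [|x1 x2 y1 y2 h1 h2|//]; first by rewrite cabs0.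
by apply: le_trans (cabsD _ _) _; apply: lerD.
Qed.
Lemma conjc_mul z : z * z^*%C = (cabs z ^+ 2)%:C%C.
Proof.
case: z => a b; rewrite /cabs /cmod sqr_sqrtr ?addr_ge0 ?sqr_ge0//=.
by apply/eqP; rewrite eq_complex /=; apply/andP; split; apply/eqP; ring.
Qed.

Lemma Re_le_cabs z : `|complex.Re z| <= cabs z.
Proof. by rewrite -sqrtr_sqr /cabs /cmod ler_sqrt ?lerDl ?addr_ge0 ?sqr_ge0. Qed.
Lemma Im_le_cabs z : `|complex.Im z| <= cabs z.
Proof. by rewrite -sqrtr_sqr /cabs /cmod ler_sqrt ?lerDr ?addr_ge0 ?sqr_ge0. Qed.
Lemma cabs_le_ReIm z : cabs z <= `|complex.Re z| + `|complex.Im z|.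
Proof.
rewrite /cabs /cmod /= -[leRHS]ger0_norm ?addr_ge0// -[leRHS]sqrtr_sqr.
rewrite ler_sqrt ?sqr_ge0// sqrrD !real_normK ?num_real//.
by rewrite -addrA (addrC (_ *+ 2)) addrA lerDl mulrn_wge0// mulr_ge0.
Qed.

(** In characteristic 0 the polynomial ['X^n - 1] is separable, so it has [n] distinct roots, and
    [n] distinct [n]-th roots of unity always include a primitive one. *)
Lemma prim_root_exists_C n : (0 < n)%N -> exists z : R[i], n.-primitive_root z.
Proof.
move=> n0; pose p : {poly R[i]} := 'X^n - 1%:P.
have [r Dp] := closed_field_poly_normal p.
have mp : p \is monic by rewrite monicXnsubC.
rewrite (monicP mp) scale1r in Dp.
have sr : size r = n.
  by have := size_XnsubC (1 : R[i]) n0; rewrite -/p Dp size_prod_XsubC => -[].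
have ur : all n.-unity_root r.
  apply/allP => x xr; rewrite -[n.-unity_root x]/(root _ x) -[_ - _]/p Dp.
  by rewrite root_prod_XsubC.
have sepp : separable_poly p.
  rewrite unlock derivB derivXn derivC subr0.
  have n1 : (n%:R : R[i]) != 0 by rewrite pnatr_eq0 -lt0n.
  (* Bezout relation with the derivative: [- ('X^n - 1) + ('X / n) * (n 'X^(n-1)) = 1]. *)
  apply/Bezout_eq1_coprimepP; exists (- 1, n%:R^-1 *: 'X) => /=.
  rewrite mulN1r -scalerAl mulrnAr -exprS prednK//.
  rewrite -[X in _ *: X](scaler_nat n ('X^n : {poly R[i]})).
  by rewrite scalerA mulVf// scale1r /p opprB subrK.
have un : uniq r by rewrite -separable_prod_XsubC -Dp.
have /hasP[z _ pz] := has_prim_root n0 ur un (eq_leq (esym sr)).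
by exists z.
Qed.

Lemma cabs_prim n z : (0 < n)%N -> n.-primitive_root z -> cabs z = 1.
Proof.
move=> n0 /prim_expr_order zn.
have := congr1 (@cabs R) zn; rewrite cabsX cabs1 => /eqP.
by rewrite pexpr_eq1 ?cabs_ge0// => /eqP.
Qed.

End Modulus.

Section Jensen.
Context {R : realType}.
Implicit Types (z w a c zeta : R[i]) (e : R).

Lemma sum_prim_root T zeta i : T.-primitive_root zeta -> (0 < i < T)%N ->
  \sum_(l < T) (zeta ^+ l) ^+ i = 0.
Proof.
move=> pz /andP[i0 iT].
have zi : zeta ^+ i - 1 != 0.
  by rewrite subr_eq0 -(prim_order_dvd pz) gtnNdvd.
apply: (mulfI zi); rewrite mulr0.
under eq_bigr do rewrite -exprM mulnC exprM.
by rewrite -subrX1 -exprM mulnC exprM (prim_expr_order pz) expr1n subrr.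
Qed.

(** Discrete mean value property: as the degree is below [T], every nonconstant monomial sums to 0
    over the [T]-th roots of unity. *)
Lemma horner_circle_mean T zeta (G : {poly R[i]}) x :
  (0 < T)%N -> T.-primitive_root zeta -> (size G <= T)%N ->
  \sum_(l < T) G.[x * zeta ^+ l] = T%:R * G.[0].
Proof.
move=> T0 pz sG.
under eq_bigr do rewrite (horner_coef_wide _ sG).
rewrite exchange_big /=.
case: T T0 pz sG => // T _ pz sG.
rewrite big_ord_recl [X in _ + X]big1 ?addr0 => [|i _].
  under eq_bigr do rewrite expr0 mulr1.
  by rewrite sumr_const card_ord mulr_natl horner_coef0.
under eq_bigr do rewrite exprMn mulrA.
by rewrite -mulr_sumr (sum_prim_root pz) ?mulr0 //= /bump /= add1n ltnS ltn_ord.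
Qed.

Lemma exists_circle_ge T zeta (G : {poly R[i]}) x :
  (0 < T)%N -> T.-primitive_root zeta -> (size G <= T)%N ->
  exists2 l, (l < T)%N & cabs G.[0] <= cabs G.[x * zeta ^+ l].
Proof.
move=> T0 pz sG.
case: (pselect (exists2 l, (l < T)%N & cabs G.[0] <= cabs G.[x * zeta ^+ l])) => // h.
have h1 (l : 'I_T) : cabs G.[x * zeta ^+ l] < cabs G.[0].
  by rewrite ltNge; apply/negP => h2; apply: h; exists l.
have := congr1 (@cabs R) (horner_circle_mean x T0 pz sG).
rewrite cabsM -[T%:R](rmorph_nat (real_complex R)) cabs_real ger0_norm// => h2.
have : cabs (\sum_(l < T) G.[x * zeta ^+ l]) < T%:R * cabs G.[0].
  apply: le_lt_trans (cabs_sum _ _) _.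
  rewrite mulr_natl -[T in X in _ < X](card_ord T) -sumr_const.
  apply: ltr_sum => //; by apply/hasP; exists (Ordinal T0); rewrite ?mem_index_enum ?h1.
by rewrite h2 ltxx.
Qed.

(* Roots inside the circle are reflected (Blaschke factors): this changes
   neither the modulus on the circle nor the degree. *)
Lemma jensen_circle T zeta (rs : seq R[i]) c w e :
  0 < e -> T.-primitive_root zeta -> (size rs < T)%N ->
  exists2 l, (l < T)%N &
    cabs c * \prod_(a <- rs) Num.max (cabs (a - w)) e
    <= cabs (c * \prod_(a <- rs) (w + e%:C%C * zeta ^+ l - a)).
Proof.
move=> e0 pz sT.
have T0 : (0 < T)%N by case: T sT pz.
pose g a : {poly R[i]} := if e <= cabs (a - w) then 'X - (a - w)%:P
  else e%:C%C%:P - ((a - w)^*%C / e%:C%C) *: 'X.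
pose G := c%:P * \prod_(a <- rs) g a.
have eC : e%:C%C != 0 :> R[i] by rewrite (inj_eq (@complexI R)) gt_eqF.
have sg a : (size (g a) <= 2)%N.
  rewrite /g; case: ifP => _; first by rewrite size_XsubC.
  apply: leq_trans (size_polyD _ _) _; rewrite geq_max size_polyN.
  rewrite (leq_trans (size_polyC_leq1 _))//=.
  by apply: leq_trans (size_scale_leq _ _) _; rewrite size_polyX.
have sG : (size G <= T)%N.
  apply: leq_trans sT.
  suff h : (size (\prod_(a <- rs) g a)%R <= (size rs).+1)%N.
    rewrite /G mul_polyC; exact: leq_trans (size_scale_leq _ _) h.
  elim: (rs) => [|a s IH]; first by rewrite big_nil size_poly1.
  rewrite big_cons; apply: leq_trans (size_polyMleq _ _) _.
  by have := sg a; move: IH => /=; lia.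
have [l lT hl] := exists_circle_ge e%:C%C T0 pz sG; exists l => //.
have E0 : cabs G.[0] = cabs c * \prod_(a <- rs) Num.max (cabs (a - w)) e.
  rewrite /G hornerM hornerC cabsM horner_prod cabs_prod; congr (_ * _).
  apply: eq_bigr => a _; rewrite /g; case: ifP => h.
    by rewrite hornerXsubC sub0r cabsN (max_idPl h).
  rewrite !hornerE ?mulr0 ?oppr0 ?addr0 cabs_real ger0_norm ?ltW//.
  by rewrite (max_idPr _)// ltW// ltNge h.
have y1 : cabs (e%:C%C * zeta ^+ l) = e.
  by rewrite cabsM cabsX (cabs_prim T0 pz) expr1n mulr1 cabs_real ger0_norm ?ltW.
have E1 : cabs G.[e%:C%C * zeta ^+ l] =
    cabs (c * \prod_(a <- rs) (w + e%:C%C * zeta ^+ l - a)).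
  rewrite /G hornerM hornerC !cabsM horner_prod !cabs_prod; congr (_ * _).
  move: (e%:C%C * zeta ^+ l) y1 => y y1.
  apply: eq_bigr => a _; rewrite /g; case: ifP => h.
    by rewrite hornerXsubC; congr cabs; ring.
  rewrite hornerD hornerN hornerC hornerZ hornerX.
  have -> : w + y - a = y - (a - w) by ring.
  move: (a - w) h => b h.
  (* Uses [y * y^* = e ^+ 2] on the circle; taking moduli and cancelling [e] shows that the
     reflected factor has the modulus of [y - b]. *)
  have E : (e%:C%C - b^*%C / e%:C%C * y) * e%:C%C = (y - b)^*%C * y.
    have := conjc_mul y; rewrite y1 rmorphXn /= => yy.
    rewrite rmorphB /= !mulrBl (mulrAC _ y) divfK// -expr2 -yy.
    by rewrite (mulrC y).
  move: (congr1 (@cabs R) E); rewrite !cabsM cabs_conj y1 cabs_real gtr0_norm//.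
  by move/(mulIf (lt0r_neq0 e0)).
by rewrite -E0 -E1.
Qed.

(** Homogeneous form of the factorisation of ['X^M - 1], evaluated at [y / a]; this division is why
    [a = 0] is treated apart. *)
Lemma prod_sub_prim M zeta y a : (0 < M)%N -> M.-primitive_root zeta ->
  \prod_(k < M) (y - a * zeta ^+ k) = y ^+ M - a ^+ M.
Proof.
move=> M0 pz; have [->|a0] := eqVneq a 0.
  under eq_bigr do rewrite mul0r subr0.
  by rewrite prodr_const card_ord expr0n gtn_eqF// subr0.
have := congr1 (horner^~ (y / a)) (factor_Xn_sub_1 pz).
rewrite horner_prod big_mkord !hornerE => /(congr1 ( *%R (a ^+ M))).
rewrite mulrBr mulr1 -exprMn mulrCA divff// mulr1 => <-.
rewrite -[in a ^+ M](card_ord M) -prodr_const -big_split /=.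
by apply: eq_bigr => k _; rewrite !hornerE mulrBr mulrCA divff// mulr1.
Qed.

Definition psi e (a : R[i]) : R := ln (Num.max (cabs a) e).

Lemma max_gt0 e x : 0 < e -> 0 < Num.max x e.
Proof. by move=> e0; rewrite lt_max e0 orbT. Qed.

Lemma ln_prod_psi (rs : seq R[i]) w e : 0 < e ->
  ln (\prod_(a <- rs) Num.max (cabs (a - w)) e) = \sum_(a <- rs) psi e (a - w).
Proof.
move=> e0; elim: rs => [|a s IH]; first by rewrite !big_nil ln1.
rewrite !big_cons lnM ?IH//; first exact: max_gt0.
by rewrite posrE; apply: prodr_gt0 => b _; exact: max_gt0.
Qed.

(** Since the maximum is at least [e], a displacement of [z] multiplies it by at most
    [1 + cabs (z - z') / e]: [psi e] is Lipschitz with constant [1 / e]. *)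
Lemma psi_shift e z z' : 0 < e -> psi e z <= psi e z' + cabs (z - z') / e.
Proof.
move=> e0; set m := Num.max (cabs z') e.
have m0 : 0 < m by exact: max_gt0.
have d0 : 0 <= cabs (z - z') / e by rewrite divr_ge0 ?cabs_ge0// ltW.
have h : Num.max (cabs z) e <= m * (1 + cabs (z - z') / e).
  rewrite mulrDr mulr1.
  have h2 : cabs (z - z') <= m * (cabs (z - z') / e).
    rewrite mulrCA ler_peMr ?cabs_ge0// ler_pdivlMr// mul1r.
    by rewrite le_max lexx orbT.
  rewrite ge_max; apply/andP; split.
    rewrite -{1}(subrK z' z); apply: le_trans (cabsD _ _) _.
    by rewrite addrC; apply: lerD => //; rewrite le_max lexx.
  by apply: le_trans (_ : m <= _); rewrite ?le_max ?lexx ?orbT// lerDl mulr_ge0 // ltW.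
rewrite /psi; apply: le_trans (_ : ln (m * (1 + cabs (z - z') / e)) <= _).
  by rewrite ler_ln ?posrE ?mulr_gt0 ?max_gt0// ltr_pwDl.
rewrite lnM ?posrE//; last by rewrite ltr_pwDl.
rewrite lerD2l; apply: le_trans (le_ln1Dx _) _ => //.
by apply: lt_le_trans d0; rewrite ltrN10.
Qed.

Lemma ler_psi e e' z : 0 < e -> e <= e' -> psi e z <= psi e' z.
Proof.
move=> e0 ee; rewrite /psi ler_ln ?posrE ?max_gt0 ?(lt_le_trans e0)//.
by rewrite ge_max !le_max lexx ee orbT.
Qed.

Lemma ln_le_psi e z : 0 < e -> z != 0 -> ln (cabs z) <= psi e z.
Proof.
move=> e0; rewrite -cabs_gt0 => z0.
by rewrite /psi ler_ln ?posrE ?max_gt0// le_max lexx.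
Qed.

Lemma psiN e z : psi e (- z) = psi e z. Proof. by rewrite /psi cabsN. Qed.

(** Jensen applied to [y ^+ M - a ^+ M], whose roots are the vertices: on the circle of radius [e]
    around [z] both powers are at most [m ^+ M], hence the single [ln 2], whatever [M] is. *)
Lemma psi_avg_le M zeta e z a : (0 < M)%N -> M.-primitive_root zeta -> 0 < e ->
  \sum_(k < M) psi e (z - a * zeta ^+ k)
    <= M%:R * ln (Num.max (cabs a) (cabs z + e)) + ln 2.
Proof.
move=> M0 pz e0.
(* With [M] roots, Jensen needs a polygon of more than [M] vertices. *)
have [eta peta] := @prim_root_exists_C R M.+1 isT.
pose rs := [seq a * zeta ^+ (val k) | k <- index_enum 'I_M].
have srs : (size rs < M.+1)%N by rewrite size_map -sum1_size big_const_ord iter_addn_0 mul1n.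
have [l _] := jensen_circle 1 z e0 peta srs.
rewrite cabs1 !mul1r big_map => h.
set y := z + _ in h.
have hy : cabs y <= cabs z + e.
  apply: le_trans (cabsD _ _) _; rewrite cabsM cabsX (cabs_prim _ peta)//.
  by rewrite expr1n mulr1 cabs_real gtr0_norm.
rewrite [X in cabs X]big_map prod_sub_prim// in h.
set m := Num.max (cabs a) _.
have m0 : 0 < m by apply: max_gt0; rewrite ltr_wpDl ?cabs_ge0.
have h2 : \prod_(k < M) Num.max (cabs (a * zeta ^+ k - z)) e <= 2 * m ^+ M.
  apply: le_trans h _; apply: le_trans (cabsD _ _) _.
  rewrite cabsN !cabsX mulr_natl mulr2n; apply: lerD; apply: lerXn2r;
    rewrite ?nnegrE ?cabs_ge0 ?(ltW m0)// /m le_max ?lexx ?hy ?orbT//.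
move: h2; rewrite -ler_ln ?posrE; first last.
- by rewrite mulr_gt0// exprn_gt0.
- by apply: prodr_gt0 => k _; exact: max_gt0.
rewrite lnM ?posrE ?exprn_gt0// lnXn// addrC mulr_natl.
apply: le_trans; rewrite le_eqVlt; apply/orP; left; apply/eqP.
have := ln_prod_psi rs z e0; rewrite !big_map => ->.
by apply: eq_bigr => k _; rewrite -psiN opprB.
Qed.

(** At [z] itself the product over the vertices may be tiny. It is evaluated at a better point [z'],
    and each of the [M] terms pays the Lipschitz cost of going back to [z]. *)
Lemma psi_avg_ge_shift M zeta e z z' a B :
  (0 < M)%N -> M.-primitive_root zeta -> 0 < e -> 0 < B ->
  B <= cabs (z' ^+ M - a ^+ M) ->
  ln B - M%:R * (cabs (z' - z) / e) <= \sum_(k < M) psi e (z - a * zeta ^+ k).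
Proof.
move=> M0 pz e0 B0 hB.
have h0 : z' ^+ M - a ^+ M != 0 by rewrite -cabs_gt0 (lt_le_trans B0).
have hk (k : 'I_M) : z' - a * zeta ^+ k != 0.
  apply: contra h0 => /eqP h; rewrite -(prod_sub_prim z' a M0 pz).
  by apply/prodf_eq0; exists k => //; rewrite h.
apply: le_trans (_ : ln (cabs (z' ^+ M - a ^+ M)) - M%:R * (cabs (z' - z) / e) <= _).
  by rewrite lerD2r ler_ln// posrE// cabs_gt0.
rewrite -(prod_sub_prim z' a M0 pz) cabs_prod mulr_natl.
have -> : ln (\prod_(i < M) cabs (z' - a * zeta ^+ i)) =
    \sum_(i < M) ln (cabs (z' - a * zeta ^+ i)).
  suff [] : 0 < \prod_(i < M) cabs (z' - a * zeta ^+ i) /\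
    ln (\prod_(i < M) cabs (z' - a * zeta ^+ i)) =
    \sum_(i < M) ln (cabs (z' - a * zeta ^+ i)) by [].
  elim/big_rec2 : _ => [|i s p _ [p0 IH]]; first by rewrite ln1.
  by rewrite lnM ?posrE ?cabs_gt0// IH mulr_gt0 ?cabs_gt0.
rewrite -[M in _ *+ M](card_ord M) -sumr_const -sumrB.
apply: ler_sum => i _; rewrite lerBlDr.
apply: le_trans (ln_le_psi e0 (hk i)) _.
apply: le_trans (psi_shift _ (z - a * zeta ^+ i) e0) _.
by rewrite lerD2l (_ : z' - _ - _ = z' - z)//; ring.
Qed.

Lemma bernoulli_le (x : R) n : 0 <= x -> 1 + n%:R * x <= (1 + x) ^+ n.
Proof.
move=> x0; elim: n => [|n IH]; first by rewrite expr0 mul0r addr0.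
rewrite exprS; apply: le_trans (ler_wpM2l _ IH); last by rewrite addr_ge0.
rewrite mulrDl mul1r mulrDr mulr1 -natr1 mulrDl mul1r addrA lerD2l lerDl.
by rewrite !mulr_ge0.
Qed.

(** A radial move of [z] by the factor [1 + 1/M] or [1 - 1/M] changes [cabs z ^+ M] by a factor of
    at least 2, which separates it from [cabs a ^+ M]; the [M] Lipschitz costs add up to
    [cabs z / e], free of [M]. The minimum serves two uses: [a] fixed with [z] unbounded, and [z]
    fixed with [a] unbounded. *)
Lemma psi_avg_ge M zeta e z a :
  (0 < M)%N -> M.-primitive_root zeta -> 0 < e -> 0 < Num.max (cabs a) (cabs z) ->
  M%:R * ln (Num.max (cabs a) (cabs z)) - ln 2
    - Num.min (cabs z) (2 * cabs a) / e
    <= \sum_(k < M) psi e (z - a * zeta ^+ k).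
Proof.
move=> M0 pz e0; set m := Num.max _ _ => m0.
have MR0 : 0 < M%:R :> R by rewrite ltr0n.
have B0 : 0 < m ^+ M / 2 by rewrite divr_gt0// exprn_gt0.
(* Three choices of [z']: inwards if [cabs z < cabs a], outwards if
   [cabs a <= cabs z <= 2 * cabs a], and [z] itself, at no cost, beyond that. *)
suff [z' h1 h2] : exists2 z', m ^+ M / 2 <= cabs (z' ^+ M - a ^+ M) &
    M%:R * cabs (z' - z) <= Num.min (cabs z) (2 * cabs a).
  apply: le_trans _ (psi_avg_ge_shift z M0 pz e0 B0 h1).
  rewrite lnM ?posrE ?exprn_gt0// lnXn// lnV ?posrE// mulr_natl.
  by rewrite lerD2l lerN2 mulrA ler_pM2r ?invr_gt0.
have bern : 2 <= (1 + M%:R^-1) ^+ M :> R.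
  apply: le_trans _ (bernoulli_le _ _); last by rewrite invr_ge0 ler0n.
  by rewrite mulfV ?gt_eqF.
(* Follows from the previous bound because [(1 - x) * (1 + x) <= 1]. *)
have bern' : (1 - M%:R^-1) ^+ M <= 2^-1 :> R.
  have M1 : M%:R^-1 <= 1 :> R by rewrite invf_le1// ler1n.
  rewrite -[leRHS]mul1r ler_pdivlMr//.
  apply: le_trans (ler_wpM2l _ bern) _; first by rewrite exprn_ge0// subr_ge0.
  have M2 : 0 <= M%:R^-1 :> R by rewrite invr_ge0 ler0n.
  by rewrite -exprMn exprn_ile1//; nra.
have dist (t : R) : `|t - 1| = M%:R^-1 ->
    M%:R * cabs (z * t%:C%C - z) = cabs z.
  move=> ht; rewrite -{2}[z]mulr1 -mulrBr cabsM.
  by rewrite -(rmorph1 (real_complex R)) -rmorphB/= cabs_real ht mulrCA mulfV ?mulr1 ?gt_eqF.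
have [az|za] := leP (cabs a) (cabs z); last first.
  have mE : m = cabs a by rewrite /m (max_idPl (ltW za)).
  exists (z * (1 - M%:R^-1)%:C%C).
    rewrite cabsB_sym; apply: le_trans _ (cabsB_ge _ _).
    rewrite exprMn cabsM !cabsX cabs_real ger0_norm; last first.
      by rewrite subr_ge0 invf_le1// ler1n.
    have h : cabs z ^+ M * (1 - M%:R^-1) ^+ M <= m ^+ M * 2^-1.
      apply: ler_pM => //; rewrite ?exprn_ge0 ?cabs_ge0//.
        by rewrite subr_ge0 invf_le1// ler1n.
      by rewrite mE; apply: lerXn2r; rewrite ?nnegrE ?cabs_ge0// ltW.
    rewrite lerBrDr; apply: le_trans (lerD (lexx _) h) _.
    by rewrite -mE -splitr.
  rewrite dist; last by rewrite addrAC subrr sub0r normrN ger0_norm// invr_ge0 ler0n.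
  rewrite le_min lexx/= mulr_natl mulr2n.
  by apply: le_trans (ltW za) _; rewrite lerDl cabs_ge0.
have mE : m = cabs z by rewrite /m (max_idPr az).
have [za|za] := leP (cabs z) (2 * cabs a).
  exists (z * (1 + M%:R^-1)%:C%C).
    apply: le_trans _ (cabsB_ge _ _).
    rewrite exprMn cabsM !cabsX cabs_real ger0_norm ?addr_ge0 ?invr_ge0//.
    have h1 : m ^+ M * 2 <= cabs z ^+ M * (1 + M%:R^-1) ^+ M.
      by rewrite mE ler_wpM2l// exprn_ge0// cabs_ge0.
    have h2 : cabs a ^+ M <= m ^+ M.
      by rewrite mE; apply: lerXn2r; rewrite ?nnegrE ?cabs_ge0.
    have : 0 < m ^+ M by rewrite exprn_gt0.
    by move: h1 h2; lra.
  rewrite dist//.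
  by rewrite addrAC subrr add0r ger0_norm// invr_ge0 ler0n.
exists z.
  apply: le_trans _ (cabsB_ge _ _); rewrite !cabsX.
  have h2 : cabs a ^+ M <= (m / 2) ^+ M.
    apply: lerXn2r; rewrite ?nnegrE ?cabs_ge0 ?divr_ge0 ?(ltW m0)//.
    by rewrite ler_pdivlMr// mulrC mE ltW.
  have h3 : (m / 2) ^+ M <= m ^+ M / 2.
    rewrite exprMn ler_wpM2l ?exprn_ge0 ?(ltW m0)//.
    by case: (M) M0 => // k _; rewrite exprS ler_piMr// exprn_ile1//; lra.
  by rewrite -mE; lra.
by rewrite subrr cabs0 mulr0 mulr_ge0 ?cabs_ge0.
Qed.

End Jensen.

(** * Approximation by logarithmic potentials *)

Section Approximation.
Context {R : realType}.
Implicit Types (F H : R[i] -> R) (e r eps : R) (cs : seq (R * R[i])) (a z w : R[i]).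

Definition combo cs e a : R := \sum_(q <- cs) q.1 * psi e (a - q.2).

(* The centres avoid [0], where a random polynomial reduces to a single term and
   anticoncentration says nothing, and the coefficients sum to [0], so that [ln] of the leading
   coefficient cancels.  [C] must not depend on [e]: this lets [e] tend to [0]. *)
Definition potential_approx F := forall eps, 0 < eps ->
  exists2 C, 0 <= C & exists2 e0, 0 < e0 & forall e, 0 < e < e0 ->
  exists cs, [/\ all (fun q => q.2 != 0) cs, \sum_(q <- cs) q.1 = 0,
    \sum_(q <- cs) `|q.1| <= C & forall a, `|F a - combo cs e a| <= eps].

Lemma combo_cat cs1 cs2 e a : combo (cs1 ++ cs2) e a = combo cs1 e a + combo cs2 e a.
Proof. exact: big_cat. Qed.

Definition scale_coefs (k : R) cs := [seq (k * q.1, q.2) | q <- cs].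

Lemma combo_scale k cs e a : combo (scale_coefs k cs) e a = k * combo cs e a.
Proof.
by rewrite /combo big_map mulr_sumr; apply: eq_bigr => q _ /=; rewrite mulrA.
Qed.

Lemma potential_approxD F H : potential_approx F -> potential_approx H ->
  potential_approx (fun a => F a + H a).
Proof.
move=> hF hH eps eps0; have e20 : 0 < eps / 2 by rewrite divr_gt0.
have [C1 C10 [e1 e10 h1]] := hF _ e20; have [C2 C20 [e2 e20' h2]] := hH _ e20.
exists (C1 + C2); first exact: addr_ge0.
exists (Num.min e1 e2); first by rewrite lt_min e10.
move=> e /andP[ee0]; rewrite lt_min => /andP[ee1 ee2].
have [|cs1 [nz1 s1 a1 ap1]] := h1 e; first by rewrite ee0.
have [|cs2 [nz2 s2 a2 ap2]] := h2 e; first by rewrite ee0.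
exists (cs1 ++ cs2); split; rewrite ?all_cat ?nz1// ?big_cat /= ?s1 ?s2 ?addr0//.
  exact: lerD.
move=> a; rewrite combo_cat (splitr eps).
have -> : F a + H a - (combo cs1 e a + combo cs2 e a) =
  (F a - combo cs1 e a) + (H a - combo cs2 e a) by ring.
by apply: le_trans (ler_normD _ _) _; apply: lerD.
Qed.

Lemma potential_approxZ k F : potential_approx F -> potential_approx (fun a => k * F a).
Proof.
move=> hF eps eps0.
have k0 : 0 < `|k| + 1 by rewrite ltr_wpDl.
have [C C0 [e1 e10 h1]] := hF _ (divr_gt0 eps0 k0).
exists (`|k| * C); first by rewrite mulr_ge0.
exists e1 => // e he; have [cs [nz s1 a1 ap1]] := h1 e he.
exists (scale_coefs k cs); split.
- by rewrite /scale_coefs all_map; apply: sub_all nz => q.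
- by rewrite big_map /= -mulr_sumr s1 mulr0.
- rewrite big_map /=; under eq_bigr do rewrite normrM.
  by rewrite -mulr_sumr ler_wpM2l.
move=> a; rewrite combo_scale -mulrBr normrM.
have := ap1 a; rewrite ler_pdivlMr//; apply: le_trans.
by rewrite mulrC ler_wpM2l// lerDl.
Qed.

Lemma potential_approx0 : potential_approx (fun=> 0).
Proof.
move=> eps eps0; exists 0 => //; exists 1 => // e _; exists [::].
split; rewrite ?big_nil// => a.
by rewrite /combo big_nil subrr normr0 ltW.
Qed.

Lemma potential_approx_sum (I : Type) (s : seq I) (F : I -> R[i] -> R) :
  (forall i, potential_approx (F i)) ->
  potential_approx (fun a => \sum_(i <- s) F i a).
Proof.
move=> h; elim: s => [|i s IH].
  rewrite (_ : (fun a => _) = fun=> 0); first exact: potential_approx0.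
  by apply/funext => a; rewrite big_nil.
rewrite (_ : (fun a => _) = fun a => F i a + \sum_(j <- s) F j a).
  exact: potential_approxD.
by apply/funext => a; rewrite big_cons.
Qed.

Lemma potential_approx_lim F :
  (forall eps, 0 < eps -> exists2 H, potential_approx H & forall a, `|F a - H a| <= eps) ->
  potential_approx F.
Proof.
move=> h eps eps0; have e20 : 0 < eps / 2 by rewrite divr_gt0.
have [H aH hH] := h _ e20; have [C C0 [e1 e10 h1]] := aH _ e20.
exists C => //; exists e1 => // e he; have [cs [nz s1 a1 ap1]] := h1 e he.
exists cs; split=> // a; rewrite (splitr eps).
rewrite (_ : F a - _ = (F a - H a) + (H a - combo cs e a)); last by ring.
by apply: le_trans (ler_normD _ _) _; apply: lerD.
Qed.

Lemma psi_lip e z z' : 0 < e -> `|psi e z - psi e z'| <= cabs (z - z') / e.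
Proof.
move=> e0; rewrite ler_norml lerBlDl (psi_shift _ _ e0) andbT.
by rewrite lerNl opprB lerBlDl cabsB_sym psi_shift.
Qed.

(** [psi r (a - w)] is the mean of [ln (cabs (a - q))] over the circle of radius [r] around [w]; the
    combination puts weight [1 / M] on [M] vertices. Positive weights keep the total mass equal to 1
    although [M] grows as [e] shrinks. *)
Lemma potential_circle w r eps : 0 < r -> 0 < eps ->
  exists2 e0, 0 < e0 & forall e, 0 < e < e0 ->
  exists cs, [/\ all (fun q => q.2 != 0) cs, \sum_(q <- cs) q.1 = 1,
    \sum_(q <- cs) `|q.1| = 1 & forall a, `|psi r (a - w) - combo cs e a| <= eps].
Proof.
(* One third each for the polygon error, for the enlargement of the radius by [e < d * r], and for
   moving a vertex off the origin. *)
move=> r0 eps0; pose d := eps / 3; have d0 : 0 < d by rewrite divr_gt0.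
exists (d * r) => [|e /andP[e0 ee0]]; first by rewrite mulr_gt0.
(* With [M >= B] the errors of [psi_avg_le] and [psi_avg_ge], divided by [M], are at most [d]. *)
pose B := (ln 2 + 2 * r / e) / d.
have B0 : 0 <= B.
  by rewrite divr_ge0 ?(ltW d0)// addr_ge0 ?ln_ge0 ?ler1n ?divr_ge0 ?mulr_ge0 // ltW.
pose M := (Num.truncn B).+1.
have BM : B <= M%:R by rewrite ltW// truncnS_gt.
have M0 : 0 < M%:R :> R by rewrite ltr0n.
have [zeta pz] := @prim_root_exists_C R M isT.
(* A vertex at the origin is replaced by this point; by the Lipschitz bound [1 / e] this costs at
   most [d]. *)
pose t : R[i] := (d * e)%:C%C.
have t0 : t != 0 by rewrite (inj_eq (@complexI R)) mulf_neq0 ?gt_eqF.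
pose nz z := if z == 0 then t else z.
have nzE z : cabs (z - nz z) / e <= d.
  rewrite /nz; case: eqP => [->|_]; last by rewrite subrr cabs0 mul0r ltW.
  by rewrite sub0r cabsN cabs_real gtr0_norm ?mulr_gt0// mulfK ?gt_eqF.
exists [seq (M%:R^-1, nz (w + r%:C%C * zeta ^+ val k)) | k <- index_enum 'I_M]; split.
- rewrite all_map; apply/allP => k _ /=; rewrite /nz.
  by case: ifP => // ->.
- by rewrite big_map /= sumr_const card_ord -[LHS]mulr_natl mulfV ?gt_eqF.
- rewrite big_map /= ger0_norm ?invr_ge0 ?ltW//.
  by rewrite sumr_const card_ord -[LHS]mulr_natl mulfV ?gt_eqF.
move=> a; rewrite /combo big_map /=.
rewrite -mulr_sumr; set S := \sum_(k < M) _.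
pose S' := \sum_(k < M) psi e (a - w - r%:C%C * zeta ^+ k).
have SS' : `|S' - S| <= M%:R * d.
  rewrite -sumrB; apply: le_trans (ler_norm_sum _ _ _) _.
  rewrite mulr_natl -[M in _ *+ M](card_ord M) -sumr_const; apply: ler_sum => k _.
  apply: le_trans (psi_lip _ _ e0) _.
  apply: le_trans (nzE (w + r%:C%C * zeta ^+ k)).
  rewrite ler_pM2r ?invr_gt0// cabsB_sym.
  by rewrite (_ : _ - (a - w - _) = w + r%:C%C * zeta ^+ k - nz (w + r%:C%C * zeta ^+ k))//; ring.
have up := psi_avg_le (a - w) r%:C%C (isT : (0 < M)%N) pz e0.
have lo := psi_avg_ge (a := r%:C%C) (z := a - w) (isT : (0 < M)%N) pz e0.
have rr : cabs r%:C%C = r by rewrite cabs_real gtr0_norm.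
rewrite -/S' rr in up lo.
set m := Num.max r _ in lo.
have m0 : 0 < m by rewrite /m lt_max r0.
have {}lo := lo m0.
have psim : psi r (a - w) = ln m by rewrite /psi maxC.
rewrite psim.
have M1 : M%:R^-1 * M%:R = 1 :> R by rewrite mulVf ?gt_eqF.
have e2 : Num.min (cabs (a - w)) (2 * r) / e <= 2 * r / e.
  by rewrite ler_pM2r ?invr_gt0// ge_min lexx orbT.
have up2 : ln (Num.max r (cabs (a - w) + e)) <= ln m + d.
  have h1 : Num.max r (cabs (a - w) + e) <= m * (1 + d).
    rewrite ge_max; apply/andP; split.
      apply: le_trans (_ : m * 1 <= _); first by rewrite mulr1 /m le_max lexx.
      by rewrite ler_wpM2l ?lerDl ?ltW.
    rewrite mulrDr mulr1; apply: lerD; first by rewrite /m le_max lexx orbT.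
    apply: le_trans (ltW ee0) _; rewrite mulrC ler_wpM2r ?(ltW d0)//.
    by rewrite /m le_max lexx.
  apply: le_trans (_ : ln (m * (1 + d)) <= _).
    by rewrite ler_ln// posrE; [rewrite lt_max r0|rewrite mulr_gt0// addr_gt0].
  rewrite lnM ?posrE ?addr_gt0// lerD2l; apply: le_ln1Dx.
  by apply: lt_trans d0; rewrite ltrN10.
have dB : ln 2 + 2 * r / e <= M%:R * d by rewrite -ler_pdivrMr.
rewrite -(ler_pM2l M0) -{1}(gtr0_norm M0) -normrM mulrBr mulrA mulfV ?gt_eqF// mul1r.
have hd : eps = d + d + d by rewrite /d; lra.
have ln20 : 0 <= ln 2 :> R by rewrite ln_ge0 ?ler1n.
have up3 : M%:R * ln (Num.max r (cabs (a - w) + e)) <= M%:R * ln m + M%:R * d.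
  by rewrite -mulrDr ler_pM2l.
have re0 : 0 <= 2 * r / e by rewrite divr_ge0 ?mulr_ge0 ?ltW.
have Md0 : 0 <= M%:R * d by rewrite mulr_ge0 ?ltW.
have [SS1 SS2] : - (M%:R * d) <= S' - S /\ S' - S <= M%:R * d.
  by apply/andP; rewrite -ler_norml.
rewrite hd !mulrDr ler_norml; apply/andP; split; lra.
Qed.

(** The potentials of two concentric circles of equal charge cancel outside the larger one, which
    makes the difference a bump supported in the disk of radius [r]. *)
Definition cbump r w a : R := psi r (a - w) - psi (r / 2) (a - w).

Lemma potential_bump r w : 0 < r -> potential_approx (cbump r w).
Proof.
move=> r0 eps eps0; have e20 : 0 < eps / 2 by rewrite divr_gt0.
have r20 : 0 < r / 2 by rewrite divr_gt0.
have [e1 e10 h1] := potential_circle w r0 e20.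
have [e2 e20' h2] := potential_circle w r20 e20.
exists (1 + 1); first exact: addr_ge0.
exists (Num.min e1 e2); first by rewrite lt_min e10.
move=> e /andP[ee0]; rewrite lt_min => /andP[ee1 ee2].
have [|cs1 [nz1 s1 a1 ap1]] := h1 e; first by rewrite ee0.
have [|cs2 [nz2 s2 a2 ap2]] := h2 e; first by rewrite ee0.
exists (cs1 ++ scale_coefs (-1) cs2); split.
- by rewrite all_cat nz1 /scale_coefs all_map; apply: sub_all nz2 => q.
- by rewrite big_cat big_map /= -mulr_sumr s1 s2 mulr1 subrr.
- rewrite big_cat big_map /=; under [X in _ + X]eq_bigr do rewrite mulN1r normrN.
  by rewrite a1 a2.
move=> a; rewrite combo_cat combo_scale mulN1r /cbump (splitr eps).
have -> : forall p q p' q' : R, p - q - (p' - q') = (p - p') - (q - q').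
  by move=> *; ring.
by apply: le_trans (ler_normB _ _) _; apply: lerD.
Qed.

Lemma cbump_ge0 r w a : 0 < r -> 0 <= cbump r w a.
Proof. by move=> r0; rewrite /cbump subr_ge0 ler_psi//; lra. Qed.

Lemma cbump_le r w a : 0 < r -> cbump r w a <= ln 2.
Proof.
move=> r0; rewrite /cbump /psi lerBlDr -lnM ?posrE ?max_gt0//; last by lra.
rewrite ler_ln ?posrE ?mulr_gt0 ?max_gt0//; last by lra.
have := cabs_ge0 (a - w).
by rewrite ge_max; case: (leP (cabs (a - w)) (r / 2)) => h h0; apply/andP; split; lra.
Qed.

Lemma cbump_out r w a : 0 < r -> r <= cabs (a - w) -> cbump r w a = 0.
Proof.
move=> r0 h; rewrite /cbump /psi (max_idPl h) (max_idPl _) ?subrr//.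
by apply: le_trans h; lra.
Qed.

(** The hypotheses describe the square of points nearest to a grid node of mesh [r]. There
    [2 * cabs (a - w) ^+ 2 <= r ^+ 2], so the logarithm of the ratio is at least [ln 2 / 2]. *)
Lemma cbump_center r w a : 0 < r -> `|complex.Re (a - w)| <= r / 2 ->
  `|complex.Im (a - w)| <= r / 2 -> ln 2 / 2 <= cbump r w a.
Proof.
move=> r0; rewrite /cbump; move: (a - w) => z h1 h2.
have r20 : 0 < r / 2 by lra.
have z2 : cabs z ^+ 2 <= r ^+ 2 / 2.
  rewrite /cabs /cmod sqr_sqrtr ?addr_ge0 ?sqr_ge0//=.
  by move: h1 h2; rewrite !ler_norml => /andP[? ?] /andP[? ?]; nra.
rewrite /psi.
have zr : cabs z <= r.
  by rewrite -(@ler_pXn2r _ 2) ?nnegrE ?cabs_ge0 ?ltW//; nra.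
rewrite (max_idPr zr); set m := Num.max _ _.
have m0 : 0 < m by exact: max_gt0.
have m2 : m ^+ 2 * 2 <= r ^+ 2.
  by rewrite /m; case: (leP (cabs z) (r / 2)) => _; [nra|lra].
have : ln (m ^+ 2 * 2) <= ln (r ^+ 2) by rewrite ler_ln ?posrE ?mulr_gt0 ?exprn_gt0.
by rewrite lnM ?posrE ?exprn_gt0// !lnXn//; lra.
Qed.

(** The class stable under subtracting bumps, so that the contraction step can be repeated on the
    remainder. *)
Definition uniform_cc F := (exists K, forall a, K < cabs a -> F a = 0) /\
  (forall eps, 0 < eps -> exists2 r, 0 < r &
     forall a z, cabs (a - z) < r -> `|F a - F z| <= eps).

Lemma uniform_ccD F H : uniform_cc F -> uniform_cc H -> uniform_cc (fun a => F a + H a).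
Proof.
move=> [[K1 hK1] u1] [[K2 hK2] u2]; split.
  exists (Num.max K1 K2) => a; rewrite gt_max => /andP[/hK1 -> /hK2 ->].
  by rewrite addr0.
move=> eps eps0; have e20 : 0 < eps / 2 by rewrite divr_gt0.
have [r1 r10 h1] := u1 _ e20; have [r2 r20 h2] := u2 _ e20.
exists (Num.min r1 r2); first by rewrite lt_min r10.
move=> a z; rewrite lt_min => /andP[/h1 ? /h2 ?].
rewrite (_ : _ - _ = (F a - F z) + (H a - H z)); last by ring.
by rewrite (splitr eps); apply: le_trans (ler_normD _ _) _; apply: lerD.
Qed.

Lemma uniform_ccZ k F : uniform_cc F -> uniform_cc (fun a => k * F a).
Proof.
move=> [[K hK] u]; split; first by exists K => a /hK ->; rewrite mulr0.
move=> eps eps0; have k0 : 0 < `|k| + 1 by rewrite ltr_wpDl.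
have [r r0 h] := u _ (divr_gt0 eps0 k0); exists r => // a z /h.
rewrite ler_pdivlMr// -mulrBr normrM; apply: le_trans.
by rewrite mulrC ler_wpM2l// lerDl.
Qed.

Lemma uniform_cc_sum (I : Type) (s : seq I) (F : I -> R[i] -> R) :
  (forall i, uniform_cc (F i)) -> uniform_cc (fun a => \sum_(i <- s) F i a).
Proof.
move=> h; elim: s => [|i s IH].
  rewrite (_ : (fun a => _) = fun=> 0); last by apply/funext => a; rewrite big_nil.
  by split; [exists 0|move=> eps eps0; exists 1 => // a z _; rewrite subrr normr0 ltW].
rewrite (_ : (fun a => _) = fun a => F i a + \sum_(j <- s) F j a).
  exact: uniform_ccD.
by apply/funext => a; rewrite big_cons.
Qed.

Lemma uniform_cc_bump r w : 0 < r -> uniform_cc (cbump r w).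
Proof.
move=> r0; split.
  exists (r + cabs w) => a h; apply: cbump_out => //.
  by apply: le_trans _ (cabsB_ge _ _); rewrite lerBrDr ltW.
move=> eps eps0; exists (eps * r / 3); first by rewrite !mulr_gt0.
move=> a z haz; rewrite /cbump.
have -> : forall p q p' q' : R, p - q - (p' - q') = (p - p') - (q - q').
  by move=> *; ring.
apply: le_trans (ler_normB _ _) _.
have r20 : 0 < r / 2 by lra.
apply: le_trans (lerD (psi_lip _ _ r0) (psi_lip _ _ r20)) _.
rewrite (_ : a - w - (z - w) = a - z); last by ring.
rewrite invf_div; have : cabs (a - z) / r <= eps / 3 by rewrite ler_pdivrMr//; lra.
by move: (cabs _) => t; lra.
Qed.

End Approximation.

(** * Covering the plane by a grid of bumps *)

Section GridContraction.
Context {R : realType}.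
Implicit Types (F H : R[i] -> R) (e r eps x : R) (a z w : R[i]).

Lemma sum_eq_le1 n k : (\sum_(i < n) (i == k :> nat) <= 1)%N.
Proof.
have [kn|nk] := ltnP k n.
  by rewrite (bigD1 (Ordinal kn)) //= eqxx big1 ?addn0// => i /eqP h; case: eqP => // e; case: h; apply: val_inj.
by rewrite big1// => i _; case: eqP => // e; have := ltn_ord i; rewrite e ltnNge nk.
Qed.

(** Only [Num.truncn x] and its successor can qualify. *)
Lemma near_nat_count n x : (\sum_(i < n) (`|x - i%:R| < 1)%R <= 2)%N.
Proof.
pose k := Num.truncn x.
apply: (@leq_trans (\sum_(i < n) ((i == k :> nat) + (i == k.+1 :> nat)))%N).
  apply: leq_sum => i _; case: (ltP `|x - i%:R| 1) => //; rewrite ltr_norml => /andP[h1 h2].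
  have h3 : (k <= i)%N by rewrite truncn_le_nat -natr1; lra.
  have h4 : (i < k.+2)%N.
    rewrite -(ltr_nat R) -natr1; have := truncnS_gt x; rewrite -/k; lra.
  by move: h3 h4; case: eqP; case: eqP => //=; lia.
by rewrite big_split; apply: (@leq_add _ _ 1 1); exact: sum_eq_le1.
Qed.

Lemma near_nat_exists m x : `|x| <= m%:R ->
  exists i : 'I_(2 * m).+1, `|x + m%:R - i%:R| <= 2^-1.
Proof.
rewrite ler_norml => /andP[h1 h2].
pose y := x + m%:R + 2^-1; have y0 : 0 <= y by rewrite /y; lra.
have h : (Num.truncn y < (2 * m).+1)%N.
  by rewrite truncn_lt_nat// -natr1 natrM /y; lra.
exists (Ordinal h) => /=.
have /andP[] := truncn_itv y0; rewrite -natr1 ler_norml.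
by move: (Num.truncn y)%:R => t; rewrite /y => ? ?; apply/andP; split; lra.
Qed.

(** The shift by [m] centres the grid at 0 with natural indices. The mesh equals the radius of the
    bumps, which gives both bounded overlap and a full cover. *)
Definition grid r m (i j : nat) : R[i] :=
  complex.Complex (r * (i%:R - m%:R)) (r * (j%:R - m%:R)).

(** At most two columns and two rows are closer than [r] to [a], so at most four bumps are nonzero,
    each bounded by [ln 2]. *)
Lemma grid_bump_count r m a : 0 < r ->
  \sum_(i < (2 * m).+1) \sum_(j < (2 * m).+1) cbump r (grid r m i j) a <= 4 * ln 2.
Proof.
move=> r0; set n := (2 * m).+1.
have ln20 : 0 <= ln 2 :> R by rewrite ln_ge0// ler1n.
pose f (t : R) (i : nat) : nat := `|t / r + m%:R - i%:R| < 1.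
have hf t i : r <= `|t - r * (i%:R - m%:R)| \/ f t i = 1%N.
  rewrite /f; case: (ltP `|_| 1) => h; first by right.
  left; have -> : t - r * (i%:R - m%:R) = r * (t / r + m%:R - i%:R).
    by field; rewrite gt_eqF.
  by rewrite normrM gtr0_norm// ler_peMr// ltW.
apply: (@le_trans _ _ (\sum_(i < n) \sum_(j < n)
   ((f (complex.Re a) i)%:R * (f (complex.Im a) j)%:R * ln 2))).
  apply: ler_sum => i _; apply: ler_sum => j _.
  have hre : complex.Re (a - grid r m i j) = complex.Re a - r * (i%:R - m%:R).
    by case: (a).
  have him : complex.Im (a - grid r m i j) = complex.Im a - r * (j%:R - m%:R).
    by case: (a).
  case: (hf (complex.Re a) i) => [h|->].
    rewrite cbump_out ?mulr_ge0//; apply: le_trans (Re_le_cabs _).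
    by rewrite hre.
  case: (hf (complex.Im a) j) => [h|->].
    rewrite cbump_out ?mulr_ge0//; apply: le_trans (Im_le_cabs _).
    by rewrite him.
  by rewrite !mul1r cbump_le.
have E : \sum_(i < n) \sum_(j < n) (f (complex.Re a) i)%:R * (f (complex.Im a) j)%:R * ln 2
  = (\sum_(i < n) f (complex.Re a) i)%N%:R * (\sum_(j < n) f (complex.Im a) j)%N%:R * ln 2 :> R.
  rewrite !natr_sum mulr_suml mulr_suml; apply: eq_bigr => i _.
  by rewrite mulr_sumr mulr_suml.
rewrite E ler_wpM2r// -natrM ler_nat.
by apply: (@leq_mul _ _ 2 2); exact: near_nat_count.
Qed.

(** Rounding both coordinates gives a node within [r / 2] in each of them; its bump alone suffices,
    the others being nonnegative. *)
Lemma grid_bump_lb r m a : 0 < r -> cabs a <= r * m%:R ->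
  ln 2 / 2 <= \sum_(i < (2 * m).+1) \sum_(j < (2 * m).+1) cbump r (grid r m i j) a.
Proof.
move=> r0 ha.
have h t : `|t| <= cabs a -> `|t / r| <= m%:R.
  move=> ht; rewrite normrM normfV (gtr0_norm r0) ler_pdivrMr//.
  by rewrite mulrC; apply: le_trans ha.
have [i hi] := near_nat_exists (h _ (Re_le_cabs a)).
have [j hj] := near_nat_exists (h _ (Im_le_cabs a)).
rewrite (bigD1 i)//= (bigD1 j)//=.
apply: le_trans (_ : cbump r (grid r m i j) a <= _); last first.
  rewrite -addrA lerDl addr_ge0 ?sumr_ge0// => k _; rewrite ?cbump_ge0//.
  by apply: sumr_ge0 => l _; rewrite cbump_ge0.
have hE t (k : nat) : `|t / r + m%:R - k%:R| <= 2^-1 -> `|t - r * (k%:R - m%:R)| <= r / 2.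
  move=> hk; have -> : t - r * (k%:R - m%:R) = r * (t / r + m%:R - k%:R).
    by field; rewrite gt_eqF.
  by rewrite normrM gtr0_norm// ler_wpM2l// ltW.
apply: cbump_center => //.
  by have := hE _ _ hi; case: (a).
by have := hE _ _ hj; case: (a).
Qed.

(* Subtract at every point of a fine grid a small bump proportional to the value
   of [F] there; everywhere the bumps add up to a fraction of [F] bounded below. *)
Lemma grid_contraction F s : uniform_cc F -> 0 < s -> (forall a, `|F a| <= s) ->
  exists H, [/\ potential_approx H, uniform_cc H &
    forall a, `|F a - H a| <= 15 / 16 * s].
Proof.
move=> [[K hK] uF] s0 Fs.
(* Oscillation allowed on a bump. The bumps remove at least the fraction [1 / 8] of [F], and
   [7 / 8 + 1 / 16 = 15 / 16]. *)
have s160 : 0 < s / 16 by rewrite divr_gt0.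
have [r r0 hr] := uF _ s160.
pose m := (Num.truncn (`|K| / r)).+1.
have Km : K <= r * m%:R.
  apply: le_trans (ler_norm _) _; rewrite mulrC -ler_pdivrMr//.
  by rewrite ltW// truncnS_gt.
have ln20 : 0 < ln 2 :> R by rewrite ln_gt0// ltr1n.
(* Normalised by the overlap bound, the bumps sum to at most 1; the lower bound becomes
   [(ln 2 / 2) / (4 * ln 2) = 1 / 8]. *)
pose l := 4 * ln 2 : R; have l0 : 0 < l by rewrite mulr_gt0.
pose g := grid r m.
pose H a := \sum_(i < (2 * m).+1) \sum_(j < (2 * m).+1) (F (g i j) / l) * cbump r (g i j) a.
exists H; split.
- apply: potential_approx_sum => i; apply: potential_approx_sum => j.
  by apply: potential_approxZ; apply: potential_bump.
- apply: uniform_cc_sum => i; apply: uniform_cc_sum => j.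
  by apply: uniform_ccZ; apply: uniform_cc_bump.
move=> a.
pose W := \sum_(i < (2 * m).+1) \sum_(j < (2 * m).+1) cbump r (g i j) a.
have W0 : 0 <= W by apply: sumr_ge0 => i _; apply: sumr_ge0 => j _; rewrite cbump_ge0.
have Wl : W <= l by exact: grid_bump_count.
have dev : `|F a * (W / l) - H a| <= s / 16.
  have -> : F a * (W / l) - H a =
    l^-1 * \sum_(i < (2 * m).+1) \sum_(j < (2 * m).+1) (F a - F (g i j)) * cbump r (g i j) a.
    have -> : F a * (W / l) = (F a / l) * W by rewrite mulrA mulrAC.
    rewrite /W /H !mulr_sumr -sumrB.
    apply: eq_bigr => i _; rewrite !mulr_sumr -sumrB; apply: eq_bigr => j _.
    by ring.
  rewrite normrM gtr0_norm ?invr_gt0// mulrC ler_pdivrMr//.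
  apply: le_trans (_ : s / 16 * W <= _); last by rewrite ler_wpM2l// ltW.
  rewrite /W mulr_sumr; apply: le_trans (ler_norm_sum _ _ _) _; apply: ler_sum => i _.
  rewrite mulr_sumr; apply: le_trans (ler_norm_sum _ _ _) _; apply: ler_sum => j _.
  rewrite normrM (ger0_norm (cbump_ge0 _ _ r0)).
  have [h|h] := ltP (cabs (a - g i j)) r; last by rewrite cbump_out// !mulr0.
  by rewrite ler_wpM2r ?cbump_ge0// hr.
have [aK|Ka] := leP (cabs a) K; last first.
  rewrite hK// sub0r normrN; move: dev; rewrite hK// mul0r sub0r normrN.
  by move=> h; apply: le_trans h _; lra.
have Wlb : 1 / 8 <= W / l.
  rewrite ler_pdivlMr//; have := grid_bump_lb (m := m) r0 (le_trans aK Km).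
  by rewrite -/W /l; lra.
have -> : F a - H a = F a * (1 - W / l) + (F a * (W / l) - H a) by ring.
apply: le_trans (ler_normD _ _) _.
have W1 : W / l <= 1 by rewrite ler_pdivrMr// mul1r.
rewrite normrM (ger0_norm (_ : 0 <= 1 - _)); last by rewrite subr_ge0.
have : `|F a| * (1 - W / l) <= s * (7 / 8).
  by apply: ler_pM => //; [rewrite subr_ge0|lra].
by move: dev; lra.
Qed.

(** Every point of the support is within [r] of one of finitely many nodes: otherwise all bumps
    would vanish there, against [grid_bump_lb]. *)
Lemma uniform_cc_bounded F : uniform_cc F -> exists2 s, 0 < s & forall a, `|F a| <= s.
Proof.
move=> [[K hK] uF]; have [r r0 hr] := uF 1 ltr01.
pose m := (Num.truncn (`|K| / r)).+1.
have Km : K <= r * m%:R.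
  apply: le_trans (ler_norm _) _; rewrite mulrC -ler_pdivrMr//.
  by rewrite ltW// truncnS_gt.
pose g := grid r m.
pose S := \sum_(i < (2 * m).+1) \sum_(j < (2 * m).+1) `|F (g i j)|.
have S0 : 0 <= S by apply: sumr_ge0 => i _; apply: sumr_ge0.
exists (S + 1) => [|a]; first by rewrite ltr_wpDl.
have [aK|Ka] := leP (cabs a) K; last by rewrite hK// normr0 addr_ge0.
have ln20 : 0 < ln 2 :> R by rewrite ln_gt0// ltr1n.
case: (pselect (exists i j : 'I_(2 * m).+1, cabs (a - g i j) < r)) => [[i [j h]]|h].
  rewrite -(subrK (F (g i j)) (F a)) addrC; apply: le_trans (ler_normD _ _) _.
  apply: lerD; last exact: hr.
  rewrite /S (bigD1 i)//= (bigD1 j)//= -addrA lerDl addr_ge0//; apply: sumr_ge0 => // k _.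
  exact: sumr_ge0.
exfalso; have := grid_bump_lb (m := m) r0 (le_trans aK Km).
rewrite big1 ?leNgt ?divr_gt0// => i _; rewrite big1// => j _.
rewrite cbump_out// leNgt; apply/negP => h'; apply: h; by exists i, j.
Qed.

(** Iterating the contraction makes the remainder decay geometrically, and [potential_approx] is
    closed under uniform limits. *)
Lemma potential_approx_uniform_cc F : uniform_cc F -> potential_approx F.
Proof.
move=> uF; have [s s0 Fs] := uniform_cc_bounded uF.
suff step n : exists H, [/\ potential_approx H, uniform_cc H &
    forall a, `|F a - H a| <= (15 / 16) ^+ n * s].
  apply: potential_approx_lim => eps eps0.
  have : (fun n => (15 / 16) ^+ n * s) @ \oo --> (0 : R).
    rewrite -(mul0r s); apply: cvgM; last exact: cvg_cst.
    by apply: cvg_expr; rewrite ger0_norm; lra.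
  move=> /cvgrPdist_le /(_ _ eps0) [n _ /(_ n (leqnn n))].
  rewrite sub0r normrN => hn.
  have [H [aH _ hH]] := step n; exists H => // a.
  by apply: le_trans (hH a) _; apply: le_trans (ler_norm _) hn.
elim: n => [|n [H [aH uH hH]]].
  exists (fun=> 0); split; first exact: potential_approx0.
    split; first by exists 0.
    by move=> eps eps0; exists 1 => // a z _; rewrite subrr normr0 ltW.
  by move=> a; rewrite subr0 expr0 mul1r.
have uFH : uniform_cc (fun a => F a + -1 * H a).
  by apply: uniform_ccD => //; apply: uniform_ccZ.
have q0 : 0 < (15 / 16) ^+ n * s by rewrite mulr_gt0// exprn_gt0.
have hFH a : `|F a + -1 * H a| <= (15 / 16) ^+ n * s by rewrite mulN1r.
have [G [aG uG hG]] := grid_contraction uFH q0 hFH.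
exists (fun a => H a + G a); split; [exact: potential_approxD|exact: uniform_ccD|].
by move=> a; have := hG a; rewrite mulN1r opprD addrA exprS mulrA.
Qed.

End GridContraction.

Section TestFunctions.
Context {R : realType}.

Definition Cfun (phi : R -> R -> R) (a : R[i]) : R := phi (complex.Re a) (complex.Im a).

Lemma uniform_cc_continuous (phi : R -> R -> R) :
  continuous (fun z : R * R => phi z.1 z.2) -> compact_support phi ->
  uniform_cc (Cfun phi).
Proof.
move=> cphi [M hM]; split; first by exists M => -[a b] /= h; apply: hM.
move=> eps eps0.
(* The margin 1 exceeds [r]: if [a] leaves the disk of radius [K], then [phi] vanishes at [a] and at
   every point within [r] of it. *)
pose K := `|M| + 1.
pose A : set (R * R) := `[- K, K] `*` `[- K, K].
have cA : compact A by apply: compact_setX; exact: segment_compact.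
pose P (r : R) (x : R * R) := forall z : R * R, `|x.1 - z.1| < r -> `|x.2 - z.2| < r ->
  `|phi x.1 x.2 - phi z.1 z.2| <= eps.
have : \forall r \near 0^'+, forall x, A x -> P r x.
  move/compact_near_coveringP : cA; apply.
  move=> x Ax; have e20 : 0 < eps / 2 by rewrite divr_gt0.
  have := cphi x => /cvgrPdist_le /(_ _ e20).
  rewrite -nbhs_ballE => -[d /= d0 hd].
  exists (ball x (d / 2), [set r | 0 < r < d / 2]) => /=.
    split; first by apply: nbhsx_ballx; rewrite divr_gt0.
    near=> r => /=; apply/andP; split; first by near: r; exact: nbhs_right_gt.
    by near: r; apply: nbhs_right_lt; rewrite divr_gt0.
  move=> [y r] /= [[hy1 hy2] /andP[r0 rd]] z h1 h2.
  have hx : `|phi x.1 x.2 - phi y.1 y.2| <= eps / 2.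
    apply: (hd y); split; apply: le_ball (hy1) || apply: le_ball (hy2); lra.
  have hz : `|phi x.1 x.2 - phi z.1 z.2| <= eps / 2.
    have hb (p q s : R) : ball p (d / 2) q -> `|q - s| < r -> ball p d s.
      rewrite /ball /= => hpq hqs; rewrite (_ : p - s = (p - q) + (q - s)); last by ring.
      by apply: le_lt_trans (ler_normD _ _) _; lra.
    by apply: (hd z); split; [apply: hb hy1 _|apply: hb hy2 _].
  rewrite (_ : _ - _ = (phi x.1 x.2 - phi z.1 z.2) - (phi x.1 x.2 - phi y.1 y.2)); last by ring.
  by apply: le_trans (ler_normB _ _) _; lra.
move=> hP; near (0 : R)^'+ => r.
have r0 : 0 < r by near: r; exact: nbhs_right_gt.
have r1 : r < 1 by near: r; apply: nbhs_right_lt.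
have hr : forall x, A x -> P r x by near: r.
exists r => // a z haz; rewrite /Cfun.
have h1 : `|complex.Re a - complex.Re z| < r.
  apply: le_lt_trans haz; apply: le_trans (Re_le_cabs _).
  by case: (a); case: (z).
have h2 : `|complex.Im a - complex.Im z| < r.
  apply: le_lt_trans haz; apply: le_trans (Im_le_cabs _).
  by case: (a); case: (z).
have [aK|Ka] := leP (cabs a) K.
  apply: (hr (complex.Re a, complex.Im a) _ (complex.Re z, complex.Im z)) => //.
  split; rewrite /= in_itv /= -ler_norml; apply: le_trans aK;
    [exact: Re_le_cabs|exact: Im_le_cabs].
have hM' : M < cabs a by apply: le_lt_trans (ler_norm _) _; move: Ka; rewrite /K; lra.
have hM'' : M < cabs z.
  apply: le_lt_trans (ler_norm _) _.
  have := cabsB_ge a z; move: Ka haz r1; rewrite /K; lra.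
have z0 (b : R[i]) : M < cabs b -> phi (complex.Re b) (complex.Im b) = 0 by apply: hM.
by rewrite !z0// subrr normr0 ltW.
Unshelve. all: by end_near. Qed.

Lemma potential_approx_test (phi : R -> R -> R) :
  continuous (fun z : R * R => phi z.1 z.2) -> compact_support phi ->
  potential_approx (Cfun phi).
Proof. by move=> *; apply/potential_approx_uniform_cc/uniform_cc_continuous. Qed.

End TestFunctions.

(** * The Legendre-Fenchel transform *)

Section Legendre.
Context {R : realType} (p : R -> R) (T0 : R).
Context (p_ge0 : forall t, 0 <= t -> 0 <= p t) (T0_gt0 : 0 < T0)
  (p_gt0 : forall t, 0 <= t < T0 -> 0 < p t)
  (p_out : forall t, T0 < t -> p t = 0)
  (p_cont : {within `[0, T0], continuous p}).
Implicit Types (s t m e : R).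

Lemma within_itv_eps (f : R -> R) a b : {within `[a, b], continuous f} ->
  forall t, a <= t <= b -> forall e, 0 < e -> exists2 d, 0 < d &
  forall u, a <= u <= b -> `|t - u| < d -> `|f t - f u| < e.
Proof.
move=> /subspace_continuousP fc t tab e e0.
have /fc/cvgrPdist_lt/(_ _ e0) : `[a, b]%classic t by rewrite /= in_itv.
rewrite near_withinE -nbhs_ballE => -[d /= d0 hd].
by exists d => // u uab tu; apply: (hd u) => //; rewrite /= in_itv.
Qed.

(** [ln (p t)] may tend to minus infinity at [T0]; the weight [p t * expR (t * s)] stays continuous
    up to the endpoint, so maxima are sought for it instead. *)
Lemma itv_cts_weight s b : b <= T0 -> {within `[0, b], continuous (fun t => p t * expR (t * s))}.
Proof.
move=> bT; have pc : {within `[0, b], continuous p}.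
  by apply: continuous_subspaceW p_cont; apply: subset_itvl; rewrite bnd_simp.
move/subspace_continuousP : pc => pc.
apply/subspace_continuousP => t tb; apply: cvgM; first exact: pc.
apply: cvg_within_filter.
apply: (@continuous_comp _ _ _ (fun u : R => u * s) expR); last exact: continuous_expR.
by apply: continuousM; [exact: cvg_id|exact: cvg_cst].
Qed.

Lemma p00 : 0 < p 0. Proof. by apply: p_gt0; rewrite lexx. Qed.

(** The least maximiser of [t * s + ln (p t)]; being the least makes it the left derivative of [I]
    at [s]. The guards [0 < p t] are essential because [ln 0 = 0] here rather than minus
    infinity. *)
Definition minargmax s m := [/\ 0 <= m <= T0, 0 < p m,
  forall t, 0 <= t <= T0 -> 0 < p t -> t * s + ln (p t) <= m * s + ln (p m) &
  forall t, 0 <= t <= T0 -> 0 < p t -> t * s + ln (p t) = m * s + ln (p m) -> m <= t].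

Lemma exists_minargmax s : exists m, minargmax s m.
Proof.
pose q t := p t * expR (t * s).
have qc : {within `[0, T0], continuous q} by exact: itv_cts_weight.
have [c] := EVT_max (ltW T0_gt0) qc; rewrite in_itv /= => c0T hc.
have {}hc t : 0 <= t <= T0 -> q t <= q c by move=> h; apply: hc; rewrite in_itv.
pose A := [set t | 0 <= t <= T0 /\ q t = q c].
have A0 : A !=set0 by exists c.
have Alb : lbound A 0 by move=> t [/andP[]].
have hA : has_inf A by split=> //; exists 0.
pose m := inf A.
have m0 : 0 <= m by apply: lb_le_inf.
have mc t : A t -> m <= t by move=> At; apply: ge_inf => //; exists 0.
have mT : m <= T0 by apply: le_trans (mc c _) _ => //; case/andP: c0T.
have m0T : 0 <= m <= T0 by rewrite m0.
(* The infimum of the maximisers is one itself: a smaller value there would persist nearby by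
   continuity, yet maximisers accumulate at [m]. *)
have qm : q m = q c.
  apply/eqP; rewrite eq_le hc//= leNgt; apply/negP => lt.
  have e0 : 0 < q c - q m by rewrite subr_gt0.
  have [d d0 hd] := within_itv_eps qc m0T e0.
  have [t At td] := inf_adherent d0 hA.
  have := hd t; rewrite distrC ger0_norm ?subr_ge0 ?mc//.
  have [t0T ->] := At; rewrite distrC gtr0_norm// ltxx => h.
  suff : false by []; apply: h => //.
  by rewrite ltrBlDl.
have q0 : 0 < q c by apply: lt_le_trans (hc 0 _); rewrite ?mul0r ?expR0 ?mulr1 ?p00 ?lexx ?ltW// /q mul0r expR0 mulr1 p00.
have pq t : 0 < q t -> 0 < p t by rewrite /q pmulr_lgt0 ?expR_gt0.
have lnq t : 0 < p t -> ln (q t) = t * s + ln (p t).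
  by move=> pt; rewrite /q lnM ?posrE ?expR_gt0// expRK addrC.
have pm : 0 < p m by apply: pq; rewrite qm.
exists m; split=> // t t0T pt.
  by rewrite -!lnq// ler_ln ?posrE ?qm// ?hc// /q mulr_gt0 ?expR_gt0.
rewrite -!lnq// => /ln_inj h; apply: mc; split => //; rewrite -qm; apply: h;
  by rewrite posrE /q mulr_gt0 ?expR_gt0.
Qed.

Lemma I_LF_minargmax s m : minargmax s m -> I_LF p s = m * s + ln (p m).
Proof.
move=> [m0T pm max _]; rewrite /I_LF.
suff -> : Ibar p s = (m * s + ln (p m))%:E by [].
rewrite /Ibar; apply/eqP; rewrite eq_le; apply/andP; split.
  apply: ge_ereal_sup => _ [t t0 ->]; case: eqP => [_|/eqP pt]; first exact: leNye.
  rewrite lee_fin mulrC; apply: max; last by rewrite lt_neqAle eq_sym pt p_ge0.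
  by rewrite t0 leNgt; apply/negP => /p_out h; rewrite h eqxx in pt.
apply: ereal_sup_ubound; exists m; first by case/andP: m0T.
by rewrite gt_eqF// mulrC.
Qed.

Lemma I_LF_ge s t : 0 <= t <= T0 -> 0 < p t -> t * s + ln (p t) <= I_LF p s.
Proof.
move=> t0T pt; have [m hm] := exists_minargmax s.
by rewrite (I_LF_minargmax hm); case: hm => _ _ + _; apply.
Qed.

(** Subgradient inequalities: each supremum is tested at the maximiser of the other. *)
Lemma I_LF_slope s s' m m' : minargmax s m -> minargmax s' m' ->
  m' * (s - s') <= I_LF p s - I_LF p s' <= m * (s - s').
Proof.
move=> hm hm'; have := @I_LF_ge s m'; have := @I_LF_ge s' m.
rewrite (I_LF_minargmax hm) (I_LF_minargmax hm').
case: hm => m0T pm _ _; case: hm' => m0T' pm' _ _ /(_ m0T pm) + /(_ m0T' pm').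
by rewrite !mulrBr => ? ?; apply/andP; split; lra.
Qed.

Lemma minargmax_le s s' m m' : s' < s -> minargmax s m -> minargmax s' m' -> m' <= m.
Proof.
move=> ss hm hm'; have /andP[h1 h2] := I_LF_slope hm hm'.
have := le_trans h1 h2; rewrite ler_pM2r// subr_gt0//.
Qed.

Lemma p_bounded : exists2 B, 0 < B & forall t, 0 <= t <= T0 -> p t <= B.
Proof.
have [c _ hc] := EVT_max (ltW T0_gt0) p_cont.
have h t : 0 <= t <= T0 -> p t <= p c by move=> ?; apply: hc; rewrite in_itv.
by exists (p c) => //; apply: lt_le_trans p00 _; apply: h; rewrite lexx ltW.
Qed.

(** Left continuity of the least maximiser. On [[0, m - e]] the maximum falls short of the global
    one by a gap [g > 0], and a small decrease of [s] cannot bridge it. *)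
Lemma minargmax_left s m e : minargmax s m -> 0 < e ->
  exists2 d, 0 < d & forall s' m', s - d < s' < s -> minargmax s' m' -> m - e < m'.
Proof.
move=> hm e0; have [m0T pm max mmin] := hm; have /andP[m0 mT] := m0T.
have [me|me] := ltP (m - e) 0.
  by exists 1 => // s' m' _ [/andP[h _] _ _ _]; exact: lt_le_trans h.
have meT : m - e <= T0 by lra.
have [c] := EVT_max me (@itv_cts_weight s _ meT); rewrite in_itv /= => c0 hc.
have {}hc t : 0 <= t <= m - e -> p t * expR (t * s) <= p c * expR (c * s).
  by move=> h; apply: hc; rewrite in_itv.
have lnq t : 0 < p t -> ln (p t * expR (t * s)) = t * s + ln (p t).
  by move=> pt; rewrite lnM ?posrE ?expR_gt0// expRK addrC.
have pc : 0 < p c.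
  rewrite -(pmulr_lgt0 _ (expR_gt0 (c * s))); apply: lt_le_trans (hc 0 _).
    by rewrite mul0r expR0 mulr1 p00.
  by rewrite lexx.
have /andP[c00 cme] := c0; have c0T : 0 <= c <= T0 by rewrite c00; lra.
have lt : c * s + ln (p c) < m * s + ln (p m).
  rewrite lt_neqAle max// andbT; apply/eqP => /(mmin _ c0T pc); lra.
pose g := m * s + ln (p m) - (c * s + ln (p c)).
have g0 : 0 < g by rewrite subr_gt0.
(* Slopes of [I] are at most [T0], so [I] loses less than [g] over this distance. *)
exists (g / T0) => [|s' m' /andP[hs1 hs2] hm']; first by rewrite divr_gt0.
rewrite ltNge; apply/negP => m'e.
have := I_LF_slope hm hm' => /andP[_]; have := I_LF_minargmax hm'; have [/andP[m'0 _] pm' _ _] := hm'.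
have h1 : m' * s + ln (p m') <= c * s + ln (p c).
  rewrite -!lnq// ler_ln ?posrE ?mulr_gt0 ?expR_gt0//; apply: hc; by rewrite m'0.
have h2 : m' * s' <= m' * s by rewrite ler_wpM2l// ltW.
have h3 : m * (s - s') < g.
  apply: le_lt_trans (_ : T0 * (s - s') < _); first by rewrite ler_wpM2r//; lra.
  by rewrite mulrC -ltr_pdivlMr//; lra.
rewrite (I_LF_minargmax hm); move: h3; rewrite /g => h3 h4 h5; lra.
Qed.

(** For large [s] the linear term wins: a point [u] with [t < u < T0] and [p u > 0] beats every
    point up to [t], since [ln p] is bounded above. *)
Lemma minargmax_top t : t < T0 -> exists s0, forall s m, s0 < s -> minargmax s m -> t < m.
Proof.
move=> tT; have [B B0 hB] := p_bounded.
pose u := Num.max 0 ((t + T0) / 2).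
have u0 : 0 <= u by rewrite le_max lexx.
have uT : u < T0 by rewrite gt_max T0_gt0; lra.
have tu : t < u by rewrite lt_max; apply/orP; right; lra.
have pu : 0 < p u by apply: p_gt0; rewrite u0.
have u0T : 0 <= u <= T0 by rewrite u0 ltW.
pose D := ln B - ln (p u).
exists (`|D| / (u - t)) => s m hs [m0T pm max _].
rewrite ltNge; apply/negP => mt.
have h1 := max u u0T pu.
have h2 : ln (p m) <= ln B by rewrite ler_ln// hB.
have hut : 0 < u - t by lra.
have s0 : 0 < s by apply: le_lt_trans hs; rewrite divr_ge0// ltW.
have h3 : `|D| < s * (u - t) by rewrite -ltr_pdivrMr.
have h4 : m * s <= t * s by rewrite ler_pM2r.
by have := ler_norm D; move: h3; rewrite {2}/D; lra.
Qed.

Lemma I_LF_ge0 s : ln (p 0) <= I_LF p s.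
Proof. by have := @I_LF_ge s 0; rewrite mul0r add0r; apply; rewrite ?p00// lexx ltW. Qed.

(** Maximisers below [d] have [p m <= p 0 * expR e] by continuity; at those beyond [d] the term
    [m * s] outweighs the bound on [ln p]. *)
Lemma I_LF_bottom e : 0 < e -> exists s0, forall s, s < s0 -> I_LF p s <= ln (p 0) + e.
Proof.
move=> e0; have [B B0 hB] := p_bounded.
have c0 : 0 < p 0 * (expR e - 1).
  by rewrite mulr_gt0 ?p00// subr_gt0 -expR0 ltr_expR.
have T0T : (0 : R) <= 0 <= T0 by rewrite lexx ltW.
have [d d0 hd] := within_itv_eps p_cont T0T c0.
pose D := ln B - ln (p 0).
exists (- (`|D| / d)) => s hs.
have s0 : s < 0 by apply: lt_le_trans hs _; rewrite oppr_le0 divr_ge0// ltW.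
have [m hm] := exists_minargmax s; rewrite (I_LF_minargmax hm).
have [m0T pm _ _] := hm; have /andP[m0 _] := m0T.
have [md|dm] := ltP m d.
  have : p m <= p 0 * expR e.
    have := hd m m0T; rewrite sub0r normrN ger0_norm// => /(_ md).
    by rewrite distrC => /(le_lt_trans (ler_norm _)); rewrite mulrBr mulr1; lra.
  rewrite -ler_ln ?posrE ?mulr_gt0 ?p00 ?expR_gt0// lnM ?posrE ?p00 ?expR_gt0// expRK.
  have : m * s <= 0 by rewrite mulr_ge0_le0// ltW.
  by lra.
have h1 : ln (p m) <= ln B by rewrite ler_ln// hB.
have h2 : m * s <= d * s by rewrite ler_nM2r.
have h3 : `|D| <= - (d * s).
  by rewrite -mulrN mulrC -ler_pdivrMr// lerNr ltW.
by have := ler_norm D; move: h3; rewrite {2}/D; lra.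
Qed.

Lemma I_LF_mono s s' : s' <= s -> I_LF p s' <= I_LF p s.
Proof.
move=> ss; have [m hm] := exists_minargmax s; have [m' hm'] := exists_minargmax s'.
have /andP[h _] := I_LF_slope hm hm'.
rewrite -subr_ge0; apply: le_trans h; case: hm' => /andP[m0 _] _ _ _.
by rewrite mulr_ge0// subr_ge0.
Qed.

(** The value at 0 is the limit of [I (ln x)] as [x] decreases to 0. *)
Definition radial_pot (x : R) : R := if x == 0 then ln (p 0) else I_LF p (ln x).

Lemma radial_pot_mono x y : 0 <= x -> x <= y -> radial_pot x <= radial_pot y.
Proof.
move=> x0 xy; rewrite /radial_pot; case: (eqVneq y 0) => [y0|y0].
  have x00 : x = 0 by apply/eqP; rewrite eq_le x0 -y0 xy.
  by rewrite x00 eqxx.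
have y00 : 0 < y by rewrite lt_neqAle eq_sym y0 (le_trans x0).
case: eqVneq => [_|xn0]; first exact: I_LF_ge0.
have x00 : 0 < x by rewrite lt_neqAle eq_sym xn0.
by apply: I_LF_mono; rewrite ler_ln.
Qed.

(** Near 0 both values are close to [ln (p 0)]; away from 0 the slope in [ln x] is at most [T0] and
    [ln (1 + h / x) <= h / x]. Uniformity in [x] lets [e] be fixed before the centres are known. *)
Lemma radial_pot_unif e : 0 < e -> exists2 d, 0 < d &
  forall x h, 0 <= x -> 0 <= h <= d -> radial_pot (x + h) <= radial_pot x + e.
Proof.
move=> e0; have [s0 hs0] := I_LF_bottom e0.
(* Half the threshold, so that [x < x1] and [h <= x1] still give [x + h < expR s0]. *)
pose x1 := expR s0 / 2; have x10 : 0 < x1 by rewrite divr_gt0// expR_gt0.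
exists (Num.min x1 (e * x1 / T0)) => [|x h x0].
  by rewrite lt_min x10 divr_gt0// mulr_gt0.
rewrite le_min => /and3P[h0 hx1 he].
have bot y : 0 <= y -> ln (p 0) <= radial_pot y.
  by move=> y0; apply: le_trans (radial_pot_mono (lexx 0) y0); rewrite /radial_pot eqxx.
have [xx1|x1x] := ltP x x1.
  apply: le_trans (_ : ln (p 0) + e <= _); last by rewrite lerD2r bot.
  rewrite /radial_pot; case: eqVneq => [_|n0]; first by rewrite lerDl ltW.
  have xh0 : 0 < x + h by rewrite lt_neqAle eq_sym n0 addr_ge0.
  apply: hs0; rewrite -[s0]expRK ltr_ln ?posrE ?expR_gt0//.
  by move: xx1 hx1; rewrite /x1; lra.
have xp : 0 < x by exact: lt_le_trans x1x.
have xhp : 0 < x + h by rewrite ltr_wpDr.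
rewrite /radial_pot !gt_eqF//.
have [m hm] := exists_minargmax (ln (x + h)); have [m' hm'] := exists_minargmax (ln x).
have /andP[_] := I_LF_slope hm hm'; rewrite lerBlDr => /le_trans; apply.
rewrite addrC lerD2l; case: hm => /andP[m0 mT] _ _ _.
have -> : x + h = x * (1 + h / x) by field; rewrite gt_eqF.
have hx0 : 0 <= h / x by rewrite divr_ge0// ltW.
rewrite lnM ?posrE ?ltr_pwDl// addrC addKr.
apply: le_trans (_ : T0 * (h / x) <= _).
  apply: ler_pM => //; first by rewrite ln_ge0// lerDl.
  by apply: le_ln1Dx; apply: lt_le_trans hx0; rewrite ltrN10.
move: he; rewrite ler_pdivlMr// => he.
rewrite mulrA ler_pdivrMr// mulrC; apply: le_trans he _.
by rewrite ler_pM2l.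
Qed.

End Legendre.

(** * Rotation invariant measures *)

Section RotationInvariantMeasure.
Context {R : realType}.
Local Notation leb := (@lebesgue_measure R).

Definition pushm d d' (T1 : measurableType d) (T2 : measurableType d')
    (m : {measure set T1 -> \bar R}) (f : T1 -> T2) (mf : measurable_fun setT f) :
    {measure set T2 -> \bar R} :=
  measure_function_pushforward__canonical__measure_function_Measure m mf.

Lemma lebesgue_measure_shift (c : R) (A : set R) : measurable A ->
  leb ((fun x => x + c) @^-1` A) = leb A.
Proof.
move=> mA.
have mc : measurable_fun setT (fun x : measurableTypeR R => x + c : measurableTypeR R).
  by apply: measurable_funD => //; exact: measurable_cst.
rewrite -[LHS]/(pushm leb mc A); apply/esym/(@lebesgue_measure_unique R (pushm leb mc)) => //= _ [[a b]] _ <-.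
rewrite /pushforward /=.
have -> : (fun x => x + c) @^-1` `]a, b]%classic = `]a - c, b - c]%classic.
  by apply/seteqP; split => x /=; rewrite !in_itv/= ltrBlDr lerBrDr.
rewrite !lebesgue_measure_itv/= !lte_fin ltrD2r.
by case: ifP => // _; rewrite -!EFinB; congr EFin; ring.
Qed.

(** The translated window is [[c, T + c]]; its part beyond [T] is carried back by one period onto
    [[0, c]]. *)
Lemma lebesgue_period (c T : R) (A : set R) : measurable A -> 0 <= c <= T ->
  (forall x, A (x + T) <-> A x) ->
  leb (((fun x => x + c) @^-1` A) `&` `[0, T]) = leb (A `&` `[0, T]).
Proof.
move=> mA /andP[c0 cT] perA.
have pt (x : R) : leb [set x] = 0%E by exact: lebesgue_measure_set1.
have E1 : ((fun x => x + c) @^-1` A) `&` `[0, T] =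
    (fun x => x + c) @^-1` (A `&` `[c, T + c]).
  apply/seteqP; split => x /=; rewrite !in_itv/= => -[Ax /andP[? ?]];
    split => //; apply/andP; split; lra.
rewrite E1 lebesgue_measure_shift; last exact: measurableI.
(* The common endpoint is counted twice, which is harmless for a null point. *)
have split1 a b d : a <= b -> b <= d ->
    leb (A `&` `[a, d]) = (leb (A `&` `[a, b]) + leb (A `&` `[b, d]))%E.
  move=> ab bd.
  have -> : A `&` `[a, d]%classic = (A `&` `[a, b]) `|` (A `&` `]b, d]).
    apply/seteqP; split => x /=; rewrite !in_itv/=.
      move=> [Ax /andP[ax xd]]; case: (leP x b) => xb; [left|right]; split => //;
        apply/andP; split => //.
    by move=> [|] [Ax /andP[h1 h2]]; split => //; apply/andP; split => //; lra.
  rewrite measureU//=; [|exact: measurableI|exact: measurableI|]; last first.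
    by apply/seteqP; split => // x /=; rewrite !in_itv/= => -[[_ /andP[_ ?]] [_ /andP[? _]]]; lra.
  congr (_ + _)%E.
  have -> : A `&` `[b, d]%classic = (A `&` [set b]) `|` (A `&` `]b, d]).
    apply/seteqP; split => x /=; rewrite !in_itv/=.
      move=> [Ax /andP[ax xd]]; have [xb|xb] := eqVneq x b; [left|right]; split => //.
      by rewrite xd andbT lt_neqAle eq_sym xb.
    move=> [[Ax xb]|[Ax /andP[h1 h2]]]; split => //; first by rewrite xb lexx.
    by rewrite h2 andbT ltW.
  rewrite measureU//=; [|exact: measurableI|exact: measurableI|]; last first.
    by apply/seteqP; split => // x /=; rewrite !in_itv/= => -[[_ ->] [_ /andP[]]]; rewrite ltxx.
  rewrite (_ : leb (A `&` [set b]) = 0%E) ?add0e//.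
  apply/eqP; rewrite eq_le measure_ge0// andbT -(pt b).
  by apply: le_measure; rewrite ?inE//; exact: measurableI.
have cTc : T <= T + c by lra.
rewrite (split1 c T (T + c))// (split1 0 c T)// addeC; congr (_ + _)%E.
rewrite -(lebesgue_measure_shift T); last exact: measurableI.
congr (leb _); apply/seteqP; split => x /=; rewrite !in_itv/= => -[Ax /andP[? ?]];
    (split; [by apply/perA|apply/andP; split; lra]).
Qed.

Lemma rotationD (a b : R) z : rotation (a + b) z = rotation a (rotation b z).
Proof. by rewrite /rotation cosD sinD /=; congr pair; ring. Qed.

Lemma rotation0 (z : R * R) : rotation 0 z = z.
Proof. by case: z => a b; rewrite /rotation cos0 sin0 /=; congr pair; ring. Qed.

Lemma measurable_rotation (a : R) : measurable_fun setT (@rotation R a).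
Proof.
apply/measurable_fun_pairP; split.
  apply: measurable_funB; apply: measurable_funM => //=.
apply: measurable_funD; apply: measurable_funM => //=.
Qed.

Lemma measurable_cmod : measurable_fun setT (@cmod R).
Proof.
apply: (@measurableT_comp _ _ _ _ _ _ (@Num.sqrt R)).
  by apply: continuous_measurable_fun; exact: sqrt_continuous.
by apply: measurable_funD; apply: measurable_funX.
Qed.

Lemma measurable_disk (r : R) : measurable (@disk R r).
Proof.
rewrite (_ : disk r = @cmod R @^-1` `]-oo, r[%classic).
  by rewrite -[X in measurable X]setTI; apply: measurable_cmod.
by apply/seteqP; split => z; rewrite /= in_itv.
Qed.

Lemma uniform_probE (a b : R) (ab : a < b) (A : set R) : measurable A ->
  uniform_prob ab A = ((b - a)^-1%:E * leb (A `&` `[a, b]))%E.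
Proof.
move=> mA; rewrite /uniform_prob integral_uniform_pdf.
rewrite (eq_integral (fun=> (b - a)^-1%:E)).
  by rewrite integral_cst//; exact: measurableI.
by move=> x; rewrite inE /= in_itv /= => -[_ xab]; rewrite /uniform_pdf xab.
Qed.

(** [tau r] is the prescribed mass of the open disk of radius [r]: hence left continuity, and the
    limit [T0] at infinity, expressed by [tau_left] and [tau_top]. *)
Context (tau : R -> R) (T0 : R) (T0_gt0 : 0 < T0)
  (tau_mono : forall x y, 0 < x -> x <= y -> tau x <= tau y)
  (tau_bd : forall x, 0 < x -> 0 <= tau x <= T0)
  (tau_left : forall x t, 0 < x -> t < tau x -> exists2 y, 0 < y < x & t < tau y)
  (tau_top : forall t, t < T0 -> exists2 y, 0 < y & t < tau y).

(* For [T0 <= t] the set is empty and [inf set0 = 0]. *)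
Definition radial_quantile (t : R) : R := inf [set r | 0 < r /\ t < tau r].
Local Notation rho := radial_quantile.

Lemma radial_quantile_ge0 t : 0 <= rho t.
Proof.
rewrite /rho; have [->|/set0P ne] := eqVneq [set r | 0 < r /\ t < tau r] set0.
  by rewrite inf0.
by apply: lb_le_inf => // r [/ltW].
Qed.

(** Galois connection between a distribution function and its quantile. [tau_left] excludes
    [t < tau c], and [tau_top] makes the defining set nonempty so that the infimum is not its
    default value. *)
Lemma radial_quantile_ge c t : 0 < c -> (c <= rho t) = (tau c <= t < T0).
Proof.
move=> c0; apply/idP/idP => [h|/andP[h1 h2]].
  have tT : t < T0.
    rewrite ltNge; apply/negP => Tt; move: h; rewrite leNgt => /negP; apply.
    rewrite /rho (_ : [set r | _] = set0) ?inf0//.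
    apply/seteqP; split => // r [r0 /lt_le_trans]; have /andP[_ tT] := tau_bd r0.
    by move=> /(_ _ tT); rewrite ltNge Tt.
  rewrite tT andbT leNgt; apply/negP => /(tau_left c0) [y /andP[y0 yc] ty].
  have : rho t <= y by apply: ge_inf => //; exists 0 => r [/ltW].
  by rewrite leNgt (lt_le_trans yc).
have [y y0 ty] := tau_top h2.
apply: lb_le_inf; first by exists y.
move=> r [r0 tr]; rewrite leNgt; apply/negP => rc.
by have := tau_mono r0 (ltW rc); rewrite leNgt (le_lt_trans h1).
Qed.

Lemma measurable_radial_quantile : measurable_fun setT rho.
Proof.
apply: (measurability (@RGenCInfty.G R)); first exact: RGenCInfty.measurableE.
move=> /= _ [_ [r ->] <-]; rewrite setTI.
have [r0|r0] := leP r 0.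
  rewrite (_ : _ @^-1` _ = setT)//; apply/seteqP; split => // t _ /=.
  by rewrite in_itv/= andbT (le_trans r0) ?radial_quantile_ge0.
rewrite (_ : _ @^-1` _ = `[tau r, T0[%classic)//.
by apply/seteqP; split => t /=; rewrite !in_itv/= andbT radial_quantile_ge.
Qed.

Definition polar (z : R * R) : R * R := (rho z.1 * cos z.2, rho z.1 * sin z.2).

Lemma measurable_polar : measurable_fun setT polar.
Proof.
have m1 : measurable_fun setT (fun z : R * R => rho z.1).
  by apply: measurableT_comp => //; exact: measurable_radial_quantile.
have mc : measurable_fun setT (fun z : R * R => cos z.2).
  by apply: measurableT_comp => //; apply: continuous_measurable_fun; exact: continuous_cos.
have ms : measurable_fun setT (fun z : R * R => sin z.2).
  by apply: measurableT_comp => //; apply: continuous_measurable_fun; exact: continuous_sin.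
by apply/measurable_fun_pairP; split; apply: measurable_funM.
Qed.

Lemma cmod_polar z : cmod (polar z) = rho z.1.
Proof.
rewrite /cmod /= !exprMn -mulrDr cos2Dsin2 mulr1 sqrtr_sqr.
by rewrite ger0_norm// radial_quantile_ge0.
Qed.

Lemma pi2_gt0 : 0 < pi *+ 2 :> R.
Proof. by rewrite mulrn_wgt0// pi_gt0. Qed.

(** Inverse transform sampling: [T0] times the law of the point with modulus [rho t] and an
    independent uniform angle, [t] being uniform on [[0, T0]]. *)
Definition polar_measure : {measure set (R * R) -> \bar R} :=
  mscale (NngNum (ltW T0_gt0))
    (pushm (uniform_prob T0_gt0 \x uniform_prob pi2_gt0)%E measurable_polar).

Lemma polar_measureE A : polar_measure A =
  (T0%:E * (uniform_prob T0_gt0 \x uniform_prob pi2_gt0) (polar @^-1` A))%E.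
Proof. by []. Qed.

Lemma polar_measure_disk r : 0 < r -> polar_measure (disk r) = (tau r)%:E.
Proof.
move=> r0; rewrite !polar_measureE.
have -> : polar @^-1` disk r = (~` `[tau r, T0[) `*` setT.
  apply/seteqP; split => z.
    rewrite /disk /= cmod_polar in_itv/= -radial_quantile_ge// ltNge => /negP.
    by [].
  rewrite /disk /= cmod_polar in_itv/= -radial_quantile_ge// => -[/negP].
  by rewrite -ltNge.
rewrite product_measure1E//; last exact: measurableC.
rewrite [X in (_ * (_ * X))%E](_ : _ = 1%E); last first.
  exact: (probability_setT (uniform_prob pi2_gt0)).
rewrite mule1 [X in (_ * X)%E](_ : _ = 1 - uniform_prob T0_gt0 `[tau r, T0[)%E; last first.
  exact: (probability_setC (uniform_prob T0_gt0)).
rewrite uniform_probE// subr0.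
have /andP[t0 tT] := tau_bd r0.
have -> : `[tau r, T0[%classic `&` `[0, T0]%classic = `[tau r, T0[%classic.
  apply/seteqP; split => x /=; rewrite !in_itv/=; first by case.
  by move=> /andP[h1 h2]; split; apply/andP; split=> //; lra.
rewrite lebesgue_measure_itv/= lte_fin; case: ltP => h.
  transitivity (T0 * (1 - T0^-1 * (T0 - tau r)))%:E; first by [].
  congr EFin.
  by field; rewrite gt_eqF.
rewrite mule0 sube0 mule1; congr EFin; lra.
Qed.

Lemma polar_measure_setT : polar_measure setT = T0%:E.
Proof.
by rewrite polar_measureE preimage_setT probability_setT mule1.
Qed.

Lemma polar_rotation (b : R) z : rotation b (polar z) = polar (z.1, z.2 + b).
Proof. by rewrite /rotation /polar /= cosD sinD; congr pair; ring. Qed.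

(** For a fixed radius a rotation shifts the angle, and every angular section is periodic with
    period [pi *+ 2]. *)
Lemma polar_measure_rot_small (b : R) (A : set (R * R)) : measurable A ->
  0 <= b <= pi *+ 2 -> polar_measure (@rotation R b @^-1` A) = polar_measure A.
Proof.
move=> mA hb; rewrite !polar_measureE; congr (_ * _)%E.
rewrite /product_measure1; apply: eq_integral => t _ /=.
have mP : measurable (polar @^-1` A).
  by rewrite -[X in measurable X]setTI; apply: measurable_polar.
have mS : measurable (xsection (polar @^-1` A) t) by exact: measurable_xsection.
have -> : xsection (polar @^-1` (@rotation R b @^-1` A)) t =
    (fun x => x + b) @^-1` (xsection (polar @^-1` A) t).
  by apply/seteqP; split => x; rewrite /xsection /= !inE /= polar_rotation.
rewrite !uniform_probE//; last first.
  rewrite -[X in measurable X]setTI.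
  have mf : measurable_fun setT (fun x : measurableTypeR R => x + b : measurableTypeR R).
    by apply: measurable_funD => //; exact: measurable_cst.
  exact: mf.
congr (_ * _)%E; apply: lebesgue_period => // x.
by rewrite /xsection /= !inE /= /polar /= cosD2pi sinD2pi.
Qed.

Lemma polar_measure_rot (b : R) (A : set (R * R)) : measurable A ->
  polar_measure (@rotation R b @^-1` A) = polar_measure A.
Proof.
have pos (c : R) (B : set (R * R)) : 0 <= c -> measurable B ->
    polar_measure (@rotation R c @^-1` B) = polar_measure B.
  move=> c0 mB.
  (* The rotation is cut into [n] equal ones, each of angle at most one period. *)
  pose n := (Num.truncn (c / (pi *+ 2))).+1.
  pose d := c / n%:R.
  have n0 : 0 < n%:R :> R by rewrite ltr0n.
  have hd : 0 <= d <= pi *+ 2.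
    rewrite divr_ge0//= ler_pdivrMr// mulrC -ler_pdivrMr ?pi2_gt0//.
    by rewrite ltW// truncnS_gt.
  suff h m : polar_measure (@rotation R (d *+ m) @^-1` B) = polar_measure B.
    by rewrite -(h n) -mulr_natr divfK ?gt_eqF.
  elim: m => [|m IH].
    by congr (polar_measure _); apply/seteqP; split => z; rewrite /= mulr0n rotation0.
  rewrite -IH -[RHS](polar_measure_rot_small _ hd); last first.
    by rewrite -[X in measurable X]setTI; apply: measurable_rotation.
  by congr (polar_measure _); apply/seteqP; split => z; rewrite /= -rotationD mulrSr.
move=> mA; have [b0|b0] := leP 0 b; first exact: pos.
rewrite -[LHS](pos (- b)); first last.
- by rewrite -[X in measurable X]setTI; apply: measurable_rotation.
- by rewrite oppr_ge0 ltW.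
by congr (polar_measure _); apply/seteqP; split => z; rewrite /= -rotationD subrr rotation0.
Qed.

End RotationInvariantMeasure.

(** * Potential of a rotation invariant measure *)

Section SlopeUnique.
Context {R : realType}.

(** Over one step of length [d] the two increments differ by at most [d] times the increase of
    [tau]; over a partition this telescopes to at most [T0 * d], which tends to 0. *)
Lemma slope_unique (I J tau : R -> R) (T0 : R) :
  (forall s, 0 <= tau s <= T0) ->
  (forall s t, t <= s -> tau t * (s - t) <= I s - I t <= tau s * (s - t)) ->
  (forall s t, t <= s -> tau t * (s - t) <= J s - J t <= tau s * (s - t)) ->
  forall s t, J s - J t = I s - I t.
Proof.
move=> tb hI hJ.
suff h s t : t <= s -> J s - J t = I s - I t.
  by move=> s t; have [/h//|/ltW/h] := leP t s; lra.
move=> ts; apply/eqP; rewrite -subr_eq0 -normr_le0; apply/ler_addgt0Pl => e e0.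
rewrite addr0.
pose n := (Num.truncn (T0 * (s - t) / e)).+1.
have n0 : 0 < n%:R :> R by rewrite ltr0n.
have hn : T0 * (s - t) / n%:R <= e.
  rewrite ler_pdivrMr// [e * _]mulrC -ler_pdivrMr//.
  by rewrite ltW// truncnS_gt.
pose d := (s - t) / n%:R.
have d0 : 0 <= d by rewrite divr_ge0 ?subr_ge0// ltW.
pose x k := t + k%:R * d.
have xs : x n = s by rewrite /x mulrC divfK ?gt_eqF//; lra.
have x0 : x 0%N = t by rewrite /x mul0r addr0.
have step k : `|J (x k) - J t - (I (x k) - I t)| <= (tau (x k) - tau t) * d.
  elim: k => [|k IH].
    by rewrite x0 !subrr normr0 mul0r.
  have dx : x k.+1 - x k = d by rewrite /x -natr1; ring.
  have xx : x k <= x k.+1 by rewrite -subr_ge0 dx.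
  have /andP[i1 i2] := hI _ _ xx; have /andP[j1 j2] := hJ _ _ xx.
  rewrite dx in i1 i2 j1 j2.
  move: IH; rewrite !ler_norml => /andP[h1 h2]; apply/andP; split; lra.
have := step n; rewrite xs => h; apply: le_trans h _; apply: le_trans hn.
have /andP[ts0 tsT] := tb s; have /andP[tt0 _] := tb t.
rewrite -mulrA -/d ler_wpM2r//; lra.
Qed.

End SlopeUnique.

Section RadialIntegral.
Context {R : realType} (mu : {measure set (R * R) -> \bar R}) (T0 : R).
Context (mu_T : mu setT = T0%:E)
  (mu_rot : forall (b : R) (A : set (R * R)), measurable A ->
     mu (@rotation R b @^-1` A) = mu A).
Implicit Types f g : R * R -> R.

Definition bdm f := measurable_fun setT f /\ exists K : R, forall z, `|f z| <= K.

Lemma bdm_integrable f : bdm f -> mu.-integrable setT (EFin \o f).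
Proof.
move=> [mf [K hK]]; apply: measurable_bounded_integrable => //.
  by rewrite mu_T ltry.
exists K; split; first exact: num_real.
by move=> x Kx y _; apply: le_trans (hK y) (ltW Kx).
Qed.

Lemma bdmD f g : bdm f -> bdm g -> bdm (fun z => f z + g z).
Proof.
move=> [mf [K hK]] [mg [K' hK']]; split; first exact: measurable_funD.
by exists (K + K') => z; apply: le_trans (ler_normD _ _) _; apply: lerD.
Qed.

Lemma bdm_cst (k : R) : bdm (fun=> k).
Proof. by split; [exact: measurable_cst|exists `|k|]. Qed.

Lemma bdmZ (k : R) f : bdm f -> bdm (fun z => k * f z).
Proof.
move=> [mf [K hK]]; split; first by apply: measurable_funM => //; exact: measurable_cst.
by exists (`|k| * K) => z; rewrite normrM ler_wpM2l.
Qed.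

Lemma bdm_sum (I : Type) (s : seq I) (F : I -> R * R -> R) :
  (forall i, bdm (F i)) -> bdm (fun z => \sum_(i <- s) F i z).
Proof.
move=> h; elim: s => [|i s IH].
  by rewrite (_ : (fun z => _) = fun=> 0); [exact: bdm_cst|apply/funext => a; rewrite big_nil].
rewrite (_ : (fun z => _) = fun z => F i z + \sum_(j <- s) F j z); first exact: bdmD.
by apply/funext => a; rewrite big_cons.
Qed.

Lemma Rintegral_sum (I : Type) (s : seq I) (F : I -> R * R -> R) :
  (forall i, bdm (F i)) ->
  \int[mu]_z (\sum_(i <- s) F i z) = \sum_(i <- s) \int[mu]_z (F i z).
Proof.
move=> h; elim: s => [|i s IH].
  rewrite big_nil -[RHS](mul0r (fine (mu setT))) -Rintegral_cst//.
  by apply: eq_Rintegral => z _; rewrite big_nil.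
rewrite big_cons -IH -RintegralD//; try exact/bdm_integrable/bdm_sum; try exact: bdm_integrable.
by apply: eq_Rintegral => z _; rewrite big_cons.
Qed.

Lemma le_Rint f g : bdm f -> bdm g -> (forall z, f z <= g z) ->
  \int[mu]_z f z <= \int[mu]_z g z.
Proof. by move=> bf bg h; apply: le_Rintegral => //; exact: bdm_integrable. Qed.

Lemma Rintegral_rotation f b : bdm f -> \int[mu]_z f (rotation b z) = \int[mu]_z f z.
Proof.
move=> bf; rewrite /Rintegral; congr fine.
have [mf [K hK]] := bf.
have mr := @measurable_rotation R b.
rewrite [RHS](@eq_measure_integral _ _ _ setT (pushm mu mr)) => [|A mA _]; last first.
  by rewrite -(mu_rot b).
have intf : mu.-integrable setT (EFin \o (f \o @rotation R b)).
  apply: bdm_integrable; split; first exact: measurableT_comp.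
  by exists K => z; exact: hK.
have mEf : measurable_fun setT (EFin \o f) by exact/measurable_EFinP.
by rewrite (integral_pushforward mr mEf intf).
Qed.

Lemma measurable_cabsB (w : R[i]) : measurable_fun setT (fun z : R * R => cabs (toC z - w)).
Proof.
rewrite (_ : (fun z => _) = fun z : R * R => cmod (z.1 - complex.Re w, z.2 - complex.Im w)).
  apply: measurableT_comp; first exact: measurable_cmod.
  by apply/measurable_fun_pairP; split; apply: measurable_funB => //; exact: measurable_cst.
by apply/funext => -[x y]; case: w.
Qed.

Lemma measurable_psi e (w : R[i]) : measurable_fun setT (fun z : R * R => psi e (toC z - w)).
Proof.
apply: measurableT_comp; first exact: measurable_ln.
by apply: measurable_maxr; [exact: measurable_cabsB|exact: measurable_cst].
Qed.

Lemma cabs_toC (z : R * R) : cabs (toC z) = cmod z. Proof. by case: z. Qed.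

Lemma measurable_psi0 e : measurable_fun setT (fun z : R * R => psi e (toC z)).
Proof.
have := measurable_psi e 0; rewrite (_ : (fun z => _) = fun z : R * R => psi e (toC z))//.
by apply/funext => z; rewrite subr0.
Qed.

(** [psi] grows at infinity, but moving its centre costs at most [cabs w / e] and changing its
    radius a constant. Subtracting [psi 1] thus makes every potential integrable. *)
Lemma bdm_psi_diff e e' (w : R[i]) : 0 < e -> 0 < e' ->
  bdm (fun z => psi e (toC z - w) - psi e' (toC z)).
Proof.
move=> e0 e'0; split.
  by apply: measurable_funB; [exact: measurable_psi|exact: measurable_psi0].
have me : 0 < Num.min e e' by rewrite lt_min e0.
pose m := Num.min e e'; pose M := Num.max e e'.
have Mm x : psi M x <= psi m x + (M - m) / m.
  have m0 : 0 < m by [].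
  have mM : m <= M by rewrite /m /M ge_min le_max lexx.
  have c0 : 0 <= (M - m) / m by rewrite divr_ge0 ?subr_ge0// ltW.
  rewrite /psi; set c := cabs x.
  apply: le_trans (_ : ln (Num.max c m * (1 + (M - m) / m)) <= _).
    rewrite ler_ln ?posrE ?mulr_gt0 ?max_gt0 ?ltr_pwDl ?(lt_le_trans m0 mM)//.
    have -> : 1 + (M - m) / m = M / m by field; rewrite gt_eqF.
    have Mm1 : 1 <= M / m by rewrite ler_pdivlMr// mul1r.
    rewrite ge_max; apply/andP; split.
      apply: le_trans (_ : Num.max c m * 1 <= _); first by rewrite mulr1 le_max lexx.
      by rewrite ler_pM2l ?max_gt0.
    rewrite mulrA ler_pdivlMr// mulrC ler_wpM2r ?(le_trans (ltW m0) mM)//.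
    by rewrite le_max lexx orbT.
  rewrite lnM ?posrE ?max_gt0 ?ltr_pwDl// lerD2l; apply: le_ln1Dx.
  by apply: lt_le_trans c0; rewrite ltrN10.
exists (cabs w / e + (M - m) / m) => z.
rewrite (_ : _ - _ = (psi e (toC z - w) - psi e (toC z)) + (psi e (toC z) - psi e' (toC z))); last by ring.
apply: le_trans (ler_normD _ _) _; apply: lerD.
  apply: le_trans (psi_lip _ _ e0) _.
  by rewrite (_ : _ - w - _ = - w) ?cabsN//; ring.
have h1 := Mm (toC z).
have h2 : psi m (toC z) <= psi e (toC z) by rewrite ler_psi// /m ge_min lexx.
have h3 : psi m (toC z) <= psi e' (toC z) by rewrite ler_psi// /m ge_min lexx orbT.
have h4 : psi e (toC z) <= psi M (toC z) by rewrite ler_psi// /M le_max lexx.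
have h5 : psi e' (toC z) <= psi M (toC z) by rewrite ler_psi// /M le_max lexx orbT.
by rewrite ler_norml; apply/andP; split; lra.
Qed.

Lemma bdm_psi_diff0 e e' : 0 < e -> 0 < e' ->
  bdm (fun z => psi e (toC z) - psi e' (toC z)).
Proof.
move=> e0 e'0; have := bdm_psi_diff 0 e0 e'0.
rewrite (_ : (fun z => _) = fun z => psi e (toC z) - psi e' (toC z))//.
by apply/funext => z; rewrite subr0.
Qed.

(** Links algebraic roots of unity with [rotation]: the angle is [acos x] up to the sign of the
    imaginary part, as the sine is nonnegative on the range of [acos]. *)
Lemma unit_angle (u : R[i]) : cabs u = 1 ->
  exists b, forall z : R * R, toC (rotation b z) = u * toC z.
Proof.
case: u => x y; rewrite /cabs /cmod /= => h.
have h2 : x ^+ 2 + y ^+ 2 = 1.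
  by rewrite -[LHS]sqr_sqrtr ?h ?expr1n// addr_ge0 ?sqr_ge0.
have x1 : -1 <= x <= 1 by apply/andP; split; nra.
have [b0 cb] := acos_def x1.
have sb : sin (acos x) = `|y|.
  have s0 : 0 <= sin (acos x) by apply: sin_ge0_pi.
  rewrite -(ger0_norm s0) -!sqrtr_sqr sin2cos2 cb; congr Num.sqrt; lra.
exists (if 0 <= y then acos x else - acos x) => -[a c].
rewrite /toC /rotation /=.
have [-> ->] : cos (if 0 <= y then acos x else - acos x) = x /\
    sin (if 0 <= y then acos x else - acos x) = y.
  case: (leP 0 y) sb => y0 sb; rewrite ?cosN ?sinN cb sb; split => //.
    by rewrite ger0_norm.
  by rewrite ltr0_norm// opprK.
by apply/eqP; rewrite eq_complex /=; apply/andP; split; apply/eqP; ring.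
Qed.

Context (tau : R -> R) (mu_disk : forall r, 0 < r -> mu (disk r) = (tau r)%:E).

Lemma bdm_disk (r : R) : bdm (\1_(disk r)).
Proof.
split; first by apply: measurable_indic; exact: measurable_disk.
by exists 1 => z; rewrite indicE; case: (_ \in _); rewrite ?normr1// normr0.
Qed.

Lemma Rintegral_disk (k r : R) : 0 < r ->
  \int[mu]_z (k * \1_(disk r) z) = k * tau r.
Proof.
move=> r0; rewrite RintegralZl//; last by apply: bdm_integrable; exact: bdm_disk.
rewrite /Rintegral integral_indic ?setIT; last exact: measurable_disk.
  by rewrite mu_disk.
by [].
Qed.

(** Mean over the circle of radius [expR s] around 0 of the logarithmic potential of [mu],
    normalised to vanish at [s = 0]. *)
Definition log_potential (s : R) := \int[mu]_z (psi (expR s) (toC z) - psi 1 (toC z)).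

(** The map [s |-> ln (max (cabs z) (expR s))] has slope 1 while [cabs z < expR s] and 0 otherwise;
    so the integrand lies between [s - t] times the indicators of the two disks. *)
Lemma log_potential_slope s t : t <= s ->
  tau (expR t) * (s - t) <= log_potential s - log_potential t <= tau (expR s) * (s - t).
Proof.
move=> ts.
have bde u : bdm (fun z => psi (expR u) (toC z) - psi 1 (toC z)).
  exact: bdm_psi_diff0 (expR_gt0 u) ltr01.
rewrite /log_potential -RintegralB//; try exact/bdm_integrable/bde.
have E : \int[mu]_z (psi (expR s) (toC z) - psi 1 (toC z) - (psi (expR t) (toC z) - psi 1 (toC z)))
   = \int[mu]_z (psi (expR s) (toC z) - psi (expR t) (toC z)).
  by apply: eq_Rintegral => z _; ring.
have est : expR t <= expR s by rewrite ler_expR.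
rewrite E -!(mulrC (s - t)) -!Rintegral_disk ?expR_gt0//.
have bd := bdm_psi_diff0 (expR_gt0 s) (expR_gt0 t).
have lnt (c : R) : expR t <= c -> t <= ln c.
  by move=> h; rewrite -{1}(expRK t) ler_ln ?posrE ?expR_gt0// (lt_le_trans (expR_gt0 t)).
apply/andP; split.
  apply: le_Rint => //; first exact/bdmZ/bdm_disk.
  move=> z; rewrite indicE; case: (boolP (z \in _)); last first.
    by move=> _; rewrite mulr0 subr_ge0 ler_psi ?expR_gt0.
  rewrite inE /disk /= -cabs_toC mulr1 => zt.
  by rewrite /psi (max_idPr (ltW zt)) (max_idPr (ltW (lt_le_trans zt est))) !expRK.
apply: le_Rint => //; first exact/bdmZ/bdm_disk.
move=> z; rewrite indicE; case: (boolP (z \in _)).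
  rewrite inE /disk /= -cabs_toC mulr1 => zt.
  rewrite /psi (max_idPr (ltW zt)) expRK lerD2l lerN2; apply: lnt.
  by rewrite le_max lexx orbT.
rewrite notin_setE /disk /= -cabs_toC => /negP; rewrite -leNgt mulr0 => zs.
by rewrite /psi (max_idPl zs) (max_idPl (le_trans est zs)) subrr.
Qed.

Definition circle_potential e w := \int[mu]_z (psi e (toC z - w) - psi 1 (toC z)).

(** By invariance the integrand may be averaged over [M] rotations, and polygon averages compare it
    with [psi] centred at 0. The error [K] is independent of [M], so it disappears after division by
    [M]. *)
Lemma circle_potential_bounds e w : 0 < e -> w != 0 ->
  log_potential (ln (cabs w)) <= circle_potential e w <= log_potential (ln (cabs w + e)).
Proof.
move=> e0; rewrite -cabs_gt0 => w0.
have we0 : 0 < cabs w + e by rewrite addr_gt0.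
pose K := T0 * (ln 2 + cabs w / e).
have ln20 : 0 <= ln 2 :> R by rewrite ln_ge0// ler1n.
have cwe : 0 <= cabs w / e by rewrite divr_ge0 ?cabs_ge0// ltW.
have T0_ge0 : 0 <= T0 by rewrite -lee_fin -mu_T measure_ge0.
have bw := bdm_psi_diff w e0 ltr01.
have key M : (0 < M)%N ->
    M%:R * log_potential (ln (cabs w)) - K <= M%:R * circle_potential e w
      <= M%:R * log_potential (ln (cabs w + e)) + K.
  move=> M0; have [zeta pz] := @prim_root_exists_C R M M0.
  have /choice[b hb] : forall k : nat, exists b, forall z : R * R,
      toC (rotation b z) = zeta ^+ k * toC z.
    by move=> k; apply: unit_angle; rewrite cabsX (cabs_prim M0 pz) expr1n.
  have E : M%:R * circle_potential e w = \int[mu]_z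
      (\sum_(k < M) (psi e (toC (rotation (b k) z) - w) - psi 1 (toC (rotation (b k) z)))).
    have bk (k : 'I_M) : bdm (fun z =>
        psi e (toC (rotation (b k) z) - w) - psi 1 (toC (rotation (b k) z))).
      have [mf [C hC]] := bw; split.
        by apply: (measurableT_comp mf); exact: measurable_rotation.
      by exists C => z; exact: hC.
    rewrite (@Rintegral_sum _ (index_enum 'I_M) (fun k z =>
        psi e (toC (rotation (b k) z) - w) - psi 1 (toC (rotation (b k) z))))//.
    rewrite mulr_natl -[M in LHS](card_ord M) -sumr_const; apply: eq_bigr => k _.
    by rewrite -[LHS](Rintegral_rotation (b k) bw).
  rewrite E.
  have Sk z : \sum_(k < M) (psi e (toC (rotation (b k) z) - w) - psi 1 (toC (rotation (b k) z)))
     = \sum_(k < M) psi e (w - toC z * zeta ^+ k) - M%:R * psi 1 (toC z).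
    rewrite sumrB; congr (_ - _).
      by apply: eq_bigr => k _; rewrite hb -psiN opprB mulrC.
    rewrite mulr_natl -[M in RHS](card_ord M) -sumr_const; apply: eq_bigr => k _.
    by rewrite hb /psi cabsM cabsX (cabs_prim M0 pz) expr1n mul1r.
  have bdS : bdm (fun z => \sum_(k < M) (psi e (toC (rotation (b k) z) - w) - psi 1 (toC (rotation (b k) z)))).
    apply: bdm_sum => k; have [mf [C hC]] := bw; split.
      by apply: (measurableT_comp mf); exact: measurable_rotation.
    by exists C => z; exact: hC.
  have int_lin x c : 0 < x -> bdm (fun z => M%:R * (psi x (toC z) - psi 1 (toC z)) + c)
     /\ \int[mu]_z (M%:R * (psi x (toC z) - psi 1 (toC z)) + c) =
         M%:R * log_potential (ln x) + c * T0.
    move=> x0; have b1 := bdm_psi_diff0 x0 ltr01.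
    split; first by apply: bdmD; [exact: bdmZ|exact: bdm_cst].
    rewrite RintegralD//; try exact/bdm_integrable/bdmZ; try exact/bdm_integrable/bdm_cst.
    rewrite RintegralZl//; last exact: bdm_integrable.
    by rewrite Rintegral_cst// mu_T /log_potential lnK.
  apply/andP; split.
    have [b1 i1] := int_lin _ (- (ln 2 + cabs w / e)) w0.
    rewrite (_ : _ - K = M%:R * log_potential (ln (cabs w)) + - (ln 2 + cabs w / e) * T0); last first.
      by rewrite /K; ring.
    rewrite -i1; apply: le_Rint => // z; rewrite Sk.
    have := psi_avg_ge (a := toC z) (z := w) M0 pz e0.
    rewrite lt_max w0 orbT => /(_ isT) h.
    have h2 : Num.min (cabs w) (2 * cabs (toC z)) / e <= cabs w / e.
      by rewrite ler_pM2r ?invr_gt0// ge_min lexx.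
    by rewrite /psi mulrBr; move: h h2; rewrite /psi; lra.
  have [b1 i1] := int_lin _ (ln 2 + cabs w / e) we0.
  rewrite (_ : _ + K = M%:R * log_potential (ln (cabs w + e)) + (ln 2 + cabs w / e) * T0); last first.
    by rewrite /K; ring.
  rewrite -i1.
  apply: le_Rint => // z; rewrite Sk.
  have h := psi_avg_le w (toC z) M0 pz e0.
  by rewrite mulrBr; move: h; rewrite /psi; lra.
have lim (x y : R) : (forall M, (0 < M)%N -> M%:R * x <= M%:R * y + K) -> x <= y.
  move=> h; apply/ler_addgt0Pl => d d0.
  pose M := (Num.truncn (K / d)).+1.
  have M0 : 0 < M%:R :> R by rewrite ltr0n.
  rewrite -(ler_pM2l M0) mulrDr addrC; apply: le_trans (h M isT) _.
  by rewrite lerD2l -ler_pdivrMr// ltW// truncnS_gt.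
apply/andP; split; apply: lim => M M0; have /andP[h1 h2] := key M M0 => //.
by rewrite -lerBlDr.
Qed.

End RadialIntegral.

(** A countable choice of combinations, used to obtain measurability through pointwise limits. *)
Lemma potential_approx_seq {R : realType} (F : R[i] -> R) : potential_approx F ->
  exists (e : nat -> R) (cs : nat -> seq (R * R[i])), forall n,
  [/\ 0 < e n, all (fun q => q.2 != 0) (cs n), \sum_(q <- cs n) q.1 = 0 &
      forall a, `|F a - combo (cs n) (e n) a| <= n.+1%:R^-1].
Proof.
move=> hF.
have h n : exists q : R * seq (R * R[i]), [/\ 0 < q.1, all (fun q => q.2 != 0) q.2,
    \sum_(r <- q.2) r.1 = 0 & forall a, `|F a - combo q.2 q.1 a| <= n.+1%:R^-1].
  have n0 : 0 < n.+1%:R^-1 :> R by rewrite invr_gt0.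
  have [C C0 [e0 e00 /(_ (e0 / 2))]] := hF _ n0.
  move=> []; first by apply/andP; split; lra.
  by move=> cs [? ? ? ?]; exists (e0 / 2, cs); split => //; rewrite divr_gt0.
have /choice[f hf] := h; exists (fun n => (f n).1), (fun n => (f n).2) => n.
exact: hf.
Qed.

Lemma combo_approx_cvg {R : realType} (F : R[i] -> R) (f : nat -> R[i] -> R) a :
  (forall n, `|F a - f n a| <= n.+1%:R^-1) -> f n a @[n --> \oo] --> F a.
Proof.
move=> h; apply/cvgrPdist_le => eps eps0.
have := @cvg_harmonic R => /cvgrPdist_le /(_ _ eps0).
apply: filterS => n; rewrite sub0r normrN /= => hn.
by apply: le_trans (h n) _; apply: le_trans (ler_norm _) hn.
Qed.

Section IntegralOfTestFunction.
Context {R : realType} (mu : {measure set (R * R) -> \bar R}) (T0 : R).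
Context (mu_T : mu setT = T0%:E)
  (mu_rot : forall (b : R) (A : set (R * R)), measurable A ->
     mu (@rotation R b @^-1` A) = mu A)
  (tau : R -> R) (mu_disk : forall r, 0 < r -> mu (disk r) = (tau r)%:E)
  (tau_bd : forall r, 0 < r -> 0 <= tau r <= T0)
  (I : R -> R) (I_slope : forall s t, t <= s ->
     tau (expR t) * (s - t) <= I s - I t <= tau (expR s) * (s - t)).

Lemma measurable_approx (F : R[i] -> R) : potential_approx F ->
  measurable_fun setT (fun z : R * R => F (toC z)).
Proof.
move=> hF; have [e [cs h]] := potential_approx_seq hF.
apply: (@measurable_fun_cvg _ _ _ _ (fun n z => combo (cs n) (e n) (toC z))) => [n|z _].
  rewrite /combo; elim: (cs n) => [|q s IH].
    under eq_fun do rewrite big_nil; exact: measurable_cst.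
  under eq_fun do rewrite big_cons; apply: measurable_funD => //.
  by apply: measurable_funM; [exact: measurable_cst|exact: measurable_psi].
apply: (@combo_approx_cvg R F (fun n => combo (cs n) (e n)) (toC z)) => n.
by have [_ _ _] := h n; apply.
Qed.

Lemma circle_potential_pot e w : 0 < e -> w != 0 ->
  I (ln (cabs w)) - I 0 <= circle_potential mu e w <= I (ln (cabs w + e)) - I 0.
Proof.
move=> e0 w0.
have J s : log_potential mu s = I s - I 0.
  have h := @slope_unique R I (log_potential mu) (fun s => tau (expR s)) T0
    (fun s => tau_bd (expR_gt0 s)) I_slope
    (fun s t => log_potential_slope mu_T mu_disk (s := s) (t := t)).
  rewrite -h -[LHS]subr0; congr (_ - _).
  rewrite /log_potential expR0 -[LHS](mul0r (fine (mu setT))) -Rintegral_cst//.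
  by apply: eq_Rintegral => z _; rewrite subrr.
by rewrite -!J; exact: (circle_potential_bounds mu_T mu_rot).
Qed.

(** The coefficients sum to 0, so the additive constants [psi 1] and [I 0] cancel. The approximation
    error is multiplied by the mass [T0], the error of the potential at each centre by [C]. *)
Lemma integral_combo (F : R[i] -> R) cs e eps C delta :
  bdm (fun z => F (toC z)) -> 0 < e -> all (fun q => q.2 != 0) cs ->
  \sum_(q <- cs) q.1 = 0 -> \sum_(q <- cs) `|q.1| <= C ->
  (forall a, `|F a - combo cs e a| <= eps) -> 0 <= delta ->
  (forall w, w != 0 -> I (ln (cabs w + e)) <= I (ln (cabs w)) + delta) ->
  `|\int[mu]_z F (toC z) - \sum_(q <- cs) q.1 * I (ln (cabs q.2))| <= T0 * eps + C * delta.
Proof.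
move=> bF e0 nz s0 sC hF d0 hI.
have bc : bdm (fun z => \sum_(q <- cs) q.1 * (psi e (toC z - q.2) - psi 1 (toC z))).
  by apply: bdm_sum => q; apply: bdmZ; exact: bdm_psi_diff.
have cE z : combo cs e (toC z) = \sum_(q <- cs) q.1 * (psi e (toC z - q.2) - psi 1 (toC z)).
  under [RHS]eq_bigr do rewrite mulrBr.
  by rewrite sumrB -mulr_suml s0 mul0r subr0.
have i1 : `|\int[mu]_z F (toC z) - \sum_(q <- cs) q.1 * circle_potential mu e q.2| <= T0 * eps.
  have -> : \sum_(q <- cs) q.1 * circle_potential mu e q.2 =
      \int[mu]_z \sum_(q <- cs) q.1 * (psi e (toC z - q.2) - psi 1 (toC z)).
    rewrite (Rintegral_sum mu_T) => [|q]; last by apply: bdmZ; exact: bdm_psi_diff.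
    apply: eq_bigr => q _; rewrite RintegralZl//.
    by apply: (bdm_integrable mu_T); exact: bdm_psi_diff.
  rewrite -RintegralB//; [|exact: (bdm_integrable mu_T)|exact: (bdm_integrable mu_T)].
  apply: le_trans (le_normr_Rintegral _ _) _ => //.
    apply: (bdm_integrable mu_T); rewrite (_ : (fun z => _) = fun z => F (toC z) +
      -1 * \sum_(q <- cs) q.1 * (psi e (toC z - q.2) - psi 1 (toC z))).
      by apply: bdmD => //; apply: bdmZ.
    by apply/funext => z; rewrite mulN1r.
  apply: (@le_trans _ _ (\int[mu]_z eps)).
    apply: (le_Rint mu_T); last by move=> z; rewrite -cE.
      have [mf [K hK]] : bdm (fun z => F (toC z) +
          -1 * \sum_(q <- cs) q.1 * (psi e (toC z - q.2) - psi 1 (toC z))).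
        by apply: bdmD => //; apply: bdmZ.
      split.
        apply: (@measurableT_comp _ _ _ _ _ _ (@Num.norm R R)); first exact: normr_measurable.
        by move: mf; under eq_fun do rewrite mulN1r.
      by exists K => z; rewrite normr_id; have := hK z; rewrite mulN1r.
    exact: bdm_cst.
  by rewrite Rintegral_cst// mu_T mulrC.
have i2 : `|\sum_(q <- cs) q.1 * circle_potential mu e q.2 -
    \sum_(q <- cs) q.1 * I (ln (cabs q.2))| <= C * delta.
  have -> : \sum_(q <- cs) q.1 * I (ln (cabs q.2)) =
      \sum_(q <- cs) q.1 * (I (ln (cabs q.2)) - I 0).
    under [RHS]eq_bigr do rewrite mulrBr.
    by rewrite sumrB -mulr_suml s0 mul0r subr0.
  rewrite -sumrB; apply: le_trans (ler_norm_sum _ _ _) _.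
  apply: (@le_trans _ _ (\sum_(q <- cs) `|q.1| * delta)); last first.
    by rewrite -mulr_suml ler_wpM2r.
  rewrite big_seq [leRHS]big_seq; apply: ler_sum => q qcs.
  rewrite -mulrBr normrM ler_wpM2l//.
  have q0 : q.2 != 0 by move/allP : nz => /(_ _ qcs).
  have /andP[h1 h2] := circle_potential_pot e0 q0; have h3 := hI _ q0.
  by rewrite ler_norml; apply/andP; split; lra.
rewrite (_ : _ - _ = (\int[mu]_z F (toC z) - \sum_(q <- cs) q.1 * circle_potential mu e q.2)
   + (\sum_(q <- cs) q.1 * circle_potential mu e q.2 - \sum_(q <- cs) q.1 * I (ln (cabs q.2)))); last by ring.
by apply: le_trans (ler_normD _ _) _; apply: lerD.
Qed.

End IntegralOfTestFunction.

(** * Anticoncentration of random sums *)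

Section LazyWalk.
Context {R : realType} (rho : R) (rho_gt0 : 0 < rho) (rho_le : rho <= 2^-1).

(* Probability that the lazy walk with steps [+1, -1] of probability [rho]
   each, started at [l], has not hit [0] after [k] steps. *)
Fixpoint survival (k l : nat) : R :=
  match l with
  | 0 => 0
  | l'.+1 => if k is k'.+1 then
      (1 - 2 * rho) * survival k' l'.+1 + rho * (survival k' l'.+2 + survival k' l')
    else 1
  end.

Lemma survival0 k : survival k 0 = 0. Proof. by case: k. Qed.

Lemma survival_ge0 k l : 0 <= survival k l.
Proof.
elim: k l => [|k IH] [|l] //=.
have := IH l; have := IH l.+1; have := IH l.+2.
move: (survival _ _) (survival _ _) (survival _ _) => a b c a0 b0 c0.
have r2 : 0 <= 1 - 2 * rho by rewrite subr_ge0 mulrC -ler_pdivlMr// mul1r.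
by apply: addr_ge0; apply: mulr_ge0 => //; [exact: ltW|exact: addr_ge0].
Qed.

Lemma survival_le1 k l : survival k l <= 1.
Proof.
elim: k l => [|k IH] [|l] //=.
have := IH l; have := IH l.+1; have := IH l.+2.
move: (survival _ _) (survival _ _) (survival _ _) => a b c a0 b0 c0.
rewrite [leRHS](_ : 1 = (1 - 2 * rho) * 1 + rho * (1 + 1)); last by ring.
have r2 : 0 <= 1 - 2 * rho by rewrite subr_ge0 mulrC -ler_pdivlMr// mul1r.
by apply: lerD; apply: ler_wpM2l => //; [exact: ltW|exact: lerD].
Qed.

Lemma survival_decr k l : survival k.+1 l <= survival k l.
Proof.
elim: k l => [|k IH] [|l] //; first exact: survival_le1.
rewrite -[survival k.+2 _]/((1 - 2 * rho) * survival k.+1 l.+1 +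
  rho * (survival k.+1 l.+2 + survival k.+1 l)).
rewrite -[survival k.+1 l.+1 in leRHS]/((1 - 2 * rho) * survival k l.+1 +
  rho * (survival k l.+2 + survival k l)).
have r2 : 0 <= 1 - 2 * rho by rewrite subr_ge0 mulrC -ler_pdivlMr// mul1r.
apply: lerD; first by apply: ler_wpM2l; [exact: r2|exact: IH].
by apply: ler_wpM2l; [exact: ltW|apply: lerD; exact: IH].
Qed.

(** The decreasing limit [B l] satisfies [B l.+2 = 2 * B l.+1 - B l] with [B 0 = 0], so it is linear
    in [l]; being bounded by 1 it vanishes. *)
Lemma survival_cvg0 : survival k 1 @[k --> \oo] --> (0 : R).
Proof.
have cv l : cvgn (survival^~ l).
  apply: nonincreasing_is_cvgn.
    by apply/nonincreasing_seqP => k; exact: survival_decr.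
  by exists 0 => _ [k _ <-]; exact: survival_ge0.
pose B l : R := limn (survival^~ l).
have hB l : survival k l @[k --> \oo] --> B l by exact: cv.
have B0 : B 0%N = 0.
  apply: cvg_lim => //; rewrite (_ : survival^~ 0%N = fun=> 0); first exact: cvg_cst.
  by apply/funext => k; exact: survival0.
have rec l : B l.+2 = 2 * B l.+1 - B l.
  have h1 : survival k.+1 l.+1 @[k --> \oo] --> B l.+1.
    by have := hB l.+1; rewrite -(cvg_shiftS (survival^~ l.+1)).
  have h2 : survival k.+1 l.+1 @[k --> \oo] -->
      (1 - 2 * rho) * B l.+1 + rho * (B l.+2 + B l).
    apply: cvgD; first by apply: cvgMr; exact: hB.
    by apply: cvgMr; apply: cvgD; exact: hB.
  have h : B l.+1 = (1 - 2 * rho) * B l.+1 + rho * (B l.+2 + B l).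
    by apply: (cvg_unique _ h1 h2) => //; exact: norm_hausdorff.
  have : rho * (B l.+2 - (2 * B l.+1 - B l)) = 0 by move: (B l.+2) (B l.+1) (B l) h => b2 b1 b0 h; lra.
  by move/eqP; rewrite mulf_eq0 gt_eqF//= subr_eq0 => /eqP.
have lin l : B l = l%:R * B 1%N /\ B l.+1 = l.+1%:R * B 1%N.
  elim: l => [|l [h1 h2]]; first by rewrite B0 mul0r mul1r.
  by split => //; rewrite rec h1 h2 -!natr1; ring.
have Bb l : 0 <= B l <= 1.
  apply/andP; split.
    by apply: limr_ge => //; apply: nearW => k; exact: survival_ge0.
  by apply: limr_le => //; apply: nearW => k; exact: survival_le1.
have : B 1%N = 0.
  apply/eqP; rewrite eq_le; have /andP[-> _] := Bb 1%N; rewrite andbT.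
  rewrite leNgt; apply/negP => b0.
  pose n := (Num.truncn (B 1%N)^-1).+1.
  have := Bb n => /andP[_]; rewrite (lin n).1 leNgt => /negP; apply.
  by rewrite -ltr_pdivrMr// div1r truncnS_gt.
by move=> <-; exact: hB.
Qed.

End LazyWalk.

Section Convolution.
Context {R : realType} d (Omega : measurableType d) (P : probability Omega R).

Lemma finite_measure_rect_unique d1 d2 (T1 : measurableType d1) (T2 : measurableType d2)
    (m1 m2 : {measure set (T1 * T2) -> \bar R}) :
  (m1 setT < +oo)%E ->
  (forall A B, measurable A -> measurable B -> m1 (A `*` B) = m2 (A `*` B)) ->
  forall C, measurable C -> m1 C = m2 C.
Proof.
move=> fin h C mC.
pose G : set (set (T1 * T2)) := [set C | exists2 A, measurable A & exists2 B, measurable B & A `*` B = C].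
apply: (measure_unique G (fun=> setT)) => //.
- by rewrite measurable_prod_measurableType.
- move=> /= _ _ [X1 mX1 [X2 mX2 <-]] [Y1 mY1 [Y2 mY2 <-]].
  rewrite -setXI; exists (X1 `&` Y1); first exact: measurableI.
  by exists (X2 `&` Y2) => //; exact: measurableI.
- by move=> _; exists setT => //; exists setT => //; rewrite setXTT.
- by rewrite bigcup_const//; exists 0%N.
- by move=> _ [A mA [B mB <-]]; exact: h.
Qed.

(** Both sides are finite measures in [C] which agree on rectangles. *)
Lemma independent_pair_event d1 d2 (T1 : measurableType d1) (T2 : measurableType d2)
    (X : Omega -> T1) (Y : Omega -> T2) (E : set Omega) :
  measurable_fun setT X -> measurable_fun setT Y -> measurable E ->
  (forall A B, measurable A -> measurable B ->
     P ((X @^-1` A `&` Y @^-1` B) `&` E) = (P (X @^-1` A `&` Y @^-1` B) * P E)%E) ->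
  forall C, measurable C ->
    P ((fun w => (X w, Y w)) @^-1` C `&` E) = (P ((fun w => (X w, Y w)) @^-1` C) * P E)%E.
Proof.
move=> mX mY mE h C mC.
have mXY : measurable_fun setT (fun w => (X w, Y w)) by apply/measurable_fun_pairP.
have PE0 : 0 <= fine (P E) by apply: fine_ge0; exact: measure_ge0.
pose m1 := pushm (mrestr P mE) mXY.
pose m2 : {measure set (T1 * T2) -> \bar R} := mscale (NngNum PE0) (pushm P mXY).
have PEE : (fine (P E))%:E = P E by rewrite fineK// fin_num_measure.
have m1E A : m1 A = P ((fun w => (X w, Y w)) @^-1` A `&` E) by [].
have m2E A : m2 A = (P ((fun w => (X w, Y w)) @^-1` A) * P E)%E.
  by rewrite muleC -PEE.
rewrite -m1E -m2E; apply: finite_measure_rect_unique mC.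
  rewrite m1E; apply: le_lt_trans (probability_le1 P _) (ltry _).
  by apply: measurableI => //; rewrite preimage_setT.
by move=> A B mA mB; rewrite m1E m2E; exact: h.
Qed.

Lemma independent_pair_law d1 d2 (T1 : measurableType d1) (T2 : measurableType d2)
    (X : Omega -> T1) (Y : Omega -> T2)
    (mX : measurable_fun setT X) (mY : measurable_fun setT Y) :
  (forall A B, measurable A -> measurable B ->
     P (X @^-1` A `&` Y @^-1` B) = (P (X @^-1` A) * P (Y @^-1` B))%E) ->
  forall C, measurable C ->
    P ((fun w => (X w, Y w)) @^-1` C) =
    (\int[distribution P (mfun_Sub (mem_set mX))]_x P (Y @^-1` xsection C x))%E.
Proof.
move=> h C mC.
have mXY : measurable_fun setT (fun w => (X w, Y w)) by apply/measurable_fun_pairP.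
pose mu1 : probability T1 R := distribution P (mfun_Sub (mem_set mX)).
pose mu2 : probability T2 R := distribution P (mfun_Sub (mem_set mY)).
rewrite -[LHS]/(pushm P mXY C).
by rewrite -(product_measure_unique (m1 := mu1) (m2 := mu2)).
Qed.

End Convolution.

Section PartialSums.
Context {R : realType} d (Omega : measurableType d) (P : probability Omega R).
Context (xi : nat -> Omega -> R * R) (mxi : forall k, measurable_fun setT (xi k))
  (xi_ind : forall (n : nat) (A : nat -> set (R * R)), (forall k, measurable (A k)) ->
     P [set w | forall k, (k < n)%N -> xi k w \in A k]
     = (\prod_(k < n) P (xi k @^-1` A k))%E).
Context (l : nat -> R * R -> R) (ml : forall k, measurable_fun setT (l k)).

Definition psum (k : nat) (w : Omega) : R := \sum_(i < k) l i (xi i w).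

Lemma measurable_psum k : measurable_fun setT (psum k).
Proof.
rewrite /psum; elim: k => [|k IH].
  by under eq_fun do rewrite big_ord0; exact: measurable_cst.
under eq_fun do rewrite big_ord_recr; apply: measurable_funD => //.
exact: measurableT_comp.
Qed.

Definition tail_event (A : nat -> set (R * R)) k n : set Omega :=
  [set w | forall j, (k <= j < n)%N -> A j (xi j w)].

Lemma measurable_tail_event A k n : (forall j, measurable (A j)) ->
  measurable (tail_event A k n).
Proof.
move=> mA; rewrite (_ : tail_event A k n =
    \bigcap_(j in [set j | (k <= j < n)%N]) (xi j @^-1` A j)).
  apply: bigcap_measurableType => j _.
  by rewrite -[X in measurable X]setTI; exact: mxi.
by apply/seteqP; split => w h j /h.
Qed.

(** Induction on [k]: independence is assumed for product events only, so the variables pass one at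
    a time from the tail event into the sum. Carrying the later factors along is what closes the
    induction. *)
Lemma psum_tail_indep k n B A : (k <= n)%N -> measurable B -> (forall j, measurable (A j)) ->
  P (psum k @^-1` B `&` tail_event A k n) =
  (P (psum k @^-1` B) * \prod_(k <= j < n) P (xi j @^-1` A j))%E.
Proof.
elim: k n B A => [|k IH] n B A kn mB mA.
  have E : P (tail_event A 0 n) = (\prod_(0 <= j < n) P (xi j @^-1` A j))%E.
    rewrite big_mkord -xi_ind//; congr (P _); apply/seteqP; split => w h j.
      by move=> jn; rewrite inE; apply: h.
    by rewrite leq0n /= => /h; rewrite inE.
  have s0 w : psum 0 w = 0 by rewrite /psum big_ord0.
  have [B0|B0] := pselect (B 0).
    rewrite (_ : psum 0 @^-1` B = setT) ?setTI ?E ?probability_setT ?mul1e//.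
    by apply/seteqP; split => w //= _; rewrite s0.
  rewrite (_ : psum 0 @^-1` B = set0) ?set0I ?measure0 ?mul0e//.
  by apply/seteqP; split => w //=; rewrite s0.
pose E := tail_event A k.+1 n.
have mE : measurable E by exact: measurable_tail_event.
(* Inserting [D] at position [k] lets the induction hypothesis describe the pair formed by [psum k]
   and [xi k]. *)
pose A' (D : set (R * R)) j := if j == k then D else A j.
have mA' D j : measurable D -> measurable (A' D j) by move=> mD; rewrite /A'; case: ifP.
have tA' D : tail_event (A' D) k n = xi k @^-1` D `&` E.
  apply/seteqP; split => w.
    move=> h; split; first by have := h k; rewrite /A' eqxx; apply; rewrite leqnn.
    move=> j /andP[kj jn]; have := h j; rewrite /A' gtn_eqF//; apply.
    by rewrite jn (ltnW kj).
  move=> [h1 h2] j /andP[kj jn]; rewrite /A'; case: eqVneq => [->//|jk].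
  by apply: h2; rewrite jn andbT ltn_neqAle eq_sym jk.
have pA' D : (\prod_(k <= j < n) P (xi j @^-1` A' D j) =
    P (xi k @^-1` D) * \prod_(k.+1 <= j < n) P (xi j @^-1` A j))%E.
  rewrite big_ltn// /A' eqxx; congr (_ * _)%E.
  rewrite big_nat_cond [RHS]big_nat_cond; apply: eq_bigr => j /andP[/andP[kj _] _].
  by rewrite gtn_eqF.
have tA1 D : tail_event (A' D) k k.+1 = xi k @^-1` D.
  apply/seteqP; split => w.
    by move=> h; have := h k; rewrite /A' eqxx; apply; rewrite leqnn ltnSn.
  by move=> h1 j; rewrite ltnS -eqn_leq => /eqP <-; rewrite /A' eqxx.
have kn' := ltnW kn.
have PE : P E = (\prod_(k.+1 <= j < n) P (xi j @^-1` A j))%E.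
  have := IH n setT (A' setT) kn' measurableT (fun j => mA' _ j measurableT).
  by rewrite tA' pA' !preimage_setT probability_setT !mul1e !setTI.
have P2 B' D : measurable B' -> measurable D ->
    P (psum k @^-1` B' `&` xi k @^-1` D) = (P (psum k @^-1` B') * P (xi k @^-1` D))%E.
  move=> mB' mD; have := IH k.+1 B' (A' D) (leqnSn k) mB' (fun j => mA' _ j mD).
  by rewrite tA1 big_nat1 /A' eqxx.
have h B' D : measurable B' -> measurable D ->
    P ((psum k @^-1` B' `&` xi k @^-1` D) `&` E) =
    (P (psum k @^-1` B' `&` xi k @^-1` D) * P E)%E.
  move=> mB' mD; rewrite -setIA -tA' IH// => [|j]; last exact: mA'.
  by rewrite pA' P2// -PE muleA.
pose C := (fun z : R * (R * R) => z.1 + l k z.2) @^-1` B.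
have mC : measurable C.
  rewrite -[X in measurable X]setTI.
  have mf : measurable_fun setT (fun z : R * (R * R) => z.1 + l k z.2).
    apply: measurable_funD; first exact: measurable_fst.
    by apply: measurableT_comp => //; exact: measurable_snd.
  exact: mf.
have SC : psum k.+1 @^-1` B = (fun w => (psum k w, xi k w)) @^-1` C.
  by apply/seteqP; split => w; rewrite /C /psum /= big_ord_recr.
rewrite -/E SC (independent_pair_event (measurable_psum k) (mxi k) mE h mC).
by rewrite PE.
Qed.

Lemma psum_indep k B D : measurable B -> measurable D ->
  P (xi k @^-1` D `&` psum k @^-1` B) = (P (xi k @^-1` D) * P (psum k @^-1` B))%E.
Proof.
move=> mB mD; rewrite setIC muleC.
have := @psum_tail_indep k k.+1 B (fun=> D) (leqnSn k) mB (fun=> mD).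
rewrite big_nat1 => <-; congr (P (_ `&` _)); apply/seteqP; split => w.
  by move=> h j; rewrite ltnS -eqn_leq => /eqP <-.
by apply; rewrite leqnn ltnSn.
Qed.

Definition law k : probability (R * R)%type R := distribution P (mfun_Sub (mem_set (mxi k))).

Definition conc (s : R) k c : R := fine (P [set w | `|psum k w - c| < s]).

Lemma conc_preimage s k c :
  [set w | `|psum k w - c| < s] = psum k @^-1` [set y | `|y - c| < s].
Proof. by []. Qed.

Lemma measurable_ball_set (c s : R) : measurable [set y : R | `|y - c| < s].
Proof.
rewrite (_ : [set y | _] = `]c - s, c + s[%classic)//.
apply/seteqP; split => y /=; rewrite in_itv/= ltr_norml => /andP[h1 h2];
  apply/andP; split; lra.
Qed.

Lemma measurable_conc_event s k c : measurable [set w | `|psum k w - c| < s].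
Proof.
rewrite conc_preimage -[X in measurable X]setTI.
by apply: measurable_psum => //; exact: measurable_ball_set.
Qed.

Lemma conc_ge0 s k c : 0 <= conc s k c.
Proof. by apply: fine_ge0; apply: measure_ge0; exact: measurable_conc_event. Qed.

(** Conditioning on the last summand shifts the centre of the interval by [l k x]. *)
Lemma conc_section s k c : measurable_fun setT (fun x : R * R => conc s k (c - l k x)) /\
  conc s k.+1 c = \int[law k]_x conc s k (c - l k x).
Proof.
pose C := (fun z : (R * R) * R => `|z.2 + l k z.1 - c|) @^-1` `]-oo, s[%classic.
have mC : measurable C.
  rewrite -[X in measurable X]setTI.
  have mf : measurable_fun setT (fun z : (R * R) * R => `|z.2 + l k z.1 - c|).
    apply: (@measurableT_comp _ _ _ _ _ _ (@Num.norm R R)); first exact: normr_measurable.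
    apply: measurable_funB; last exact: measurable_cst.
    apply: measurable_funD; first exact: measurable_snd.
    by apply: measurableT_comp => //; exact: measurable_fst.
  exact: mf.
pose mu2 : probability R R := distribution P (mfun_Sub (mem_set (measurable_psum k))).
have sE x : conc s k (c - l k x) = fine (mu2 (xsection C x)).
  rewrite /conc -[mu2 _]/(P _); congr (fine (P _)); apply/seteqP; split => w /=.
    by rewrite /xsection /= inE /C /= in_itv/= opprB addrA.
  by rewrite /xsection /= inE /C /= in_itv/= opprB addrA.
have mS : measurable_fun setT (fun x => mu2 (xsection C x)).
  exact: (measurable_fun_xsection mu2 mC).
split.
  under eq_fun do rewrite sE.
  by apply: measurableT_comp mS; exact: fine_measurable.
rewrite {1}/conc.
have -> : [set w | `|psum k.+1 w - c| < s] = (fun w => (xi k w, psum k w)) @^-1` C.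
  by apply/seteqP; split => w; rewrite /C /psum /= in_itv/= big_ord_recr.
rewrite (independent_pair_law (mxi k) (measurable_psum k)) => //; last first.
  by move=> A B mA mB; exact: psum_indep.
rewrite /Rintegral; congr fine; apply: eq_integral => x _.
rewrite sE fineK//; apply: fin_num_measure; exact: measurable_xsection.
Qed.

End PartialSums.

Section TwoSetBound.
Context {R : realType} (m : probability (R * R)%type R).

Lemma Rintegral_prob_cst (c : R) : \int[m]__ c = c.
Proof.
rewrite Rintegral_cst//; transitivity (c * fine (m setT)); first by [].
by rewrite probability_setT mulr1.
Qed.

(** [G] is replaced by its suprema on [B1] and [B2], whose sum is at most [K], and by [c] elsewhere.
    Both suprema are at most [c], so mass of [B1] or [B2] in excess of [rho] only lowers the
    bound. *)
Lemma integral_two_sets (G : R * R -> R) (B1 B2 : set (R * R)) (c K rho : R) :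
  measurable_fun setT G -> (forall x, 0 <= G x <= c) ->
  measurable B1 -> measurable B2 -> B1 `&` B2 = set0 -> 0 < rho ->
  rho <= fine (m B1) -> rho <= fine (m B2) ->
  (forall x y, B1 x -> B2 y -> G x + G y <= K) ->
  \int[m]_x G x <= (1 - 2 * rho) * c + rho * K.
Proof.
move=> mG Gc mB1 mB2 B12 rho0 r1 r2 GK.
have mT : m setT = 1%:E by rewrite probability_setT.
have ne B : rho <= fine (m B) -> exists x, B x.
  move=> h; case: (pselect (exists x, B x)) => // nB; exfalso.
  move: h; rewrite (_ : B = set0) ?measure0 /= ?leNgt ?rho0//.
  by apply/seteqP; split => // x Bx; apply: nB; exists x.
have [x1 hx1] := ne _ r1; have [x2 hx2] := ne _ r2.
pose s1 := sup (G @` B1); pose s2 := sup (G @` B2).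
have ub B : has_ubound (G @` B) by exists c => _ [x _ <-]; have /andP[] := Gc x.
have s1c : s1 <= c.
  by apply: ge_sup; [exists (G x1), x1|move=> _ [x _ <-]; have /andP[] := Gc x].
have s2c : s2 <= c.
  by apply: ge_sup; [exists (G x2), x2|move=> _ [x _ <-]; have /andP[] := Gc x].
have le1 x : B1 x -> G x <= s1 by move=> h; apply: ub_le_sup => //; exists x.
have le2 x : B2 x -> G x <= s2 by move=> h; apply: ub_le_sup => //; exists x.
have s12 : s1 + s2 <= K.
  rewrite -lerBrDr; apply: ge_sup; first by exists (G x1), x1.
  move=> _ [x Bx <-]; rewrite lerBrDr -lerBrDl; apply: ge_sup; first by exists (G x2), x2.
  by move=> _ [y By <-]; rewrite lerBrDl; apply: GK.
have bG : bdm G.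
  by split => //; exists c => x; have /andP[h1 h2] := Gc x; rewrite ger0_norm.
have bi (B : set (R * R)) k : measurable B -> bdm (fun x => k * \1_B x).
  move=> mB; apply: bdmZ; split; first exact: measurable_indic.
  by exists 1 => z; rewrite indicE; case: (_ \in _); rewrite ?normr1// normr0.
have Ri (B : set (R * R)) k : measurable B -> \int[m]_x (k * \1_B x) = k * fine (m B).
  move=> mB; rewrite RintegralZl//; last first.
    by have := bdm_integrable mT (bi B 1 mB); under eq_fun do rewrite mul1r.
  by rewrite /Rintegral integral_indic// setIT.
apply: le_trans (_ : \int[m]_x (c + ((s1 - c) * \1_B1 x + (s2 - c) * \1_B2 x)) <= _).
  apply: (le_Rint mT) => // [|x].
    by apply: bdmD; [exact: bdm_cst|apply: bdmD; exact: bi].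
  rewrite !indicE; case: (boolP (x \in B1)); rewrite ?inE => h1.
    rewrite (_ : x \in B2 = false) /= ?mulr1 ?mulr0 ?addr0; last first.
      apply/negP; rewrite inE => h2; have : (B1 `&` B2) x by []; by rewrite B12.
    by rewrite addrC subrK; exact: le1.
  rewrite mulr0 add0r; case: (boolP (x \in B2)); rewrite ?inE => h2.
    by rewrite mulr1 addrC subrK; exact: le2.
  by rewrite mulr0 addr0; have /andP[] := Gc x.
rewrite RintegralD//; [|exact: (bdm_integrable mT (bdm_cst c))|]; last first.
  by apply: (bdm_integrable mT); apply: bdmD; exact: bi.
rewrite RintegralD//; [|exact: (bdm_integrable mT (bi _ _ mB1))|exact: (bdm_integrable mT (bi _ _ mB2))].
rewrite !Ri// Rintegral_prob_cst.
have h1 : (s1 - c) * fine (m B1) <= (s1 - c) * rho by rewrite ler_wnM2l// subr_le0.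
have h2 : (s2 - c) * fine (m B2) <= (s2 - c) * rho by rewrite ler_wnM2l// subr_le0.
have h3 : rho * (s1 + s2) <= rho * K by rewrite ler_pM2l.
move: h1 h2 h3; lra.
Qed.

End TwoSetBound.

Section Anticoncentration.
Context {R : realType} d (Omega : measurableType d) (P : probability Omega R).
Context (xi : nat -> Omega -> R * R) (mxi : forall k, measurable_fun setT (xi k))
  (xi_ind : forall (n : nat) (A : nat -> set (R * R)), (forall k, measurable (A k)) ->
     P [set w | forall k, (k < n)%N -> xi k w \in A k]
     = (\prod_(k < n) P (xi k @^-1` A k))%E).
Context (l : nat -> R * R -> R) (ml : forall k, measurable_fun setT (l k)).
Context (s rho : R) (s_gt0 : 0 < s) (rho_gt0 : 0 < rho)
  (B1 B2 : set (R * R)) (mB1 : measurable B1) (mB2 : measurable B2)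
  (B12 : B1 `&` B2 = set0)
  (rho1 : forall k, rho <= fine (P (xi k @^-1` B1)))
  (rho2 : forall k, rho <= fine (P (xi k @^-1` B2))).
Context (good : pred nat) (good_sep : forall k, good k ->
  (forall x y, B1 x -> B2 y -> 2 * s <= l k y - l k x) \/
  (forall x y, B1 x -> B2 y -> 2 * s <= l k x - l k y)).

Local Notation q := (conc P xi l s).
Local Notation sep := (pairwise (fun a b : R => a + 2 * s <= b)).

Definition good_count k : nat := \sum_(i < k) good i.

Lemma sep_shift (v : R) cs : sep cs -> sep [seq c - v | c <- cs].
Proof.
rewrite pairwise_map; apply: sub_pairwise => a b /=; lra.
Qed.

(* The chance that the sum falls into a union of separated intervals obeys the
   recursion of the lazy walk, the state being the number of intervals. *)
Lemma anticoncentration_sep k cs : sep cs ->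
  \sum_(c <- cs) q k c <= survival rho (good_count k) (size cs).
Proof.
elim: k cs => [|k IH] cs scs.
  rewrite /good_count big_ord0.
  have q0 (c : R) : q 0%N c = (`|c| < s)%R%:R.
    rewrite /conc /psum; under eq_fun do rewrite big_ord0 sub0r normrN.
    case: (ltP `|c| s) => h /=.
      by rewrite (_ : [set _ | _] = setT) ?probability_setT//; apply/seteqP; split.
    by rewrite (_ : [set _ | _] = set0) ?measure0//; apply/seteqP; split.
  (* The empty sum is 0, which lies in at most one of the separated intervals. *)
  have far : forall (c0 : R) ds, `|c0| < s -> all (fun b => c0 + 2 * s <= b) ds ->
      \sum_(c <- ds) q 0%N c = 0.
    move=> c0 ds hc; elim: ds => [|b ds IHd] /=; first by rewrite big_nil.
    move=> /andP[hb hds]; rewrite big_cons IHd// addr0 q0.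
    by move: hc; case: (ltP `|b| s) => //; rewrite !ltr_norml => /andP[h3 h4] /andP[h1 h2]; lra.
  elim: cs scs => [|c0 ds IHd] /=; first by rewrite big_nil.
  move=> /andP[h1 h2]; rewrite big_cons q0; case: (ltP `|c0| s) => hc /=.
    by rewrite (far c0)// addr0.
  rewrite add0r; apply: le_trans (IHd h2) _.
  by case: (size ds).
have [->|cs0] := eqVneq cs [::]; first by rewrite big_nil survival0.
have mT : law P mxi k setT = 1%:E by rewrite probability_setT.
pose G ds x := \sum_(c <- ds) q k (c - l k x).
have bq c : bdm (fun x => q k (c - l k x)).
  have [mc _] := conc_section mxi xi_ind ml s k c; split => //; exists 1 => x.
  rewrite ger0_norm ?conc_ge0//.
  by rewrite -lee_fin /conc fineK ?fin_num_measure ?probability_le1//; exact: measurable_conc_event.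
have -> : \sum_(c <- cs) q k.+1 c = \int[law P mxi k]_x G cs x.
  rewrite (Rintegral_sum mT)//; apply: eq_bigr => c _.
  by have [_ ->] := conc_section mxi xi_ind ml s k c.
have GE ds x : G ds x = \sum_(c <- [seq c - l k x | c <- ds]) q k c by rewrite big_map.
have G0 x : 0 <= G cs x <= survival rho (good_count k) (size cs).
  apply/andP; split; first by apply: sumr_ge0 => c _; exact: conc_ge0.
  rewrite GE; have := IH [seq c - l k x | c <- cs]; rewrite size_map; apply.
  exact: sep_shift.
have gS : good_count k.+1 = (good_count k + good k)%N by rewrite /good_count big_ord_recr.
have mG : measurable_fun setT (G cs) by have [] : bdm (G cs) by apply: bdm_sum.
case: (boolP (good k)) => gk; last first.
  rewrite gS (negbTE gk) addn0.
  apply: le_trans (_ : \int[law P mxi k]_x (survival rho (good_count k) (size cs)) <= _).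
    apply: (le_Rint mT); [exact: bdm_sum|exact: bdm_cst|].
    by move=> x; have /andP[] := G0 x.
  by rewrite Rintegral_prob_cst.
rewrite gS gk addn1.
case: cs scs cs0 G0 mG => // c0 ds scs _ G0 mG.
rewrite -[survival _ _ _]/((1 - 2 * rho) * survival rho (good_count k) (size (c0 :: ds)) +
  rho * (survival rho (good_count k) (size ds).+2 + survival rho (good_count k) (size ds))).
(* The families [cs - l k x] and [cs - l k y] have [size cs] centres each; moving
   the leftmost centre of the second one to the first keeps both separated. *)
have pair x y : 2 * s <= l k y - l k x -> G (c0 :: ds) x + G (c0 :: ds) y <=
    survival rho (good_count k) (size ds).+2 + survival rho (good_count k) (size ds).
  move=> hxy.
  have -> : G (c0 :: ds) x + G (c0 :: ds) y =
      (\sum_(c <- (c0 - l k y) :: [seq c - l k x | c <- c0 :: ds]) q k c) + G ds y.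
    by rewrite big_cons -GE /G !big_cons; ring.
  apply: lerD.
    have := IH ((c0 - l k y) :: [seq c - l k x | c <- c0 :: ds]).
    rewrite /= size_map; apply.
    have := sep_shift (l k x) scs; rewrite /= => /andP[h1 h2].
    rewrite h1 h2 !andbT; apply/andP; split; first lra.
    by apply: sub_all h1 => b /=; move: s_gt0 hxy; lra.
  rewrite GE; have := IH [seq c - l k y | c <- ds]; rewrite size_map; apply.
  by apply: sep_shift; move: scs => /= /andP[].
apply: integral_two_sets mB1 mB2 B12 rho_gt0 _ _ _ => //.
- exact: rho1.
- exact: rho2.
move=> x y Bx By; have [h|h] := good_sep gk; first exact: pair (h _ _ Bx By).
by rewrite addrC; exact: pair (h _ _ Bx By).
Qed.

Lemma anticoncentration k : q k 0 <= survival rho (good_count k) 1.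
Proof. by have := @anticoncentration_sep k [:: 0] isT; rewrite big_seq1. Qed.

End Anticoncentration.

(** * Two separated sets of positive probability *)

Section TwoSets.
Context {R : realType} d (T : measurableType d) (m : probability T R).

Lemma null_bigcup (F : nat -> set T) : (forall n, measurable (F n)) ->
  (forall n, m (F n) = 0%E) -> m (\bigcup_n F n) = 0%E.
Proof.
move=> mF F0; apply/negligibleP; first exact: bigcup_measurable.
apply: negligible_bigcup => n; exists (F n); split; [exact: mF|exact: F0|exact: subset_refl].
Qed.

Lemma exists_pos_bigcup (A : set T) (F : nat -> set T) : (forall n, measurable (F n)) ->
  A `<=` \bigcup_n F n -> measurable A -> m A <> 0%E ->
  exists n, m (A `&` F n) <> 0%E.
Proof.
move=> mF AF mA A0; case: (pselect (exists n, m (A `&` F n) <> 0%E)) => // h.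
exfalso; apply: A0; rewrite (_ : A = \bigcup_n (A `&` F n)).
  apply: null_bigcup => n; first exact: measurableI.
  by apply: contrapT => h'; apply: h; exists n.
rewrite -setI_bigcupr; apply/seteqP; split => x //; last by case.
by move=> Ax; split => //; exact: AF.
Qed.

(** The distribution function jumps from 0 to 1 at the supremum of the [t] with [Y < t] null; the
    event that [Y] differs from it is a countable union of null events. *)
Lemma degenerate_of_cdf (Y : T -> R) : measurable_fun setT Y ->
  (forall t, m [set w | Y w < t] = 0%E \/ m [set w | t <= Y w] = 0%E) ->
  exists c, m [set w | Y w <> c] = 0%E.
Proof.
move=> mY h.
have mlt t : measurable [set w | Y w < t].
  rewrite (_ : [set w | _] = Y @^-1` `]-oo, t[%classic).
    by rewrite -[X in measurable X]setTI; exact: mY.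
  by apply/seteqP; split => w /=; rewrite in_itv.
have mge t : measurable [set w | t <= Y w].
  rewrite (_ : [set w | _] = Y @^-1` `[t, +oo[%classic).
    by rewrite -[X in measurable X]setTI; exact: mY.
  by apply/seteqP; split => w /=; rewrite in_itv/= andbT.
pose A := [set t | m [set w | Y w < t] = 0%E].
have mT : m setT <> 0%E by rewrite probability_setT; apply/eqP; rewrite onee_neq0.
have A0 : A !=set0.
  apply: contrapT => nA; apply: mT.
  rewrite (_ : setT = \bigcup_n [set w | - n%:R <= Y w]).
    apply: null_bigcup => // n; have [h1|//] := h (- n%:R).
    by exfalso; apply: nA; exists (- n%:R).
  apply/seteqP; split => // w _; exists (Num.truncn (- Y w)).+1 => //=.
  by rewrite lerNl ltW// truncnS_gt.
have null_le s t : s <= t -> A t -> A s.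
  move=> st At; apply/eqP; rewrite eq_le measure_ge0// andbT -[leRHS]At.
  by apply: le_measure; rewrite ?inE// => w /= /lt_le_trans; apply.
have ubA : has_ubound A.
  apply: contrapT => nub; apply: mT.
  rewrite (_ : setT = \bigcup_n [set w | Y w < n%:R]).
    apply: null_bigcup => // n; apply: contrapT => nn; apply: nub.
    exists n%:R => t At; rewrite leNgt; apply/negP => nt; apply: nn.
    by apply: null_le At; exact: ltW.
  by apply/seteqP; split => // w _; exists (Num.truncn (Y w)).+1 => //=; exact: truncnS_gt.
exists (sup A).
rewrite (_ : [set w | Y w <> sup A] =
  (\bigcup_n [set w | Y w < sup A - n.+1%:R^-1]) `|` (\bigcup_n [set w | sup A + n.+1%:R^-1 <= Y w])).
  apply/eqP; rewrite eq_le measure_ge0 andbT.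
  apply: le_trans (measureU2 _ _ _) _; try by apply: bigcup_measurable.
  rewrite -[leRHS]adde0; apply: leeD; rewrite le_eqVlt; apply/orP; left; apply/eqP;
    apply: null_bigcup => // n.
    have i0 : 0 < n.+1%:R^-1 :> R by rewrite invr_gt0.
    have [t At ht] := sup_adherent i0 (conj A0 ubA).
    by apply: null_le At; exact: ltW.
  have [|//] := h (sup A + n.+1%:R^-1) => h1.
  have : sup A + n.+1%:R^-1 <= sup A by apply: ub_le_sup.
  by rewrite gerDl leNgt invr_gt0 ltr0n.
have arch (x : R) : 0 < x -> exists n : nat, n.+1%:R^-1 < x.
  move=> x0; exists (Num.truncn x^-1).
  by rewrite -[ltRHS]invrK ltf_pV2 ?posrE ?invr_gt0// truncnS_gt.
apply/seteqP; split => w /=.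
  move=> /eqP; rewrite neq_lt => /orP[lt|lt].
    left; have [|n hn] := arch (sup A - Y w); first by rewrite subr_gt0.
    by exists n => //; rewrite /mkset; move: (n.+1%:R^-1) hn => v hn; lra.
  right; have [|n hn] := arch (Y w - sup A); first by rewrite subr_gt0.
  by exists n => //; rewrite /mkset; move: (n.+1%:R^-1) hn => v hn; lra.
have pn n : 0 < n.+1%:R^-1 :> R by rewrite invr_gt0.
move=> [[n _]|[n _]]; rewrite /mkset => + h2; rewrite h2.
  by rewrite ltrBrDr gtrDl ltNge (ltW (pn n)).
by rewrite gerDl leNgt pn.
Qed.

End TwoSets.

Section SeparatedSets.
Context {R : realType} (m : probability (R * R)%type R).

Lemma measurable_fst_lt t : measurable [set x : R * R | x.1 < t].
Proof.
rewrite (_ : [set x | _] = fst @^-1` `]-oo, t[%classic).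
  by rewrite -[X in measurable X]setTI; exact: measurable_fst.
by apply/seteqP; split => w /=; rewrite in_itv.
Qed.

Lemma measurable_snd_lt t : measurable [set x : R * R | x.2 < t].
Proof.
rewrite (_ : [set x | _] = snd @^-1` `]-oo, t[%classic).
  by rewrite -[X in measurable X]setTI; exact: measurable_snd.
by apply/seteqP; split => w /=; rewrite in_itv.
Qed.

Definition square (k : R) (q : int * int) : set (R * R) :=
  [set x | q.1%:~R * k <= x.1 < (q.1 + 1)%:~R * k /\ q.2%:~R * k <= x.2 < (q.2 + 1)%:~R * k].

Lemma measurable_square k q : measurable (square k q).
Proof.
rewrite (_ : square k q = (([set x | x.1 < (q.1 + 1)%:~R * k] `\` [set x | x.1 < q.1%:~R * k])
   `&` ([set x | x.2 < (q.2 + 1)%:~R * k] `\` [set x | x.2 < q.2%:~R * k]))).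
  by apply: measurableI; apply: measurableD;
    solve [exact: measurable_fst_lt|exact: measurable_snd_lt].
apply/seteqP; split => x; rewrite /square /=.
  by move=> [/andP[h1 h2] /andP[h3 h4]]; do ! split => //; apply/negP; rewrite -leNgt.
by move=> [[h1 /negP h2] [h3 /negP h4]]; split; apply/andP; split=> //; rewrite leNgt.
Qed.

Lemma exists_square (A : set (R * R)) k : 0 < k -> measurable A -> m A <> 0%E ->
  exists q, m (A `&` square k q) <> 0%E.
Proof.
move=> k0 mA A0.
pose F n := if (unpickle n : option (int * int)) is Some q then square k q else set0.
have [||n hn] := @exists_pos_bigcup _ _ _ m A F _ _ mA A0.
- by move=> n; rewrite /F; case: unpickle => // q; exact: measurable_square.
- move=> x _; pose q : int * int := (Num.floor (x.1 / k), Num.floor (x.2 / k)).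
  have fl (y : R) : (Num.floor (y / k))%:~R * k <= y < (Num.floor (y / k) + 1)%:~R * k.
    by rewrite -ler_pdivlMr// -ltr_pdivrMr// floor_itv.
  exists (pickle q) => //; rewrite /F pickleK /square /=.
  by split; exact: fl.
move: hn; rewrite /F; case: unpickle => [q hq|]; first by exists q.
by rewrite setI0 measure0.
Qed.

Lemma square_close k q x y : square k q x -> square k q y ->
  cabs (toC x - toC y) <= 2 * k.
Proof.
move=> [/andP[h1 h2] /andP[h3 h4]] [/andP[h5 h6] /andP[h7 h8]].
apply: le_trans (cabs_le_ReIm _) _.
rewrite /toC /=; move: h1 h2 h3 h4 h5 h6 h7 h8.
rewrite !intrD !mulrDl !mul1r; move: (q.1%:~R * k) (q.2%:~R * k) => u v *.
apply: lerD; rewrite ler_norml; apply/andP; split; lra.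
Qed.

(** Some coordinate of a nondegenerate variable charges both sides of a threshold [t], and still
    does after a gap [eta] is opened. Countably many small squares cover the plane, so one on each
    side has positive mass. *)
Lemma separated_sets : ~ (exists c, m [set c] = 1%E) ->
  exists (D : R[i]) (B1 B2 : set (R * R)) (rho : R),
    [/\ D != 0, measurable B1, measurable B2, B1 `&` B2 = set0 &
     [/\ 0 < rho <= 2^-1, rho <= fine (m B1), rho <= fine (m B2) &
      forall x y, B1 x -> B2 y -> cabs ((toC y - toC x) - D) <= cabs D / 4]].
Proof.
move=> nd.
pose pr (b : bool) (x : R * R) := if b then x.1 else x.2.
have mpr b : measurable_fun setT (pr b).
  by case: b; [exact: measurable_fst|exact: measurable_snd].
have mlt b t : measurable [set x | pr b x < t].
  by case: b; [exact: measurable_fst_lt|exact: measurable_snd_lt].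
have mge b t : measurable [set x | t <= pr b x].
  rewrite (_ : [set x | _] = ~` [set x | pr b x < t]); first exact: measurableC.
  by apply/seteqP; split => x /=; rewrite leNgt => /negP.
have [b [t [h1 h2]]] : exists b t, m [set x | pr b x < t] <> 0%E /\ m [set x | t <= pr b x] <> 0%E.
  apply: contrapT => no; apply: nd.
  have dg b : exists c, m [set x | pr b x <> c] = 0%E.
    apply: degenerate_of_cdf => // t.
    case: (eqVneq (m [set x | pr b x < t]) 0%E) => [|/eqP h1]; first by left.
    case: (eqVneq (m [set x | t <= pr b x]) 0%E) => [|/eqP h2]; first by right.
    by exfalso; apply: no; exists b, t.
  have [c1 hc1] := dg true; have [c2 hc2] := dg false.
  have mne b c : measurable [set x | pr b x <> c].
    rewrite (_ : [set x | _] = ~` (pr b @^-1` [set c])).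
      by apply: measurableC; rewrite -[X in measurable X]setTI; exact: mpr.
    by apply/seteqP; split.
  have ms : measurable (~` [set (c1, c2)] : set (R * R)).
    rewrite (_ : ~` _ = [set x | pr true x <> c1] `|` [set x | pr false x <> c2]).
      exact: measurableU.
    apply/seteqP; split => -[x1 x2] /=.
      by move=> h; case: (eqVneq x1 c1) => [e1|/eqP]; [right=> e2; apply: h; rewrite e1 e2|left].
    by move=> [h [e1 e2]|h [e1 e2]]; apply: h.
  exists (c1, c2).
  have z : m (~` [set (c1, c2)]) = 0%E.
    apply/eqP; rewrite eq_le measure_ge0 andbT.
    apply: (@le_trans _ _ (m ([set x | pr true x <> c1] `|` [set x | pr false x <> c2]))).
      apply: le_measure; rewrite ?inE//; first exact: measurableU.
      move=> [x1 x2] /= h.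
      by case: (eqVneq x1 c1) => [e1|/eqP]; [right=> e2; apply: h; rewrite e1 e2|left].
    apply: le_trans (measureU2 _ _ _) _ => //.
    rewrite -[leRHS]adde0; apply: leeD; rewrite le_eqVlt; apply/orP; left; apply/eqP;
      [exact: hc1|exact: hc2].
  have := probability_setC m ms; rewrite setCK => ->.
  by rewrite z sube0.
have [eta eta0 h3] : exists2 eta, 0 < eta & m [set x | pr b x < t - eta] <> 0%E.
  have [||n hn] := @exists_pos_bigcup _ _ _ m [set x | pr b x < t]
      (fun n => [set x | pr b x < t - n.+1%:R^-1]) _ _ (mlt b t) h1.
  - by [].
  - move=> x /= xt; exists (Num.truncn (t - pr b x)^-1) => //; rewrite /mkset.
    have tx : 0 < t - pr b x by rewrite subr_gt0.
    suff : (Num.truncn (t - pr b x)^-1).+1%:R^-1 < t - pr b x by rewrite !ltrBrDr addrC.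
    by rewrite -[ltRHS]invrK ltf_pV2 ?posrE ?invr_gt0// truncnS_gt.
  exists n.+1%:R^-1; first by rewrite invr_gt0.
  move: hn; rewrite (_ : _ `&` _ = [set x | pr b x < t - n.+1%:R^-1])//.
  apply/seteqP; split => x /=; first by case.
  by move=> hx; split => //; apply: lt_trans hx _; rewrite ltrBlDr ltrDl invr_gt0.
(* Two points of one square are within [2 * k], so differences deviate from [D] by at most
   [4 * k = eta / 4], while [eta <= cabs D]. *)
pose k := eta / 16; have k0 : 0 < k by rewrite divr_gt0.
have [q1 hq1] := exists_square k0 (mlt b _) h3.
have [q2 hq2] := exists_square k0 (mge b t) h2.
set B1 := _ `&` _ in hq1; set B2 := _ `&` _ in hq2.
have mB1 : measurable B1 by apply: measurableI => //; exact: measurable_square.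
have mB2 : measurable B2 by apply: measurableI => //; exact: measurable_square.
have ne (B : set (R * R)) : m B <> 0%E -> exists x, B x.
  move=> h; apply: contrapT => nB; apply: h.
  rewrite (_ : B = set0) ?measure0//.
  by apply/seteqP; split => // x Bx; apply: nB; exists x.
have [x1 Bx1] := ne _ hq1; have [x2 Bx2] := ne _ hq2.
pose D := toC x2 - toC x1.
have De : eta <= cabs D.
  have [/= p1 _] := Bx1; have [/= p2 _] := Bx2.
  have h : eta <= `|pr b x2 - pr b x1|.
    by apply: le_trans (ler_norm _); lra.
  apply: le_trans h _; rewrite /D; case: (b); rewrite /pr.
    by apply: le_trans (Re_le_cabs _); rewrite /toC.
  by apply: le_trans (Im_le_cabs _); rewrite /toC.
have pos (B : set (R * R)) : measurable B -> m B <> 0%E -> 0 < fine (m B).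
  move=> mB /eqP h; apply: fine_gt0; rewrite lt_neqAle eq_sym h measure_ge0/=.
  by rewrite (le_lt_trans (probability_le1 m mB))// ltry.
(* The cap [2^-1] keeps the holding probability [1 - 2 * rho] of the lazy walk nonnegative. *)
pose rho := Num.min 2^-1 (Num.min (fine (m B1)) (fine (m B2))).
exists D, B1, B2, rho; split => //.
- by rewrite -cabs_gt0 (lt_le_trans eta0).
- apply/seteqP; split => // x [[/= p1 _] [/= p2 _]].
  by move: eta0; lra.
split.
- apply/andP; split; last by rewrite /rho ge_min lexx.
  by rewrite /rho !lt_min invr_gt0 ltr0n (pos _ mB1 hq1) (pos _ mB2 hq2).
- by rewrite /rho !ge_min lexx orbT.
- by rewrite /rho !ge_min lexx !orbT.
move=> x y [_ sx] [_ sy].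
have -> : toC y - toC x - D = (toC y - toC x2) - (toC x - toC x1) by rewrite /D; ring.
apply: le_trans (cabsD _ _) _; rewrite cabsN.
have h4 := square_close sy Bx2.2; have h5 := square_close sx Bx1.2.
by move: h4 h5 De; rewrite /k; lra.
Qed.

End SeparatedSets.

(** * Small ball probabilities of complex sums *)

Section SmallBall.
Context {R : realType} d (Omega : measurableType d) (P : probability Omega R).
Context (xi : nat -> Omega -> R * R) (mxi : forall k, measurable_fun setT (xi k)).

Definition rsum (a : nat -> R[i]) (n : nat) (w : Omega) : R[i] :=
  \sum_(k < n) toC (xi k w) * a k.

Definition part (b : bool) (z : R[i]) : R := if b then complex.Re z else complex.Im z.

Lemma partD b z w : part b (z + w) = part b z + part b w.
Proof. by case: b; case: z; case: w. Qed.

Lemma partN b z : part b (- z) = - part b z.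
Proof. by case: b; case: z. Qed.

Lemma part_sum b (I : Type) (s : seq I) (F : I -> R[i]) :
  part b (\sum_(i <- s) F i) = \sum_(i <- s) part b (F i).
Proof. by apply: (big_morph (part b)); [exact: partD|case: b]. Qed.

Lemma part_le b z : `|part b z| <= cabs z.
Proof. by case: b; [exact: Re_le_cabs|exact: Im_le_cabs]. Qed.

Lemma measurable_part_mul b (a : R[i]) : measurable_fun setT (fun x : R * R => part b (toC x * a)).
Proof.
case: a => u v; case: b; rewrite /part /toC /=.
  by apply: measurable_funB; apply: measurable_funM => //;
    solve [exact: measurable_fst|exact: measurable_snd|exact: measurable_cst].
by apply: measurable_funD; apply: measurable_funM => //;
    solve [exact: measurable_fst|exact: measurable_snd|exact: measurable_cst].
Qed.

Lemma measurable_cabs_parts (f : Omega -> R[i]) :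
  (forall b, measurable_fun setT (fun w => part b (f w))) ->
  measurable_fun setT (fun w => cabs (f w)).
Proof.
move=> h; rewrite (_ : (fun w => _) = (@cmod R) \o (fun w => (part true (f w), part false (f w)))).
  apply: measurableT_comp; first exact: measurable_cmod.
  by apply/measurable_fun_pairP; split; [exact: (h true)|exact: (h false)].
by apply/funext => w /=; case: (f w).
Qed.

Lemma measurable_rsum a n : measurable_fun setT (fun w => cabs (rsum a n w)).
Proof.
apply: measurable_cabs_parts => b.
rewrite (_ : (fun w => _) = fun w => psum xi (fun k x => part b (toC x * a k)) n w).
  by apply: measurable_psum => // k; exact: measurable_part_mul.
by apply/funext => w; rewrite /rsum part_sum.
Qed.

Lemma measurable_rsum_lt a n s : measurable [set w | cabs (rsum a n w) < s].
Proof.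
rewrite (_ : [set w | _] = (fun w => cabs (rsum a n w)) @^-1` `]-oo, s[%classic).
  by rewrite -[X in measurable X]setTI; apply: measurable_rsum.
by apply/seteqP; split => w /=; rewrite in_itv.
Qed.

Lemma window_count k0 m n (f g : pred nat) : (k0 + m <= n)%N ->
  (forall i, (k0 <= i < k0 + m)%N -> f i || g i) ->
  (m <= \sum_(i < n) f i + \sum_(i < n) g i)%N.
Proof.
move=> kn h; rewrite -big_split /=.
rewrite -(big_mkord xpredT (fun i => (f i + g i)%N)).
rewrite (big_cat_nat (n := k0 + m)) ?leq0n// (big_cat_nat (n := k0) (p := k0 + m)) ?leq0n ?leq_addr//=.
rewrite addnAC; apply: leq_trans (leq_addl _ _).
apply: (@leq_trans (\sum_(k0 <= i < k0 + m) 1)%N).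
  by rewrite sum_nat_const_nat muln1 addKn.
rewrite big_nat_cond [leqRHS]big_nat_cond; apply: leq_sum => i /andP[hi _].
by have := h i hi; case: (f i); case: (g i).
Qed.

Context (xi_ind : forall (n : nat) (A : nat -> set (R * R)), (forall k, measurable (A k)) ->
     P [set w | forall k, (k < n)%N -> xi k w \in A k]
     = (\prod_(k < n) P (xi k @^-1` A k))%E)
  (xi_id : forall k (A : set (R * R)), measurable A ->
     P (xi k @^-1` A) = P (xi 0%N @^-1` A))
  (xi_nd : ~ (exists c : R * R, P (xi 0%N @^-1` [set c]) = 1%E)).

(** The real or the imaginary part of [D * a k] carries at least half its modulus. In a window of
    [2 * M0] large coefficients one of the two does so [M0] times, and that projection of the sum is
    treated as a real walk. *)
Lemma small_ball (eps : R) : 0 < eps -> exists (m : nat) (delta : R), 0 < delta /\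
  forall n (a : nat -> R[i]) (A : R) k0, 0 < A -> (k0 + m <= n)%N ->
  (forall k, (k0 <= k < k0 + m)%N -> A <= cabs (a k)) ->
  (P [set w | (cabs (rsum a n w) < delta * A)%R] <= eps%:E)%E.
Proof.
move=> eps0.
have [D [B1 [B2 [rho [D0 mB1 mB2 B12 [/andP[rho0 rho2] r1 r2 cl]]]]]] :=
  @separated_sets R (law P mxi 0) xi_nd.
have := survival_cvg0 rho0 rho2 => /cvgrPdist_le /(_ _ eps0) [M0 _ hM].
have surv k : (M0 <= k)%N -> survival rho k 1 <= eps.
  move=> Mk; have := hM k Mk; rewrite sub0r normrN ger0_norm//.
  exact: survival_ge0.
have cD0 : 0 < cabs D by rewrite cabs_gt0.
(* The projected step is at least [1/2 - 1/4] of [cabs D * cabs (a k)], and it has to reach [2 * s];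
   hence the factor [1 / 8]. *)
exists (M0 + M0)%N, (cabs D / 8); split; first by rewrite divr_gt0.
move=> n a A k0 A0 kn hA.
pose s := cabs D / 8 * A; have s0 : 0 < s by rewrite mulr_gt0// divr_gt0.
pose l b k (x : R * R) := part b (toC x * a k).
have ml b k : measurable_fun setT (l b k) by exact: measurable_part_mul.
pose good b k := ((k0 <= k < k0 + (M0 + M0))%N) && (cabs (D * a k) <= 2 * `|part b (D * a k)|).
have gsep b k : good b k ->
  (forall x y, B1 x -> B2 y -> 2 * s <= l b k y - l b k x) \/
  (forall x y, B1 x -> B2 y -> 2 * s <= l b k x - l b k y).
  move=> /andP[/hA hak hD].
  have est x y : B1 x -> B2 y ->
      `|l b k y - l b k x - part b (D * a k)| <= cabs D * cabs (a k) / 4.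
    move=> Bx By; have -> : l b k y - l b k x - part b (D * a k) =
        part b ((toC y - toC x - D) * a k).
      by rewrite /l !mulrBl !partD !partN.
    apply: le_trans (part_le _ _) _; rewrite cabsM mulrAC ler_wpM2r ?cabs_ge0//.
    exact: cl.
  have h2s : 2 * s <= cabs D * cabs (a k) / 4.
    rewrite /s; have : cabs D * A <= cabs D * cabs (a k) by rewrite ler_pM2l.
    rewrite (_ : 2 * (cabs D / 8 * A) = cabs D * A / 4); last by field.
    by move: (cabs D * A) (cabs D * cabs (a k)) => u v; lra.
  rewrite cabsM in hD.
  have [p0|p0] := leP 0 (part b (D * a k)); [left|right] => x y Bx By;
    have := est x y Bx By; rewrite ler_norml => /andP[e1 e2]; move: hD h2s.
    by rewrite ger0_norm//; lra.
  by rewrite ltr0_norm//; lra.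
have rr b : (P [set w | (cabs (rsum a n w) < s)%R] <= (conc P xi (l b) s n 0)%:E)%E.
  rewrite /conc fineK ?fin_num_measure//; last exact: measurable_conc_event.
  apply: le_measure; rewrite ?inE; [exact: measurable_rsum_lt|exact: measurable_conc_event|].
  move=> w /=; apply: le_lt_trans; rewrite subr0.
  apply: le_trans (part_le b _); rewrite /rsum part_sum.
  by [].
have rk (B : set (R * R)) : measurable B -> rho <= fine (law P mxi 0 B) ->
    forall k, rho <= fine (P (xi k @^-1` B)).
  by move=> mB h k; rewrite xi_id.
have ac b := anticoncentration mxi xi_ind (ml b) s0 rho0 mB1 mB2 B12
  (rk _ mB1 r1) (rk _ mB2 r2) (good := good b) (gsep b) n.
suff [b hb] : exists b, (M0 <= good_count (good b) n)%N.
  apply: le_trans (rr b) _; rewrite lee_fin; apply: le_trans (ac b) _.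
  exact: surv.
have win i : (k0 <= i < k0 + (M0 + M0))%N -> good true i || good false i.
  move=> hi; rewrite /good hi /=; have := cabs_le_ReIm (D * a i).
  rewrite /part; case: (leP (cabs (D * a i)) (2 * `|complex.Re (D * a i)|)) => //= h1 h2.
  by move: h1 h2; lra.
have := window_count kn win.
rewrite -/(good_count (good true) n) -/(good_count (good false) n) => h.
have [h1|h1] := leqP M0 (good_count (good true) n); first by exists true.
by exists false; lia.
Qed.

End SmallBall.

(** * Growth of the random polynomials *)

Section IntegrableTail.
Context {R : realType} d (Omega : measurableType d) (P : probability Omega R).

(** Markov's inequality applied to [f] restricted to [n0 < f], whose integral is small by dominated
    convergence. The gain of [eta] over plain Markov is needed in a union bound over order [L n]
    variables. *)
Lemma integrable_tail (f : Omega -> R) (eta : R) : measurable_fun setT f ->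
  (forall w, 0 <= f w) -> (\int[P]_w (f w)%:E < +oo)%E -> 0 < eta ->
  exists2 K : R, 0 < K & forall x, K <= x -> (P [set w | (x < f w)%R] <= (eta / x)%:E)%E.
Proof.
move=> mf f0 fi eta0.
have mE (x : R) : measurable [set w | x < f w].
  rewrite (_ : [set w | _] = f @^-1` `]x, +oo[%classic).
    by rewrite -[X in measurable X]setTI; apply: mf.
  by apply/seteqP; split => w /=; rewrite in_itv /= andbT.
pose g (n : nat) (w : Omega) : R := f w * \1_[set w | n%:R < f w] w.
have mg n : measurable_fun setT (g n).
  by apply: measurable_funM => //; exact: measurable_indic.
have g0 n w : 0 <= g n w by rewrite mulr_ge0// indicE; case: (_ \in _).
have ig : P.-integrable setT (fun w => (f w)%:E).
  apply/integrableP; split; first exact/measurable_EFinP.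
  rewrite (eq_integral (fun w => (f w)%:E)) // => w _.
  by rewrite /= ger0_norm.
have [_ _] : [/\ P.-integrable setT (cst 0%E : Omega -> \bar R),
    (fun n => \int[P]_(x in setT) `|(g n x)%:E - 0|)%E @ \oo --> 0%E &
    (fun n => \int[P]_(x in setT) (g n x)%:E)%E @ \oo --> (\int[P]_(x in setT) (0 : \bar R))%E].
  apply: (@dominated_convergence _ _ _ P setT measurableT (fun n w => (g n w)%:E) (cst 0%E)
    (fun w => (f w)%:E)) => //.
  - by move=> n; apply/measurable_EFinP; exact: mg.
  - apply: aeW => w _; apply: cvg_near_cst; near=> n.
    rewrite /g indicE memNset ?mulr0//=; apply/negP; rewrite -leNgt.
    by near: n; exact: nbhs_infty_ger.
  - apply: aeW => w n _; rewrite /= lee_fin ger0_norm// /g indicE.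
    by case: (_ \in _); rewrite ?mulr1 ?mulr0.
rewrite integral0 => /fine_cvgP[_] /cvgrPdist_le /(_ _ eta0) [n0 _ /(_ n0 (leqnn _))].
rewrite /= sub0r normrN ger0_norm; last by apply: fine_ge0; apply: integral_ge0 => w _; rewrite lee_fin.
move=> h; exists (n0.+1%:R); first by rewrite ltr0n.
move=> x nx; have x0 : 0 < x by apply: lt_le_trans nx; rewrite ltr0n.
have n0x : n0%:R <= x by apply: le_trans nx; rewrite ler_nat.
have fin : (\int[P]_x0 (g n0 x0)%:E)%E \is a fin_num.
  rewrite ge0_fin_numE; last by apply: integral_ge0 => w _; rewrite lee_fin.
  apply: le_lt_trans fi; apply: ge0_le_integral => //.
  - by move=> w _; rewrite lee_fin.
  - by apply/measurable_EFinP; exact: mg.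
  - by apply/measurable_EFinP.
  - by move=> w _; rewrite lee_fin /g indicE; case: (_ \in _); rewrite ?mulr1 ?mulr0.
rewrite -(fineK (fin_num_measure P _ (mE x))) lee_fin ler_pdivlMr// mulrC.
apply: le_trans h; rewrite -lee_fin fineK// EFinM fineK ?fin_num_measure//.
rewrite -(integral_cst P (mE x) x%:E).
apply: (@le_trans _ _ (\int[P]_(w in [set w | (x < f w)%R]) (g n0 w)%:E)%E).
  apply: ge0_le_integral => //.
  - by move=> w _; rewrite lee_fin ltW.
  - by apply/measurable_EFinP; apply: measurable_funTS; exact: mg.
  - move=> w /= xw; rewrite lee_fin /g indicE mem_set ?mulr1 ?(ltW xw)//=.
    exact: le_lt_trans xw.
apply: ge0_subset_integral => //.
- by apply/measurable_EFinP; exact: mg.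
- by move=> w _; rewrite lee_fin.
Unshelve. all: by end_near.
Qed.

End IntegrableTail.

Section MaxGrowth.
Context {R : realType} d (Omega : measurableType d) (P : probability Omega R).
Context (xi : nat -> Omega -> R * R) (mxi : forall k, measurable_fun setT (xi k)).
Context (xi_id : forall k (A : set (R * R)), measurable A ->
     P (xi k @^-1` A) = P (xi 0%N @^-1` A))
  (xi_log : (\int[P]_w (ln (1 + cmod (xi 0%N w)))%:E < +oo)%E).

Definition growth_event (m : nat) (c : R) : set Omega :=
  \big[setU/set0]_(k < m) [set w | c < ln (1 + cmod (xi k w))].

Lemma growth_eventN m c w : ~ growth_event m c w ->
  forall k, (k < m)%N -> cabs (toC (xi k w)) <= expR c.
Proof.
rewrite /growth_event -(bigcup_mkord m (fun k => [set w | c < ln (1 + cmod (xi k w))])) => h k km.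
have c0 : 0 <= cmod (xi k w) by exact: sqrtr_ge0.
have : ~ (c < ln (1 + cmod (xi k w))) by move=> h2; apply: h; exists k.
move=> /negP; rewrite -leNgt => hl.
have : 1 + cmod (xi k w) <= expR c.
  by rewrite -[leLHS]lnK ?ler_expR// posrE ltr_wpDr.
rewrite (_ : cabs _ = cmod (xi k w)); last by rewrite /cabs /=; case: (xi k w).
by apply: le_trans; rewrite lerDr.
Qed.

Let mlog : measurable_fun setT (fun x : R * R => ln (1 + cmod x)).
Proof.
apply: measurableT_comp; first exact: measurable_ln.
by apply: measurable_funD; [exact: measurable_cst|exact: measurable_cmod].
Qed.

Let mB c : measurable [set x : R * R | c < ln (1 + cmod x)].
Proof.
rewrite (_ : [set w | _] = (fun x : R * R => ln (1 + cmod x)) @^-1` `]c, +oo[%classic).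
  by rewrite -[X in measurable X]setTI; apply: mlog.
by apply/seteqP; split => w /=; rewrite in_itv /= andbT.
Qed.

Let mE c k : measurable [set w | c < ln (1 + cmod (xi k w))].
Proof. by rewrite -[X in measurable X]setTI; exact: (mxi k _ (mB c)). Qed.

Lemma measurable_growth_event m c : measurable (growth_event m c).
Proof. by apply: bigsetU_measurable => k _; exact: mE. Qed.

Lemma growth_event_small (L N : nat -> nat) (C : nat) (eps eta : R) :
  (forall n, (0 < L n)%N) -> L @ \oo --> \oo -> (forall n, (N n < C * L n)%N) ->
  0 < eps -> 0 < eta ->
  \forall n \near \oo, (P (growth_event (N n).+1 (eps * (L n)%:R)) <= eta%:E)%E.
Proof.
move=> L0 Loo NC eps0 eta0.
have C0 : (0 < C)%N by rewrite lt0n; apply/eqP => C0; have := NC 0%N; rewrite C0 mul0n.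
have CR0 : 0 < C%:R :> R by rewrite ltr0n.
have h0 w : 0 <= ln (1 + cmod (xi 0%N w)).
  by apply: ln_ge0; rewrite lerDl sqrtr_ge0.
(* At level [eps * L n] this tail constant gives [eta / (C * L n)] for each of at most [C * L n]
   variables. *)
have [K K0 hK] := integrable_tail (measurableT_comp mlog (mxi 0%N)) h0 xi_log
  (eta := eta * eps / C%:R) (divr_gt0 (mulr_gt0 eta0 eps0) CR0).
have /cvgnyPge /(_ (Num.truncn (K / eps)).+1) := Loo.
apply: filterS => n Ln.
have KL : K <= eps * (L n)%:R.
  rewrite -ler_pdivrMl// mulrC; apply: ltW; apply: lt_le_trans (truncnS_gt _) _.
  by rewrite ler_nat.
apply: (@le_trans _ _ (\sum_(i < (N n).+1) P [set w | (eps * (L n)%:R < ln (1 + cmod (xi i w)))%R])%E).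
  exact: (@Boole_inequality _ _ _ P (fun i => [set w | (eps * (L n)%:R < ln (1 + cmod (xi i w)))%R])).
have LR : 0 < (L n)%:R :> R by rewrite ltr0n.
apply: (@le_trans _ _ (\sum_(i < (N n).+1) (eta / (C * L n)%N%:R)%:E)%E).
  apply: lee_sum => i _; have -> : P [set w | (eps * (L n)%:R < ln (1 + cmod (xi i w)))%R] =
    P [set w | (eps * (L n)%:R < ln (1 + cmod (xi 0%N w)))%R] by exact: xi_id (mB _).
  apply: le_trans (hK _ KL) _; rewrite lee_fin natrM le_eqVlt; apply/orP; left.
  by apply/eqP; field; rewrite !gt_eqF.
rewrite sumEFin sumr_const card_ord lee_fin -[leLHS]mulr_natr mulrAC ler_pdivrMr; last first.
  by rewrite ltr0n muln_gt0 C0 L0.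
by rewrite ler_pM2l// ler_nat; exact: NC.
Qed.

End MaxGrowth.

Section Coefficients.
Context {R : realType} (p : R -> R) (T0 : R).
Context (p_ge0 : forall t, 0 <= t -> 0 <= p t) (T0_gt0 : 0 < T0)
  (p_gt0 : forall t, 0 <= t < T0 -> 0 < p t)
  (p_out : forall t, T0 < t -> p t = 0)
  (p_cont : {within `[0, T0], continuous p}).
Context (L : nat -> nat) (delta : nat -> R) (N : nat -> nat) (pc : nat -> nat -> R[i]).
Context (L_gt0 : forall n, (0 < L n)%N) (delta0 : delta @ \oo --> 0)
  (NE : forall n, (N n)%:R = (T0 - delta n) * (L n)%:R)
  (pc_cvg : forall eps : R, 0 < eps -> \forall n \near \oo, forall k : nat, (k <= N n)%N ->
     `| powR (cabs (pc k n)) (L n)%:R^-1 - p (Num.min (k%:R / (L n)%:R) T0) | <= eps).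

Let LR n : 0 < (L n)%:R :> R. Proof. by rewrite ltr0n. Qed.

Lemma root_powK (a : R) n : (0 < n)%N -> 0 <= a -> (powR a n%:R^-1) ^+ n = a.
Proof.
move=> n0 a0; rewrite -powR_mulrn ?powR_ge0// -powRrM mulVf ?powRr1//.
by rewrite pnatr_eq0 -lt0n.
Qed.

Lemma coeff_powE n k s : cabs (pc k n) * expR (s * k%:R) =
  (powR (cabs (pc k n)) (L n)%:R^-1 * expR (s * (k%:R / (L n)%:R))) ^+ L n.
Proof.
rewrite exprMn root_powK ?cabs_ge0// -expRM_natl; congr (_ * expR _).
by field; rewrite gt_eqF.
Qed.

(** Only an upper bound on [s] is imposed, so the estimate covers all radii down to 0. The additive
    error of the [L n]-th root is made relative by [p 0 <= expR (I s)]. *)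
Lemma coeff_upper (S eps : R) : 0 < eps ->
  \forall n \near \oo, forall k s, (k <= N n)%N -> s <= S ->
  cabs (pc k n) * expR (s * k%:R) <= expR ((L n)%:R * (I_LF p s + eps)).
Proof.
move=> eps0; pose S1 := Num.max S 0.
have S10 : 0 <= S1 by rewrite le_max lexx orbT.
have SS : S <= S1 by rewrite le_max lexx.
have p0 : 0 < p 0 by exact: p00 T0_gt0 p_gt0.
(* Even after multiplication by [expR (t' * s) <= expR (T0 * S1)] the error stays below
   [expR (I s) * (eps / 2)]. *)
pose e1 := p 0 * expR (- (T0 * S1)) * (eps / 2).
have e10 : 0 < e1 by rewrite !mulr_gt0// ?expR_gt0// divr_gt0.
have e20 : 0 < eps / (2 * (S1 + 1)) by rewrite divr_gt0// mulr_gt0// ltr_wpDl.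
have /cvgrPdist_le /(_ _ e20) hd := delta0.
have hp := pc_cvg e10.
apply: filterS2 hd hp => n; rewrite sub0r normrN => hd hp k s kN sS.
have sS1 : s <= S1 by exact: le_trans SS.
rewrite coeff_powE mulrC -[(L n)%:R * _]mulrC expRM_natr [X in X ^+ _]mulrC.
set t := k%:R / (L n)%:R; set q := powR _ _.
have q0 : 0 <= q by exact: powR_ge0.
have t0 : 0 <= t by rewrite divr_ge0.
have tT : t <= T0 + `|delta n|.
  rewrite ler_pdivrMr//; apply: (@le_trans _ _ (N n)%:R); first by rewrite ler_nat.
  rewrite NE ler_pM2r// lerD2l; apply: le_trans (ler_norm _) _; by rewrite normrN.
have := hp k kN; rewrite -/t -/q; set t' := Num.min t T0.
rewrite ler_norml => /andP[_]; rewrite lerBlDl => qp.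
have t'T : 0 <= t' <= T0 by rewrite le_min t0 (ltW T0_gt0)/= ge_min lexx orbT.
have /andP[t'0 t'T0] := t'T.
have dt : 0 <= t - t' <= `|delta n|.
  rewrite /t'; case: (leP t T0) => h; first by rewrite subrr lexx normr_ge0.
  by rewrite subr_ge0 (ltW h) lerBlDl.
have /andP[dt0 dt1] := dt.
have hst : expR (t * s) <= expR (t' * s) * expR (eps / 2).
  rewrite -expRD ler_expR (_ : t * s = t' * s + (t - t') * s); last by ring.
  rewrite lerD2l; apply: le_trans (ler_wpM2l dt0 sS1) _.
  apply: le_trans (ler_wpM2r S10 (le_trans dt1 hd)) _.
  rewrite mulrAC ler_pdivrMr; last by rewrite mulr_gt0// ltr_wpDl.
  by rewrite (_ : eps / 2 * (2 * (S1 + 1)) = eps * S1 + eps) ?lerDl ?ltW//; field.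
have hpI : p t' * expR (t' * s) <= expR (I_LF p s).
  have := p_ge0 t'0; rewrite le_eqVlt => /orP[/eqP <-|pt]; first by rewrite mul0r expR_ge0.
  rewrite -[X in X * _](lnK pt) -expRD ler_expR addrC.
  by apply: (I_LF_ge p_ge0 T0_gt0 p_gt0 p_out p_cont).
have p0I : p 0 <= expR (I_LF p s).
  by rewrite -[leLHS](lnK p0) ler_expR; exact: (I_LF_ge0 p_ge0 T0_gt0 p_gt0 p_out p_cont).
have he1 : e1 * expR (t' * s) <= expR (I_LF p s) * (eps / 2).
  rewrite /e1 (_ : _ * _ * _ * _ = p 0 * (expR (- (T0 * S1)) * expR (t' * s)) * (eps / 2)); last by ring.
  rewrite ler_pM2r ?divr_gt0//; apply: le_trans p0I; rewrite ler_piMr ?(ltW p0)//.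
  rewrite -expRD -[leRHS]expR0 ler_expR addrC subr_le0.
  apply: le_trans (ler_wpM2l t'0 sS1) _; exact: ler_wpM2r.
rewrite lerXn2r ?nnegrE ?mulr_ge0 ?expR_ge0//.
apply: le_trans (ler_pM q0 (expR_ge0 _) qp _) _; first by rewrite mulrC; exact: hst.
rewrite mulrA mulrDl.
apply: le_trans (ler_wpM2r (expR_ge0 _) (lerD hpI he1)) _.
rewrite -[X in X + _]mulr1 -mulrDr.
apply: le_trans (ler_wpM2r (expR_ge0 _) (ler_wpM2l (expR_ge0 _) (expR_ge1Dx (eps / 2)))) _.
by rewrite -!expRD -addrA -splitr.
Qed.

(** By continuity the terms near the maximiser are almost maximal. An interval of positive length in
    [k / L n] supplies order [L n] such indices, enough for [small_ball]. *)
Lemma coeff_lower (s eps : R) : 0 < eps -> exists t0 t1 : R, [/\ 0 <= t0, t0 < t1 &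
  \forall n \near \oo, forall k, t0 <= k%:R / (L n)%:R <= t1 -> (k <= N n)%N /\
  expR ((L n)%:R * (I_LF p s - eps)) <= cabs (pc k n) * expR (s * k%:R)].
Proof.
move=> eps0; have [m hm] := exists_minargmax T0_gt0 p_gt0 p_cont s.
rewrite (I_LF_minargmax p_ge0 p_out hm)//; case: hm => mT pm _ _; have /andP[m0 mT0] := mT.
(* One half is spent on the continuity of [p], the other on the coefficient asymptotics. *)
pose e1 := p m * (1 - expR (- (eps / 2))) / 2.
have e10 : 0 < e1.
  by rewrite !mulr_gt0// ?invr_gt0// subr_gt0 -[ltRHS]expR0 ltr_expR oppr_lt0 divr_gt0.
have [d0 d00 hd0] := within_itv_eps p_cont mT e10.
pose d : R := Num.min d0 (eps / (2 * (`|s| + 1))).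
have s10 : 0 < 2 * (`|s| + 1) by rewrite mulr_gt0// ltr_wpDl.
have dp : 0 < d by rewrite lt_min d00 divr_gt0.
(* The window ends strictly below [T0], so [k <= N n] holds eventually even for positive [delta n].
   It lies to the right of a small [m] and to the left of a large one. *)
have [t0 [t1 [t00 t01 t1T td]]] : exists t0 t1 : R, [/\ 0 <= t0, t0 < t1, t1 < T0 &
    forall t, t0 <= t <= t1 -> `|m - t| < d].
  have [h [h0 hd hT]] : exists h : R, [/\ 0 < h, h * 4 <= d & h * 4 <= T0].
    clearbody d; move: T0_gt0 => T00.
    by have [dT|Td] := leP d T0; [exists (d / 4)|exists (T0 / 4)]; split; lra.
  move: T0_gt0 => T00.
  have [mh|mh] := leP m (T0 / 2); [exists m, (m + h)|exists (m - 2 * h), (m - h)];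
    (split; [lra|lra|lra|move=> t /andP[h1 h2]; rewrite ltr_norml; apply/andP; split; lra]).
exists t0, t1; split => //.
have T10 : 0 < T0 - t1 by rewrite subr_gt0.
have /cvgrPdist_lt /(_ _ T10) hd := delta0.
have hp := pc_cvg e10.
apply: filterS2 hd hp => n; rewrite sub0r normrN => hd hp k; set t := k%:R / _.
move=> tt; have /andP[tt0 tt1] := tt.
have tT : t < T0 by exact: le_lt_trans t1T.
have t0' : 0 <= t by exact: le_trans tt0.
have kN : (k <= N n)%N.
  rewrite -(ler_nat R) NE -ler_pdivrMr// -/t; apply: le_trans tt1 _.
  by have := ler_norm (delta n); move: hd; lra.
split=> //; rewrite coeff_powE expRM_natl.
have := hp k kN; rewrite -/t (min_idPl (ltW tT)); set q := powR _ _.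
rewrite ler_norml => /andP[qp _].
have := hd0 t; rewrite t0' (ltW tT) => /(_ isT).
have mtd := td t tt; have mtd0 : `|m - t| < d0 by apply: lt_le_trans mtd _; rewrite ge_min lexx.
move=> /(_ mtd0); rewrite ltr_norml => /andP[_ pmt].
have qe : p m * expR (- (eps / 2)) <= q.
  have : 2 * e1 = p m - p m * expR (- (eps / 2)) by rewrite /e1; field.
  move: qp pmt; lra.
have ts : m * s - eps / 2 <= s * t.
  have : s * (m - t) <= eps / 2.
    apply: le_trans (ler_norm _) _; rewrite normrM.
    apply: le_trans (ler_wpM2l (normr_ge0 _) (ltW mtd)) _.
    apply: (@le_trans _ _ (`|s| * (eps / (2 * (`|s| + 1))))).
      by rewrite ler_wpM2l// ge_min lexx orbT.
    rewrite mulrA ler_pdivrMr//.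
    by rewrite (_ : eps / 2 * (2 * (`|s| + 1)) = `|s| * eps + eps) ?lerDl ?ltW//; field.
  by rewrite mulrBr (mulrC s m); lra.
rewrite lerXn2r ?nnegrE ?mulr_ge0 ?expR_ge0 ?powR_ge0//.
have -> : m * s + ln (p m) - eps = ln (p m) - eps / 2 + (m * s - eps / 2) by lra.
rewrite expRD expRD lnK ?posrE//; apply: ler_pM => //; rewrite ?expR_ge0 ?ler_expR//.
by rewrite mulr_ge0 ?expR_ge0 ?ltW.
Qed.

End Coefficients.

Section PolyBounds.
Context {R : realType} (p : R -> R) (T0 : R).
Context (p_ge0 : forall t, 0 <= t -> 0 <= p t) (T0_gt0 : 0 < T0)
  (p_gt0 : forall t, 0 <= t < T0 -> 0 < p t)
  (p_out : forall t, T0 < t -> p t = 0)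
  (p_cont : {within `[0, T0], continuous p}).
Context (L : nat -> nat) (delta : nat -> R) (N : nat -> nat) (pc : nat -> nat -> R[i]).
Context (L_gt0 : forall n, (0 < L n)%N) (L_oo : L @ \oo --> \oo) (delta0 : delta @ \oo --> 0)
  (NE : forall n, (N n)%:R = (T0 - delta n) * (L n)%:R)
  (pc_cvg : forall eps : R, 0 < eps -> \forall n \near \oo, forall k : nat, (k <= N n)%N ->
     `| powR (cabs (pc k n)) (L n)%:R^-1 - p (Num.min (k%:R / (L n)%:R) T0) | <= eps).

Let LR n : 0 < (L n)%:R :> R. Proof. by rewrite ltr0n. Qed.

Definition Fpoly (n : nat) (x : nat -> R[i]) : {poly R[i]} :=
  \poly_(k < (N n).+1) (x k * pc k n).

Lemma L_large (c : R) : \forall n \near \oo, c <= (L n)%:R.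
Proof.
have /cvgnyPge /(_ (Num.truncn c).+1) := L_oo.
apply: filterS => n Ln; apply: ltW; apply: lt_le_trans (truncnS_gt _) _.
by rewrite ler_nat.
Qed.

(** A deterministic statement about [x], so one growth event serves all [z] at once. A quarter of
    [eps] goes to [x k], to the coefficients, to the number of terms, and to enlarging the radius,
    which stays positive even for [z = 0]. *)
Lemma poly_upper (Rad eps : R) (C : nat) : 0 < eps -> (forall n, (N n < C * L n)%N) ->
  \forall n \near \oo, forall x : nat -> R[i],
  (forall k, (k < (N n).+1)%N -> cabs (x k) <= expR (eps / 4 * (L n)%:R)) ->
  forall z, cabs z <= Rad ->
  cabs (Fpoly n x).[z] <= expR ((L n)%:R * (radial_pot p (cabs z) + eps)).
Proof.
move=> eps0 NC; have e40 : 0 < eps / 4 by rewrite divr_gt0.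
have [d d0 hd] := radial_pot_unif p_ge0 T0_gt0 p_gt0 p_out p_cont e40.
pose h : R := Num.min d 1; have h0 : 0 < h by rewrite lt_min d0 ltr01.
have hhd : 0 <= h <= d by rewrite (ltW h0) ge_min lexx.
have h1 : h <= 1 by rewrite ge_min lexx orbT.
have hu := coeff_upper p_ge0 T0_gt0 p_gt0 p_out p_cont L_gt0 delta0 NE pc_cvg
  (ln (Rad + 1)) e40.
(* With [y = eps / 8 * L n] this threshold says [C * L n <= y * y], and [y * y <= expR (2 * y)]. *)
apply: filterS2 (L_large (64 * C%:R / eps ^+ 2)) hu => n hL hu x hx z zR.
set r := cabs z + h; have r0 : 0 < r by rewrite ltr_wpDl ?cabs_ge0.
have rR : r <= Rad + 1 by apply: lerD.
have Rad0 : 0 < Rad + 1 by exact: lt_le_trans rR.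
have := hd (cabs z) h (cabs_ge0 _) hhd; rewrite -/r {1}/radial_pot gt_eqF// => hI.
rewrite /Fpoly horner_poly; apply: le_trans (cabs_sum _ _) _.
apply: (@le_trans _ _ (\sum_(k < (N n).+1) expR ((L n)%:R * (I_LF p (ln r) + eps / 2)))).
  apply: ler_sum => -[k kN] _ /=; rewrite !cabsM cabsX -mulrA.
  rewrite (_ : (L n)%:R * _ = eps / 4 * (L n)%:R + (L n)%:R * (I_LF p (ln r) + eps / 4)); last by field.
  rewrite expRD; apply: ler_pM; rewrite ?mulr_ge0 ?cabs_ge0 ?exprn_ge0 ?cabs_ge0 ?hx//.
  apply: le_trans (hu k (ln r) _ _) => //; last by rewrite ler_ln.
  rewrite ler_wpM2l ?cabs_ge0// expRM_natr lnK ?posrE// lerXn2r ?nnegrE ?cabs_ge0 ?(ltW r0)//.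
  by rewrite lerDl ltW.
rewrite sumr_const card_ord -[leLHS]mulr_natl.
have NCL : (N n).+1%:R <= C%:R * (L n)%:R :> R by rewrite -natrM ler_nat.
have CL : C%:R * (L n)%:R <= expR ((L n)%:R * (eps / 4)).
  rewrite (_ : (L n)%:R * _ = eps / 8 * (L n)%:R + eps / 8 * (L n)%:R); last by field.
  rewrite expRD; set y := eps / 8 * (L n)%:R.
  have y0 : 0 <= y by rewrite mulr_ge0 ?divr_ge0 ?(ltW eps0).
  apply: (@le_trans _ _ (y * y)).
    move: hL; rewrite ler_pdivrMr ?exprn_gt0// => hL.
    have := ler_wpM2r (ltW (LR n)) hL; rewrite /y expr2 => h64.
    lra.
  by apply: ler_pM => //; apply: le_trans (expR_ge1Dx _); rewrite lerDr.
apply: le_trans (ler_wpM2r (expR_ge0 _) (le_trans NCL CL)) _.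
rewrite -expRD ler_expR -mulrDr ler_wpM2l ?(ltW (LR n))//; lra.
Qed.

Context d (Omega : measurableType d) (P : probability Omega R).
Context (xi : nat -> Omega -> R * R) (mxi : forall k, measurable_fun setT (xi k)).
Context (xi_ind : forall (n : nat) (A : nat -> set (R * R)), (forall k, measurable (A k)) ->
     P [set w | forall k, (k < n)%N -> xi k w \in A k]
     = (\prod_(k < n) P (xi k @^-1` A k))%E)
  (xi_id : forall k (A : set (R * R)), measurable A ->
     P (xi k @^-1` A) = P (xi 0%N @^-1` A))
  (xi_nd : ~ (exists c : R * R, P (xi 0%N @^-1` [set c]) = 1%E)).

Definition low_event n (z : R[i]) (c : R) : set Omega :=
  [set w | cabs (Fpoly n (fun k => toC (xi k w))).[z] < c].

Lemma Fpoly_rsum n z w : (Fpoly n (fun k => toC (xi k w))).[z] =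
  rsum xi (fun k => pc k n * z ^+ k) (N n).+1 w.
Proof. by rewrite /Fpoly horner_poly /rsum; apply: eq_bigr => k _; rewrite mulrA. Qed.

Lemma measurable_low_event n z c : measurable (low_event n z c).
Proof.
rewrite /low_event; under eq_set do rewrite Fpoly_rsum.
exact: measurable_rsum_lt.
Qed.

(** [small_ball] applied to consecutive indices inside the window of [coeff_lower]; half of [eps]
    goes to the coefficients, half absorbs the constant [del]. *)
Lemma poly_lower (z : R[i]) (eps eta : R) : z != 0 -> 0 < eps -> 0 < eta ->
  \forall n \near \oo,
    (P (low_event n z (expR ((L n)%:R * (radial_pot p (cabs z) - eps)))) <= eta%:E)%E.
Proof.
move=> z0 eps0 eta0; have cz0 : 0 < cabs z by rewrite cabs_gt0.
have rI : radial_pot p (cabs z) = I_LF p (ln (cabs z)) by rewrite /radial_pot gt_eqF.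
rewrite rI => {rI}.
have e20 : 0 < eps / 2 by rewrite divr_gt0.
have [m [del [del0 hsb]]] := small_ball mxi xi_ind xi_id xi_nd eta0.
have [t0 [t1 [t00 t01 hlow]]] :=
  coeff_lower p_ge0 T0_gt0 p_gt0 p_out p_cont L_gt0 delta0 NE pc_cvg (ln (cabs z)) e20.
(* The first threshold fits [m] indices after rounding into the window, the second ensures
   [expR (- (eps / 2) * L n) <= del]. *)
apply: filterS3 (L_large (m.+1%:R / (t1 - t0))) (L_large (- (2 * ln del / eps))) hlow.
move=> n hL1 hL2 hlow.
pose k0 := (Num.truncn (t0 * (L n)%:R)).+1.
have /andP[k01 k02] : t0 * (L n)%:R <= k0%:R <= t0 * (L n)%:R + 1.
  have tL0 : 0 <= t0 * (L n)%:R by rewrite mulr_ge0.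
  rewrite (ltW (truncnS_gt _)) /k0 -natr1 lerD2r.
  by rewrite truncn_le.
have hk k : (k0 <= k <= k0 + m)%N -> t0 <= k%:R / (L n)%:R <= t1.
  move=> /andP[kk0 km]; rewrite ler_pdivlMr// ler_pdivrMr//; apply/andP; split.
    by apply: le_trans k01 _; rewrite ler_nat.
  move: hL1; rewrite ler_pdivrMr ?subr_gt0// -natr1 => hL1.
  have : k%:R <= k0%:R + m%:R :> R by rewrite -natrD ler_nat.
  move: k02; nra.
have ha k : (k0 <= k <= k0 + m)%N -> (k <= N n)%N /\
    expR ((L n)%:R * (I_LF p (ln (cabs z)) - eps / 2)) <= cabs (pc k n * z ^+ k).
  move=> /hk/hlow[h1 h2]; split=> //; move: h2.
  by rewrite cabsM cabsX expRM_natr lnK// posrE.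
have kmN : (k0 + m <= N n)%N by apply: (ha _ _).1; rewrite leq_addr leqnn.
apply: le_trans (hsb (N n).+1 (fun k => pc k n * z ^+ k)
  (expR ((L n)%:R * (I_LF p (ln (cabs z)) - eps / 2))) k0 (expR_gt0 _) (leqW kmN) _); last first.
  by move=> k /andP[h1 h2]; apply: (ha k _).2; rewrite h1 (ltnW h2).
apply: le_measure; rewrite ?inE; [exact: measurable_low_event|exact: measurable_rsum_lt|].
move=> w; rewrite /low_event /= Fpoly_rsum => h; apply: lt_le_trans h _.
rewrite -[del]lnK ?posrE// -expRD ler_expR.
have : - (2 * ln del) <= eps * (L n)%:R.
  by rewrite -ler_pdivrMl// mulrC mulNr.
lra.
Qed.

End PolyBounds.

(** * Logarithmic potentials of polynomials *)

Section LogPotential.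
Context {R : realType}.
Implicit Types (f : {poly R[i]}) (w z : R[i]) (e : R).

Lemma rootseqE f : f != 0 -> f = lead_coef f *: \prod_(z <- rootseq f) ('X - z%:P).
Proof.
by move=> f0; rewrite /rootseq (negPf f0); case: closed_field_poly_normal.
Qed.

Lemma horner_rootseq f z : f != 0 -> f.[z] = lead_coef f * \prod_(a <- rootseq f) (z - a).
Proof.
move=> f0; rewrite {1}(rootseqE f0) hornerZ horner_prod; congr (_ * _).
by apply: eq_bigr => a _; rewrite hornerXsubC.
Qed.

Lemma size_rootseq f : (size (rootseq f) <= (size f).-1)%N.
Proof.
have [->|f0] := eqVneq f 0; first by rewrite /rootseq eqxx.
by rewrite {2}(rootseqE f0) size_scale ?lead_coef_eq0// size_prod_XsubC.
Qed.

(** For [f = F_n] this is [L n] times the smoothed potential [U n e w]; at [f = 0] the conventions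
    give 0. *)
Definition logpot f w e : R :=
  ln (cabs (lead_coef f)) + \sum_(a <- rootseq f) psi e (a - w).

Lemma expR_logpot f w e : f != 0 -> 0 < e -> expR (logpot f w e) =
  cabs (lead_coef f) * \prod_(a <- rootseq f) Num.max (cabs (a - w)) e.
Proof.
move=> f0 e0; rewrite /logpot -ln_prod_psi// expRD !lnK ?posrE//.
  by apply: prodr_gt0 => a _; exact: max_gt0.
by rewrite cabs_gt0 lead_coef_eq0.
Qed.

Lemma logpot_ge f w e : f != 0 -> 0 < e -> cabs f.[w] <= expR (logpot f w e).
Proof.
move=> f0 e0; rewrite expR_logpot// horner_rootseq// cabsM cabs_prod.
rewrite ler_wpM2l ?cabs_ge0//; apply: ler_prod => a _.
by rewrite cabs_ge0 cabsB_sym le_max lexx.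
Qed.

Lemma logpot_le_circle f w e : f != 0 -> 0 < e ->
  exists2 z, cabs z <= cabs w + e & expR (logpot f w e) <= cabs f.[z].
Proof.
move=> f0 e0; have [zeta pz] := @prim_root_exists_C R (size (rootseq f)).+1 isT.
have [l _ hl] := jensen_circle (lead_coef f) w e0 pz (leqnn _).
exists (w + e%:C%C * zeta ^+ l); last by rewrite expR_logpot// horner_rootseq.
apply: le_trans (cabsD _ _) _; rewrite lerD2l cabsM cabsX (cabs_prim _ pz)// expr1n mulr1.
by rewrite cabs_real ger0_norm ?(ltW e0).
Qed.

Definition circle_prod f w e (T M : nat) (zeta : R[i]) (l : nat) : R :=
  \prod_(k < M) cabs f.[w + e%:C%C * zeta ^+ (l + k * T)].

(** The powers [zeta ^+ (k * T)] run over the [M]-th roots of unity, so multiplying over [k]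
    replaces each root [a - w] by its [M]-th power, as in Graeffe's method. *)
Lemma circle_prodE f w e T M zeta l : f != 0 -> (0 < M)%N -> (M * T).-primitive_root zeta ->
  circle_prod f w e T M zeta l = cabs (lead_coef f ^+ M *
    \prod_(b <- [seq (a - w) ^+ M | a <- rootseq f]) (0 + (e ^+ M)%:C%C * (zeta ^+ M) ^+ l - b)).
Proof.
move=> f0 M0 pz; rewrite /circle_prod -cabs_prod.
have pzT : M.-primitive_root (zeta ^+ T).
  by rewrite -[T](mulKn T M0); apply: (dvdn_prim_root pz); exact: dvdn_mulr.
transitivity (cabs (lead_coef f ^+ M *
    \prod_(a <- rootseq f) ((w - a) ^+ M - (- (e%:C%C * zeta ^+ l)) ^+ M))).
  congr (cabs _); under eq_bigr => k _ do rewrite horner_rootseq//.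
  rewrite big_split /= prodr_const card_ord exchange_big /=; congr (_ * _).
  apply: eq_bigr => a _; rewrite -(prod_sub_prim _ _ M0 pzT); apply: eq_bigr => k _.
  by rewrite -exprM exprD (mulnC T) mulNr opprK mulrA addrAC.
rewrite !cabsM !cabs_prod big_map; congr (_ * _); apply: eq_bigr => a _.
rewrite add0r; set x := e%:C%C * zeta ^+ l; set y := a - w.
have -> : (w - a) ^+ M - (- x) ^+ M = (-1) ^+ M * (y ^+ M - x ^+ M).
  by rewrite -(opprB a w) -/y (exprNn y) (exprNn x) mulrBr.
rewrite cabsM cabsX cabsN cabs1 expr1n mul1r cabsB_sym; congr (cabs (_ - _)).
by rewrite /x exprMn rmorphXn -!exprM mulnC.
Qed.

(* [circle_max] is comparable to the [M]-th power of [expR (logpot f w e)] up to a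
   factor [2 ^ deg f].  It is a measurable function of [f] since only
   values of [f] enter, so [logpot], and with it [zero_pairing], is measurable. *)
Definition circle_max f w e (T M : nat) (zeta : R[i]) : R :=
  \big[Num.max/0]_(l < T) circle_prod f w e T M zeta l.

Lemma max_exp (x e : R) M : 0 <= x -> 0 < e -> Num.max (x ^+ M) (e ^+ M) = Num.max x e ^+ M.
Proof.
move=> x0 e0; have [xe|ex] := leP x e.
  by rewrite max_r// lerXn2r ?nnegrE ?(ltW e0).
by rewrite max_l// lerXn2r ?nnegrE ?(ltW e0)// ltW.
Qed.

(** From below, Jensen for the powered roots on the circle of radius [e ^+ M]; from above, each
    factor is at most twice the maximum. The factor 2 per root does not grow with [M]. *)
Lemma circle_max_bounds f w e T M zeta : f != 0 -> 0 < e -> (0 < M)%N ->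
  (size (rootseq f) < T)%N -> (M * T).-primitive_root zeta ->
  expR (logpot f w e) ^+ M <= circle_max f w e T M zeta
    <= 2 ^+ size (rootseq f) * expR (logpot f w e) ^+ M.
Proof.
move=> f0 e0 M0 rsT pz; have eM0 : 0 < e ^+ M by rewrite exprn_gt0.
have pzM : T.-primitive_root (zeta ^+ M).
  have T0 : (0 < T)%N by exact: leq_ltn_trans rsT.
  by rewrite -[M](mulnK M T0); apply: (dvdn_prim_root pz); exact: dvdn_mull.
have E : expR (logpot f w e) ^+ M = cabs (lead_coef f ^+ M) *
    \prod_(b <- [seq (a - w) ^+ M | a <- rootseq f]) Num.max (cabs (b - 0)) (e ^+ M).
  rewrite expR_logpot// exprMn cabsX big_map -prodrXl; congr (_ * _).
  by apply: eq_bigr => a _; rewrite subr0 cabsX max_exp ?cabs_ge0.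
apply/andP; split.
  have [|l lT hl] := jensen_circle (lead_coef f ^+ M) 0 eM0 pzM
    (rs := [seq (a - w) ^+ M | a <- rootseq f]); first by rewrite size_map.
  rewrite E; apply: le_trans hl _; rewrite -(circle_prodE w e l f0 M0 pz).
  exact: (le_bigmax _ (fun l : 'I_T => circle_prod f w e T M zeta l) (Ordinal lT)).
apply: bigmax_le => [|l _]; first by rewrite mulr_ge0 ?exprn_ge0 ?expR_ge0.
rewrite (circle_prodE w e l f0 M0 pz) E cabsM cabs_prod mulrCA ler_wpM2l ?cabs_ge0//.
rewrite -(size_map (fun a => (a - w) ^+ M)).
elim: [seq _ | _ <- _] => [|b s IH]; first by rewrite !big_nil expr0 mul1r.
rewrite !big_cons /= exprS -mulrA [2 ^+ _ * _]mulrCA mulrA; apply: ler_pM.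
- exact: cabs_ge0.
- by apply: prodr_ge0 => a _; exact: cabs_ge0.
- apply: le_trans (cabsD _ _) _; rewrite cabsN add0r subr0 cabsM cabs_real.
  rewrite ger0_norm ?(ltW eM0)// !cabsX (cabs_prim _ pz)// ?muln_gt0 ?M0 ?(leq_ltn_trans _ rsT)//.
  rewrite !expr1n mulr1 mulrDl mul1r addrC; apply: lerD; rewrite le_max lexx ?orbT//.
- exact: IH.
Qed.

Lemma logpot0 w e : logpot 0 w e = 0.
Proof. by rewrite /logpot /rootseq eqxx lead_coef0 cabs0 ln0 ?add0r// big_nil. Qed.

(** The logarithm of the factor [2 ^+ size (rootseq f)] is divided by [M = n.+1] and vanishes in the
    limit. *)
Lemma circle_max_cvg f w e T (zeta : nat -> R[i]) : 0 < e -> (size f <= T)%N -> (0 < T)%N ->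
  (forall n, (n.+1 * T).-primitive_root (zeta n)) ->
  n.+1%:R^-1 * ln (circle_max f w e T n.+1 (zeta n)) @[n --> \oo] --> logpot f w e.
Proof.
(* For [f = 0] both sides are 0, since [ln 0 = 0]. *)
move=> e0 fT T0 pz; have [f0|f0] := eqVneq f 0.
  rewrite f0 logpot0 (_ : (fun n => _) = fun=> 0); first exact: cvg_cst.
  apply/funext => n; rewrite /circle_max.
  under eq_bigr => l _ do rewrite /circle_prod big_ord_recl horner0 cabs0 mul0r.
  rewrite (_ : \big[_/_]_l 0 = 0) ?ln0 ?mulr0//.
  by apply: (big_ind (fun x : R => x = 0)) => // x y -> ->; exact: maxxx.
have rsT : (size (rootseq f) < T)%N.
  by apply: leq_ltn_trans (size_rootseq f) _; rewrite prednK ?size_poly_gt0.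
apply/cvgrPdist_le => eps eps0.
pose c : R := (size (rootseq f))%:R * ln 2.
have c0 : 0 <= c by rewrite mulr_ge0// ln_ge0// ler1n.
have /cvgrPdist_le /(_ (eps / (c + 1))) := @cvg_harmonic R.
move=> []; first by rewrite divr_gt0// ltr_wpDl.
move=> n0 _ hn0; exists n0 => // n /hn0; rewrite /= sub0r normrN ger0_norm ?invr_ge0// => hn.
have /andP[h1 h2] := @circle_max_bounds f w e T n.+1 (zeta n) f0 e0 isT rsT (pz n).
have m0 : 0 < circle_max f w e T n.+1 (zeta n) by apply: lt_le_trans h1; rewrite exprn_gt0// expR_gt0.
have n0' : 0 < n.+1%:R :> R by rewrite ltr0n.
have l1 : n.+1%:R * logpot f w e <= ln (circle_max f w e T n.+1 (zeta n)).
  by rewrite -ler_expR expRM_natl lnK.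
have l2 : ln (circle_max f w e T n.+1 (zeta n)) <= c + n.+1%:R * logpot f w e.
  rewrite -ler_expR lnK// expRD; apply: le_trans h2 _.
  by rewrite (expRM_natl n.+1) /c (expRM_natl (size _)) lnK ?posrE.
have : c * n.+1%:R^-1 <= eps.
  apply: le_trans (ler_wpM2l c0 hn) _; rewrite mulrA ler_pdivrMr ?ltr_wpDl//.
  by rewrite mulrDr mulr1 mulrC lerDl ltW.
rewrite distrC ger0_norm.
  move=> h; rewrite lerBlDr; apply: le_trans (lerD h (lexx _)).
  by rewrite ler_pdivrMl// mulrDr mulrCA mulfV ?gt_eqF// mulr1.
by rewrite subr_ge0 ler_pdivlMl.
Qed.

End LogPotential.

(** * Measurability of the zero statistics *)

Section MeasurableZeros.
Context {R : realType} d (Omega : measurableType d).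
Context (G : Omega -> {poly R[i]}) (T : nat) (GT : forall w, (size (G w) <= T)%N)
  (mG : forall z, measurable_fun setT (fun w => cabs (G w).[z])).

Lemma measurable_circle_max z e S M zeta :
  measurable_fun setT (fun w => circle_max (G w) z e S M zeta).
Proof.
rewrite /circle_max; elim: (index_enum _) => [|l s IH].
  by under eq_fun do rewrite big_nil; exact: measurable_cst.
under eq_fun do rewrite big_cons; apply: measurable_maxr => //.
rewrite /circle_prod; elim: (index_enum _) => [|k t IHt].
  by under eq_fun do rewrite big_nil; exact: measurable_cst.
under eq_fun do rewrite big_cons; exact: measurable_funM.
Qed.

Lemma measurable_logpot z e : 0 < e -> measurable_fun setT (fun w => logpot (G w) z e).
Proof.
move=> e0; have /choice[zeta pz] : forall n, exists zeta : R[i], (n.+1 * T.+1).-primitive_root zeta.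
  by move=> n; exact: prim_root_exists_C.
apply: (@measurable_fun_cvg _ _ _ _
  (fun n w => n.+1%:R^-1 * ln (circle_max (G w) z e T.+1 n.+1 (zeta n)))) => [n|w _].
  apply: measurable_funM; first exact: measurable_cst.
  by apply: measurableT_comp; [exact: measurable_ln|exact: measurable_circle_max].
by apply: circle_max_cvg => //; exact: leqW.
Qed.

(** Exchanging the sums; the leading coefficient enters every [logpot] alike and cancels as the
    coefficients sum to 0. *)
Lemma sum_combo (f : {poly R[i]}) (cs : seq (R * R[i])) e : \sum_(q <- cs) q.1 = 0 ->
  \sum_(a <- rootseq f) combo cs e a = \sum_(q <- cs) q.1 * logpot f q.2 e.
Proof.
move=> s0; rewrite /combo exchange_big /= /logpot.
under [RHS]eq_bigr => q _ do rewrite mulrDr mulr_sumr.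
by rewrite big_split /= -mulr_suml s0 mul0r add0r.
Qed.

Lemma zero_pairing_combo (phi : R -> R -> R) f cs e eps : \sum_(q <- cs) q.1 = 0 ->
  (forall a, `|Cfun phi a - combo cs e a| <= eps) ->
  `|zero_pairing phi f - \sum_(q <- cs) q.1 * logpot f q.2 e| <= (size f).-1%:R * eps.
Proof.
move=> s0 h; have eps0 : 0 <= eps by apply: le_trans (h 0); exact: normr_ge0.
rewrite -sum_combo// /zero_pairing -sumrB.
apply: (@le_trans _ _ ((size (rootseq f))%:R * eps)); last first.
  by rewrite ler_wpM2r// ler_nat size_rootseq.
elim: (rootseq f) => [|a s IH]; first by rewrite big_nil normr0 mul0r.
rewrite big_cons /= -natr1 mulrDl mul1r addrC; apply: le_trans (ler_normD _ _) _.
exact: lerD IH (h a).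
Qed.

Lemma measurable_zero_pairing phi : potential_approx (Cfun phi) ->
  measurable_fun setT (fun w => zero_pairing phi (G w)).
Proof.
move=> hF; have [e [cs h]] := potential_approx_seq hF.
apply: (@measurable_fun_cvg _ _ _ _ (fun n w => \sum_(q <- cs n) q.1 * logpot (G w) q.2 (e n))) => [n|w _].
  have [e0 _ _ _] := h n; elim: (cs n) => [|q s IH].
    under eq_fun do rewrite big_nil; exact: measurable_cst.
  under eq_fun do rewrite big_cons; apply: measurable_funD => //.
  by apply: measurable_funM; [exact: measurable_cst|exact: measurable_logpot].
apply/cvgrPdist_le => eps eps0; pose c : R := (size (G w)).-1%:R.
have /cvgrPdist_le /(_ (eps / (c + 1))) := @cvg_harmonic R.
move=> []; first by rewrite divr_gt0// ltr_wpDl.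
move=> n0 _ hn0; exists n0 => // n /hn0; rewrite /= sub0r normrN ger0_norm ?invr_ge0// => hn.
have [e0 _ s0 hn'] := h n; apply: le_trans (zero_pairing_combo (G w) s0 hn') _.
rewrite -/c; apply: le_trans (ler_wpM2l _ hn) _; first by rewrite /c.
have c10 : 0 < c + 1 by rewrite ltr_wpDl// /c.
by rewrite mulrA ler_pdivrMr// mulrDr mulr1 mulrC lerDl ltW.
Qed.

End MeasurableZeros.

(** * Convergence of the zeros *)

Section LimitMeasure.
Context {R : realType} (p : R -> R) (T0 : R).
Context (p_ge0 : forall t, 0 <= t -> 0 <= p t) (T0_gt0 : 0 < T0)
  (p_gt0 : forall t, 0 <= t < T0 -> 0 < p t)
  (p_out : forall t, T0 < t -> p t = 0)
  (p_cont : {within `[0, T0], continuous p}).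

(** The difference quotient lies between the least maximisers at [s'] and at [s], and these converge
    by left continuity. *)
Lemma I_LF_left_derivative s m : minargmax p T0 s m ->
  (fun s' => (I_LF p s' - I_LF p s) / (s' - s)) @ s^'- --> m.
Proof.
move=> hm; apply/cvgrPdist_le => e e0.
have [d d0 hd] := minargmax_left p_ge0 T0_gt0 p_gt0 p_out p_cont hm e0.
near=> s'.
have s's : s' < s by near: s'; exact: nbhs_left_lt.
have [m' hm'] := exists_minargmax T0_gt0 p_gt0 p_cont s'.
have mm' : m - e < m'.
  apply: (hd s') => //; rewrite s's andbT.
  by near: s'; apply: nbhs_left_gt; rewrite ltrBlDr ltrDl.
have /andP[h1 h2] := I_LF_slope p_ge0 T0_gt0 p_gt0 p_out p_cont hm hm'.
have ss0 : 0 < s - s' by rewrite subr_gt0.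
rewrite -[X in m - X]mulrNN -invrN !opprB; set q := _ / _.
have q1 : m' <= q by rewrite ler_pdivlMr.
have q2 : q <= m by rewrite ler_pdivrMr.
by rewrite ger0_norm ?subr_ge0//; move: mm' q1; clearbody q; lra.
Unshelve. all: by end_near. Qed.

Lemma exists_limit_measure : exists (mu : {measure set (R * R) -> \bar R}) (m : R -> R),
  [/\ forall s, minargmax p T0 s (m s),
    forall (th : R) (A : set (R * R)), measurable A -> mu (rotation th @^-1` A) = mu A,
    forall r, 0 < r -> mu (disk r) = (m (ln r))%:E & mu setT = T0%:E].
Proof.
have /choice[m hm] := exists_minargmax T0_gt0 p_gt0 p_cont.
pose tau r := m (ln r).
have tau_mono (x y : R) : 0 < x -> x <= y -> tau x <= tau y.
  move=> x0; rewrite le_eqVlt => /orP[/eqP ->//|xy].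
  apply: (minargmax_le p_ge0 T0_gt0 p_gt0 p_out p_cont _ (hm _) (hm _)).
  by rewrite ltr_ln ?posrE// (lt_trans x0).
have tau_bd (x : R) : 0 < x -> 0 <= tau x <= T0 by move=> _; have [] := hm (ln x).
have tau_left (x t : R) : 0 < x -> t < tau x -> exists2 y, 0 < y < x & t < tau y.
  move=> x0 tx; have e0 : 0 < tau x - t by rewrite subr_gt0.
  have [d d0 hd] := minargmax_left p_ge0 T0_gt0 p_gt0 p_out p_cont (hm (ln x)) e0.
  exists (expR (ln x - d / 2)); first rewrite expR_gt0 -[ltRHS]lnK ?ltr_expR ?posrE//=.
    by move: d0; lra.
  have := hd (ln x - d / 2) (tau (expR (ln x - d / 2))).
  rewrite /tau expRK subKr; apply; last exact: hm.
  by move: d0; lra.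
have tau_top (t : R) : t < T0 -> exists2 y, 0 < y & t < tau y.
  move=> /(minargmax_top T0_gt0 p_gt0 p_cont)[s0 hs0].
  exists (expR (s0 + 1)); first exact: expR_gt0.
  by apply: (hs0 _ _ _ (hm _)); rewrite expRK ltrDl.
have rot := @polar_measure_rot R tau T0 T0_gt0 tau_mono tau_bd tau_left tau_top.
have disk := @polar_measure_disk R tau T0 T0_gt0 tau_mono tau_bd tau_left tau_top.
have tot := @polar_measure_setT R tau T0 T0_gt0 tau_mono tau_bd tau_left tau_top.
move: (polar_measure _ _ _ _ _) rot disk tot => mu rot disk tot.
exists mu, m; split.
- exact: hm.
- by move=> th A mA; apply: rot.
- by move=> r r0; apply: disk.
- exact: tot.
Qed.

End LimitMeasure.

Section Deterministic.
Context {R : realType}.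

(** The lower bound at the single point [w] already suffices, and it also excludes [f = 0]; the
    upper bound is required on a whole disk because Jensen does not locate its point. *)
Lemma logpot_close (f : {poly R[i]}) w e (l U V : R) : 0 < l -> 0 < e ->
  expR (l * U) <= cabs f.[w] ->
  (forall z, cabs z <= cabs w + e -> cabs f.[z] <= expR (l * V)) ->
  U <= l^-1 * logpot f w e <= V.
Proof.
move=> l0 e0 hU hV; have f0 : f != 0.
  apply: contraTneq hU => ->; rewrite horner0 cabs0 -ltNge; exact: expR_gt0.
have [z zw hz] := logpot_le_circle w f0 e0.
rewrite ler_pdivlMl// ler_pdivrMl//; apply/andP; split; rewrite -ler_expR.
  exact: le_trans (logpot_ge w f0 e0).
exact: le_trans hz (hV z zw).
Qed.

Lemma zero_pairing_close (phi : R -> R -> R) (f : {poly R[i]}) (cs : seq (R * R[i])) (e eps C D l B : R)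
    (pot : R[i] -> R) : 0 < l -> 0 <= D ->
  \sum_(q <- cs) q.1 = 0 -> \sum_(q <- cs) `|q.1| <= C ->
  (forall a, `|Cfun phi a - combo cs e a| <= eps) ->
  (size f).-1%:R <= B * l ->
  (forall q, q \in cs -> `|l^-1 * logpot f q.2 e - pot q.2| <= D) ->
  `|l^-1 * zero_pairing phi f - \sum_(q <- cs) q.1 * pot q.2| <= B * eps + C * D.
Proof.
move=> l0 D0 s0 sC happ hB hpot.
have eps0 : 0 <= eps by apply: le_trans (happ 0); exact: normr_ge0.
have h1 : `|l^-1 * zero_pairing phi f - l^-1 * \sum_(q <- cs) q.1 * logpot f q.2 e| <= B * eps.
  rewrite -mulrBr normrM ger0_norm ?invr_ge0 ?(ltW l0)// ler_pdivrMl//.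
  apply: le_trans (zero_pairing_combo f s0 happ) _.
  by rewrite mulrA ler_wpM2r// mulrC.
have h2 : `|l^-1 * (\sum_(q <- cs) q.1 * logpot f q.2 e) - \sum_(q <- cs) q.1 * pot q.2| <= C * D.
  rewrite mulr_sumr -sumrB; apply: le_trans (ler_norm_sum _ _ _) _.
  apply: le_trans (ler_wpM2r D0 sC); rewrite mulr_suml.
  rewrite big_seq [leRHS]big_seq; apply: ler_sum => q qcs.
  by rewrite mulrCA -mulrBr normrM ler_wpM2l ?hpot.
set x := l^-1 * zero_pairing phi f in h1 *.
set y := l^-1 * _ in h1 h2.
rewrite -(subrK y x) -addrA; apply: le_trans (ler_normD _ _) _.
exact: lerD.
Qed.

End Deterministic.

Section SmallEvents.
Context {R : realType} d (Omega : measurableType d) (P : probability Omega R).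

Lemma probability_cvg0 (E : nat -> set Omega) : (forall n, measurable (E n)) ->
  (forall eta : R, 0 < eta -> \forall n \near \oo, (P (E n) <= eta%:E)%E) ->
  P (E n) @[n --> \oo] --> 0%E.
Proof.
move=> mE h; apply/fine_cvgP; split; first by apply: nearW => n; exact: fin_num_measure.
apply/cvgrPdist_le => eta eta0; apply: filterS (h _ eta0) => n hn.
rewrite sub0r normrN ger0_norm ?fine_ge0// -lee_fin fineK//.
exact: fin_num_measure.
Qed.

Lemma small_union (I : eqType) (s : seq I) (E : nat -> I -> set Omega) :
  (forall n i, measurable (E n i)) ->
  (forall i, i \in s -> forall eta : R, 0 < eta -> \forall n \near \oo, (P (E n i) <= eta%:E)%E) ->
  forall eta : R, 0 < eta ->
  \forall n \near \oo, (P (\big[setU/set0]_(i <- s) E n i) <= eta%:E)%E.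
Proof.
move=> mE; elim: s => [|i s IH] h eta eta0.
  by apply: nearW => n; rewrite big_nil measure0 lee_fin ltW.
have e20 : 0 < eta / 2 by rewrite divr_gt0.
have := IH _ _ e20; move/(_ (fun j js => h j (mem_behead (s := i :: s) js))).
apply: filterS2 (h i (mem_head _ _) _ e20) => n h1 h2; rewrite big_cons.
apply: le_trans (measureU2 _ _ _) _ => //; first by apply: bigsetU_measurable.
by rewrite [eta]splitr EFinD; exact: leeD.
Qed.

Lemma not_in_bigU (I : eqType) (s : seq I) (E : I -> set Omega) w :
  ~ (\big[setU/set0]_(i <- s) E i) w -> forall i, i \in s -> ~ E i w.
Proof.
elim: s => // j s IH; rewrite big_cons => h i; rewrite in_cons => /orP[/eqP ->|].
  by move=> hj; apply: h; left.
by apply: IH => hs; apply: h; right.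
Qed.

End SmallEvents.

Section Convergence.
Context {R : realType} d (Omega : measurableType d) (P : probability Omega R).
Context (xi : nat -> Omega -> R * R) (mxi : forall k, measurable_fun setT (xi k)).
Context (xi_ind : forall (n : nat) (A : nat -> set (R * R)), (forall k, measurable (A k)) ->
     P [set w | forall k, (k < n)%N -> xi k w \in A k]
     = (\prod_(k < n) P (xi k @^-1` A k))%E)
  (xi_id : forall k (A : set (R * R)), measurable A ->
     P (xi k @^-1` A) = P (xi 0%N @^-1` A))
  (xi_nd : ~ (exists c : R * R, P (xi 0%N @^-1` [set c]) = 1%E))
  (xi_log : (\int[P]_w (ln (1 + cmod (xi 0%N w)))%:E < +oo)%E).
Context (p : R -> R) (T0 : R).
Context (p_ge0 : forall t, 0 <= t -> 0 <= p t) (T0_gt0 : 0 < T0)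
  (p_gt0 : forall t, 0 <= t < T0 -> 0 < p t)
  (p_out : forall t, T0 < t -> p t = 0)
  (p_cont : {within `[0, T0], continuous p}).
Context (L : nat -> nat) (delta : nat -> R) (N : nat -> nat) (pc : nat -> nat -> R[i]).
Context (L_gt0 : forall n, (0 < L n)%N) (L_oo : L @ \oo --> \oo)
  (delta_bd : forall n, - T0 < delta n < T0) (delta0 : delta @ \oo --> 0)
  (NE : forall n, (N n)%:R = (T0 - delta n) * (L n)%:R)
  (pc_cvg : forall eps : R, 0 < eps -> \forall n \near \oo, forall k : nat, (k <= N n)%N ->
     `| powR (cabs (pc k n)) (L n)%:R^-1 - p (Num.min (k%:R / (L n)%:R) T0) | <= eps).

Local Notation F n w := (Fpoly N pc n (fun k => toC (xi k w))).

(** The bad event joins the growth event with one low event per centre. The tolerance is [2 * del]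
    because from above both [poly_upper] and the enlargement of the radius by [e] cost [del]. *)
Lemma radial_pot_close (s : seq R[i]) (e del : R) : all (fun z => z != 0) s ->
  0 < e -> 0 < del ->
  (forall x h, 0 <= x -> 0 <= h <= e -> radial_pot p (x + h) <= radial_pot p x + del) ->
  forall eta : R, 0 < eta -> exists E : nat -> set Omega,
  (forall n, measurable (E n)) /\
  \forall n \near \oo, (P (E n) <= eta%:E)%E /\ forall w, ~ E n w -> forall z, z \in s ->
    `|(L n)%:R^-1 * logpot (F n w) z e - radial_pot p (cabs z)| <= 2 * del.
Proof.
move=> /allP s0 e0 del0 hdel eta eta0; have e20 : 0 < eta / 2 by rewrite divr_gt0.
have LR n : 0 < (L n)%:R :> R by rewrite ltr0n.
have [C NC] : exists C : nat, forall n, (N n < C * L n)%N.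
  (* [delta n > - T0] gives [N n < 2 * T0 * L n]. *)
  exists (Num.truncn (2 * T0)).+1 => n; rewrite -(ltr_nat R) natrM NE ltr_pM2r//.
  apply: lt_trans (truncnS_gt _); have /andP[h _] := delta_bd n.
  by move: h; lra.
pose Rad := \sum_(z <- s) cabs z + e.
have hRad z : z \in s -> cabs z + e <= Rad.
  move=> zs; rewrite lerD2r (big_rem z)//= lerDl; apply: sumr_ge0 => y _; exact: cabs_ge0.
have d40 : 0 < del / 4 by rewrite divr_gt0.
have hup := poly_upper p_ge0 T0_gt0 p_gt0 p_out p_cont L_gt0 L_oo delta0 NE pc_cvg Rad del0 NC.
have hgr := growth_event_small mxi xi_id xi_log L_gt0 L_oo NC d40 e20.
pose Lo n z := low_event N pc xi n z (expR ((L n)%:R * (radial_pot p (cabs z) - del))).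
have mLo n z : measurable (Lo n z) by exact: measurable_low_event.
have hlo := @small_union R _ Omega P _ s Lo mLo (fun z zs eta' h' => poly_lower p_ge0 T0_gt0 p_gt0
  p_out p_cont L_gt0 L_oo delta0 NE pc_cvg mxi xi_ind xi_id xi_nd (s0 _ zs) del0 h') _ e20.
pose Gr n := growth_event xi (N n).+1 (del / 4 * (L n)%:R).
have mGr n : measurable (Gr n) by exact: measurable_growth_event.
pose U n := \big[setU/set0]_(z <- s) Lo n z.
have mU n : measurable (U n) by exact: bigsetU_measurable.
exists (fun n => Gr n `|` U n); split; first by move=> n; exact: measurableU.
apply: filterS3 hup hgr hlo => n hup hgr hlo; split.
  apply: le_trans (measureU2 _ (mGr n) (mU n)) _.
  by rewrite [eta]splitr EFinD; exact: leeD.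
move=> w hw z zs.
have nG : ~ Gr n w by move=> h; apply: hw; left.
have nL : ~ Lo n z w by apply: (@not_in_bigU _ _ _ s (Lo n)) => // h; apply: hw; right.
have hl : expR ((L n)%:R * (radial_pot p (cabs z) - del)) <= cabs (F n w).[z].
  by move: nL; rewrite /Lo /low_event /= => /negP; rewrite -leNgt.
have hu y : cabs y <= cabs z + e ->
    cabs (F n w).[y] <= expR ((L n)%:R * (radial_pot p (cabs z) + 2 * del)).
  move=> yz; apply: le_trans (hup _ (growth_eventN nG) y (le_trans yz (hRad z zs))) _.
  rewrite ler_expR ler_pM2l// (_ : _ + 2 * del = radial_pot p (cabs z) + del + del); last by ring.
  rewrite lerD2r; apply: le_trans (hdel (cabs z) e (cabs_ge0 _) _); last by rewrite lexx ltW.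
  exact: (radial_pot_mono p_ge0 T0_gt0 p_gt0 p_out p_cont (cabs_ge0 _)).
have /andP[h1 h2] := logpot_close (LR n) e0 hl hu.
by rewrite ler_distl; apply/andP; split; move: h1 h2 del0; lra.
Qed.

Lemma Fpoly_measurable n z : measurable_fun setT (fun w => cabs (F n w).[z]).
Proof. by under eq_fun do rewrite Fpoly_rsum; exact: measurable_rsum. Qed.

Context (mu : {measure set (R * R) -> \bar R}) (m : R -> R)
  (hm : forall s, minargmax p T0 s (m s))
  (mu_rot : forall (th : R) (A : set (R * R)), measurable A -> mu (rotation th @^-1` A) = mu A)
  (mu_disk : forall r, 0 < r -> mu (disk r) = (m (ln r))%:E) (mu_T : mu setT = T0%:E).

Lemma zeros_cvg (phi : R -> R -> R) (eps : R) :
  continuous (fun z : R * R => phi z.1 z.2) -> compact_support phi -> 0 < eps ->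
  P [set w | (eps%:E <= `| ((L n)%:R^-1 * zero_pairing phi (F n w))%:E
     - \int[mu]_z (phi z.1 z.2)%:E |)%E] @[n --> \oo] --> 0%E.
Proof.
move=> phic phis eps0.
have hF := potential_approx_test phic phis.
have bF : bdm (fun z : R * R => Cfun phi (toC z)).
  split; first exact: measurable_approx.
  by have [K _ hK] := uniform_cc_bounded (uniform_cc_continuous phic phis); exists K.
pose J := \int[mu]_z Cfun phi (toC z).
have JE : (\int[mu]_z (phi z.1 z.2)%:E = J%:E)%E.
  rewrite /J /Rintegral fineK//; apply: integrable_fin_num => //.
  exact: (bdm_integrable mu_T bF).
have mE n : measurable [set w | (eps%:E <= `| ((L n)%:R^-1 * zero_pairing phi (F n w))%:E
     - \int[mu]_z (phi z.1 z.2)%:E |)%E].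
  rewrite JE (_ : [set w | _] = (fun w => `|(L n)%:R^-1 * zero_pairing phi (F n w) - J|)
      @^-1` `[eps, +oo[%classic); last first.
    by apply/seteqP; split => w /=; rewrite in_itv /= andbT lee_fin.
  rewrite -[X in measurable X]setTI.
  suff mf : measurable_fun setT (fun w => `|(L n)%:R^-1 * zero_pairing phi (F n w) - J|) by exact: mf.
  apply: measurableT_comp => //; apply: measurable_funB; last exact: measurable_cst.
  apply: measurable_funM; first exact: measurable_cst.
  apply: (measurable_zero_pairing (T := (N n).+1)) => // [w|z].
    exact: size_poly.
  exact: Fpoly_measurable.
apply: probability_cvg0 => // eta eta0.
pose B : R := 2 * T0; have B0 : 0 < B by rewrite mulr_gt0.
(* The uniform error is paid by at most [B * L n] zeros and by the mass [T0] of [mu], in total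
   [eps / 4]. *)
pose epsA : R := eps / (4 * (B + T0)).
have BT0 : 0 < 4 * (B + T0) by rewrite mulr_gt0// addr_gt0.
have epsA0 : 0 < epsA by rewrite divr_gt0.
have [C C0 [e0 e00 hcs]] := hF _ epsA0.
(* The potentials contribute [C * (2 * del)] for the polynomial and [C * del] for [mu], together at
   most [eps / 4]; the sum [eps / 2] stays strictly below [eps]. *)
pose del : R := eps / (12 * (C + 1)).
have C120 : 0 < 12 * (C + 1) by rewrite mulr_gt0// ltr_wpDl.
have del0 : 0 < del by rewrite divr_gt0.
have [h h0 hh] := radial_pot_unif p_ge0 T0_gt0 p_gt0 p_out p_cont del0.
(* Small enough for the approximation and for the modulus of continuity; only now are the centres
   [cs] known. *)
have [e [ep ee0 eh]] : exists e : R, [/\ 0 < e, e < e0 & e <= h].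
  by have [e0h|he0] := leP e0 h; [exists (e0 / 2)|exists (h / 2)]; split; lra.
have ee : 0 < e < e0 by rewrite ep.
have [cs [csn s0 sC happ]] := hcs e ee.
have hdel (x h' : R) : 0 <= x -> 0 <= h' <= e -> radial_pot p (x + h') <= radial_pot p x + del.
  by move=> x0 /andP[h1 h2]; apply: hh => //; rewrite h1 (le_trans h2).
have sn : all (fun z => z != 0) [seq q.2 | q <- cs] by rewrite all_map.
have [E [mEE hE]] := radial_pot_close sn ep del0 hdel eta0.
have tau_bd (r : R) : 0 < r -> 0 <= m (ln r) <= T0 by move=> _; have [] := hm (ln r).
have I_slope (s t : R) : t <= s ->
    m (ln (expR t)) * (s - t) <= I_LF p s - I_LF p t <= m (ln (expR s)) * (s - t).
  by move=> _; rewrite !expRK; exact: (I_LF_slope p_ge0 T0_gt0 p_gt0 p_out p_cont).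
have rpE (z : R[i]) : z != 0 -> radial_pot p (cabs z) = I_LF p (ln (cabs z)).
  by rewrite -cabs_gt0 => z0; rewrite /radial_pot gt_eqF.
have hI := integral_combo mu_T mu_rot mu_disk tau_bd I_slope bF ep csn s0 sC happ (ltW del0).
have {}hI : `|J - \sum_(q <- cs) q.1 * radial_pot p (cabs q.2)| <= T0 * epsA + C * del.
  rewrite (_ : \sum_(q <- cs) _ = \sum_(q <- cs) q.1 * I_LF p (ln (cabs q.2))).
    apply: hI => z z0; have cz : 0 < cabs z by rewrite cabs_gt0.
    have := hdel (cabs z) e (cabs_ge0 z); rewrite lexx (ltW ep) => /(_ isT).
    by rewrite rpE// /radial_pot gt_eqF// ltr_wpDl// ltW.
  rewrite big_seq [RHS]big_seq; apply: eq_bigr => q qcs.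
  by rewrite rpE//; exact: (allP csn _ qcs).
apply: filterS hE => n [PE hn]; apply: le_trans PE; apply: le_measure; rewrite ?inE//.
move=> w /=; rewrite JE lee_fin => hw; apply: contrapT => nE.
have LR : 0 < (L n)%:R :> R by rewrite ltr0n.
have szF : (size (F n w)).-1%:R <= B * (L n)%:R.
  apply: (@le_trans _ _ (N n)%:R); last first.
    by rewrite NE ler_pM2r//; have /andP[d1 _] := delta_bd n; move: d1; rewrite /B; lra.
  by rewrite ler_nat -[leqRHS]/((N n).+1.-1) -!subn1 leq_sub2r// size_poly.
have hz := zero_pairing_close LR (D := 2 * del) (pot := fun z => radial_pot p (cabs z)) _ s0 sC happ szF _.
have {}hz : `|(L n)%:R^-1 * zero_pairing phi (F n w) -
    \sum_(q <- cs) q.1 * radial_pot p (cabs q.2)| <= B * epsA + C * (2 * del).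
  apply: hz; first by rewrite mulr_ge0// ltW.
  by move=> q qcs; apply: hn => //; apply: map_f.
have hAe : (B + T0) * epsA = eps / 4.
  by rewrite /epsA; field; rewrite gt_eqF// addr_gt0.
have hCd : C * del <= eps / 12.
  rewrite /del mulrA ler_pdivrMr// (_ : eps / 12 * (12 * (C + 1)) = C * eps + eps); last by field.
  by rewrite lerDl ltW.
move: hw; set x := _ * zero_pairing _ _ in hz *; set S := \sum_(q <- cs) _ in hz hI.
have -> : x - J = (x - S) - (J - S) by rewrite opprB addrA subrK.
move=> /le_trans /(_ (ler_normB _ _)) hw.
move: hz hI hw hAe hCd eps0; lra.
Qed.

End Convergence.

Unset Implicit Arguments. Set Strict Implicit. Set Printing Implicit Defensive.

Theorem theorem2
  (R : realType) (d : measure_display) (Omega : measurableType d)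
  (P : probability Omega R)
  (* xi k = (Re xi_k, Im xi_k) : complex random variables *)
  (xi : nat -> Omega -> R * R)
  (p : R -> R) (T0 : R) (L : nat -> nat) (delta : nat -> R)
  (N : nat -> nat) (pc : nat -> nat -> R[i]) :
  (* measurability *)
  (forall k, measurable_fun setT (xi k)) ->
  (* mutual independence *)
  (forall (n : nat) (A : nat -> set (R * R)), (forall k, measurable (A k)) ->
     P [set w | forall k, (k < n)%N -> xi k w \in A k]
     = (\prod_(k < n) P (xi k @^-1` A k))%E) ->
  (* identically distributed *)
  (forall k (A : set (R * R)), measurable A ->
     P (xi k @^-1` A) = P (xi 0%N @^-1` A)) ->
  (* nondegenerate *)
  ~ (exists c : R * R, P (xi 0%N @^-1` [set c]) = 1%E) ->
  (* P(xi_0 = 0) = 0 *)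
  P (xi 0%N @^-1` [set (0, 0)]) = 0%E ->
  (* E log(1 + |xi_0|) < oo *)
  (\int[P]_w (ln (1 + cmod (xi 0%N w)))%:E < +oo)%E ->
  (* p : [0,oo) -> [0,oo) *)
  (forall t, 0 <= t -> 0 <= p t) ->
  0 < T0 ->
  (forall n, (0 < L n)%N) ->
  L @ \oo --> \oo ->
  (forall n, - T0 < delta n < T0) ->
  delta @ \oo --> 0 ->
  (* N n = (T0 - delta n) L n, an integer *)
  (forall n, (N n)%:R = (T0 - delta n) * (L n)%:R) ->
  (* (1) *)
  (forall t, 0 <= t < T0 -> 0 < p t) ->
  (forall t, T0 < t -> p t = 0) ->
  (* (2) *)
  {within `[0, T0], continuous p} ->
  (* (3) *)
  (forall eps : R, 0 < eps -> \forall n \near \oo, forall k : nat, (k <= N n)%N ->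
     `| powR (cabs (pc k n)) (L n)%:R^-1 - p (Num.min (k%:R / (L n)%:R) T0) | <= eps) ->
  exists mu : {measure set (R * R) -> \bar R},
    (* rotationally invariant *)
    (forall (th : R) (A : set (R * R)), measurable A ->
       mu (rotation th @^-1` A) = mu A) /\
    (* mu(D_r) = I'(log r), I' the left derivative of I *)
    (forall r : R, 0 < r -> exists l : R,
       (fun s => (I_LF p s - I_LF p (ln r)) / (s - ln r)) @ (ln r)^'- --> l
       /\ mu (disk r) = l%:E) /\
    (* (1/L_n) mu_{F_n} --> mu in probability *)
    (forall phi : R -> R -> R, smooth phi -> compact_support phi ->
     forall eps : R, 0 < eps ->
       (fun n => P [set w | (eps%:E <=
          `| ((L n)%:R^-1 * zero_pairing phi
                 (\poly_(k < (N n).+1) (toC (xi k w) * pc k n)))%:E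
             - \int[mu]_z (phi z.1 z.2)%:E |)%E]) @ \oo --> 0%E).
Proof.
move=> mxi xi_ind xi_id xi_nd _ xi_log p_ge0 T0_gt0 L_gt0 L_oo delta_bd delta0 NE p_gt0 p_out p_cont pc_cvg.
have [mu [m [hm mu_rot mu_disk mu_T]]] := exists_limit_measure p_ge0 T0_gt0 p_gt0 p_out p_cont.
exists mu; split; [exact: mu_rot|split=> [r r0|phi phi_smooth phi_cc eps eps0]].
  exists (m (ln r)); split; last exact: mu_disk.
  exact: (I_LF_left_derivative p_ge0 T0_gt0 p_gt0 p_out p_cont (hm (ln r))).
exact: (zeros_cvg mxi xi_ind xi_id xi_nd xi_log p_ge0 T0_gt0 p_gt0 p_out p_cont L_gt0 L_oo
  delta_bd delta0 NE pc_cvg hm mu_rot mu_disk mu_T (phi_smooth 0%N).1 phi_cc eps0).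
Qed.
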